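(* Let $(E,\rho)$ be a Polish metric space and let $\{X_t,\,t\ge 0\}$ be an $E$-valued Markov process on a probability space $(\Omega,\mathfrak F,\mathbb P)$ with transition probability semigroup $\{P^t,\,t\ge0\}$ and initial law $\mu_0$. Suppose that $\mu_0\in\mathcal P_1(E)$ and $\psi\in\mathrm{Lip}(E)$. Then, with hypotheses H0)–H3) as listed in the context: 1) (weak law of large numbers) If H0) and H1) hold, then there exists a unique invariant probability measure $\mu_*$ for $\{P^t\}$; it belongs to $\mathcal P_1(E)$, and $$\lim_{T\to+\infty}\frac1T\int_0^T\psi(X_s)\,ds=v_*\quad\text{in probability},$$ where $v_*:=\langle\mu_*,\psi\rangle$. 2) (existence of the asymptotic variance) If H0)–H3) hold, then there exists $\sigma\in[0,+\infty)$ such that $$\lim_{T\to+\infty}\frac1T\,\mathbb E\Big[\int_0^T\tilde\psi(X_s)\,ds\Big]^2=\sigma^2,$$ where $\tilde\psi(x):=\psi(x)-v_*$. 3) (central limit theorem) If H0)–H3) hold, then, with $\sigma$ as in 2), $$\lim_{T\to+\infty}\mathbb P\Big(\frac1{\sqrt T}\int_0^T\tilde\psi(X_s)\,ds<\xi\Big)=\Phi_\sigma(\xi),\quad\forall\,\xi\in\mathbb R,$$ where $\Phi_\sigma$ is the distribution function of a centered normal law with variance equal to $\sigma^2$.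
   Context: $\rho_{x_0}(x):=\rho(x,x_0)$; $B_R(x_0)$ is the open ball of radius $R$ centered at $x_0$. $C_b(E)$: bounded continuous real functions on $E$. $\mathrm{Lip}(E)$: Lipschitz real functions on $E$, with $\|f\|_L:=\sup_{x\ne y}|f(x)-f(y)|/\rho(x,y)$. $\langle\nu,f\rangle:=\int f\,d\nu$. $\mathcal P_1(E)$: Borel probability measures $\nu$ on $E$ with $\int\rho_{x_0}\,d\nu<\infty$ for some (hence all) $x_0\in E$, with the Wasserstein metric $d_1(\nu_1,\nu_2):=\sup_{\|f\|_L\le1}|\langle\nu_1,f\rangle-\langle\nu_2,f\rangle|$. $P^t(x,\cdot)=\delta_xP^t$ are the transition probabilities, $P^tf(x)=\int f(y)\,P^t(x,dy)$, and $\mu P^t$ is the measure with $\langle\mu P^t,f\rangle=\langle\mu,P^tf\rangle$ for bounded measurable $f$; $\mu$ is invariant if $\mu P^t=\mu$ for all $t\ge 0$. The process is Markov with respect to its natural filtration $\mathfrak F_t=\sigma(X_s,s\le t)$; $\mathbb E$ is the expectation corresponding to $\mathbb P$. Hypotheses: H0) $P^t(C_b(E))\subset C_b(E)$ for all $t\geq 0$, and $\lim_{t\to0+}P^tf(x)=f(x)$ for all $x\in E$, $f\in C_b(E)$. H1) $\mu P^t\in\mathcal P_1(E)$ for all $\mu\in\mathcal P_1(E)$, $t\ge 0$, and there exist $\hat c,\gamma>0$ such that $d_1(\mu P^t,\nu P^t)\le\hat c e^{-\gamma t}d_1(\mu,\nu)$ for all $t\ge0$ and $\mu,\nu\in\mathcal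 P_1(E)$. H2) For some (thus all) $x_0\in E$ there exists $\delta>0$ such that for all $R<+\infty$ and $T\ge0$, $\sup_{t\in[0,T]}\sup_{x\in B_R(x_0)}\int\rho_{x_0}^{2+\delta}(y)\,P^t(x,dy)<\infty$. H3) There exist $x_0\in E$ and $\delta>0$ such that $\sup_{t\ge0}\mathbb E\,\rho_{x_0}^{2+\delta}(X_t)<\infty$. The parameters $\delta$ in H2) and H3) are taken to be equal (by choosing the smaller one).
   Formalization: In 3), ξ = 0 is excluded when σ = 0, where the claim can fail (X_t = e^{-t}X_0 with X_0 = ±1, ψ = id); joint measurability of (s,ω) ↦ X_s(ω) is assumed, so that the time integrals are random variables. *)

(* Defs.v *)
From HB Require Import structures.
From mathcomp Require Import all_boot all_order all_algebra.
From mathcomp Require Import all_classical all_reals all_analysis measurable_realfun giry.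
Set Implicit Arguments.
Unset Strict Implicit.
Unset Printing Implicit Defensive.
Import Order.TTheory GRing.Theory Num.Theory.
Import numFieldNormedType.Exports.
Local Open Scope classical_set_scope.
Local Open Scope ring_scope.
Local Open Scope ereal_scope.

HB.mixin Record Topological_isSeparable T & Topological T := {
  separable_space : exists2 D : set T, countable D & dense D }.

#[short(type="polishMetricType")]
HB.structure Definition PolishMetric (R : numDomainType) :=
  { T of Metric R T & Complete T & Topological_isSeparable T }.

Definition borel {R : realType} (E : polishMetricType R) :=
  g_sigma_algebraType (@open E).

Section wasserstein.
Context {R : realType} {E : polishMetricType R}.

(* The pairs x = y contribute 0 / 0 = 0, hence do not change the supremum; they
   make it 0 (and not -oo) on a one-point space. *)
Definition lip_seminorm (f : E -> R) : \bar R :=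
  ereal_sup [set (`|f z.1 - f z.2| / mdist z.1 z.2)%:E | z in [set: E * E]].

Definition lipschitz_fun (f : E -> R) : Prop := lip_seminorm f < +oo.

Definition bounded_continuous (f : E -> R) : Prop :=
  continuous f /\ bounded_fun f.

Definition finite_first_moment (nu : probability (borel E) R) : Prop :=
  exists x0 : E, \int[nu]_x (mdist x x0)%:E < +oo.

(* Meaningful for measures with a finite first moment, for which Lipschitz
   functions are integrable. *)
Definition wasserstein (nu1 nu2 : probability (borel E) R) : \bar R :=
  ereal_sup [set (`| \int[nu1]_x f x - \int[nu2]_x f x |%R)%:E
            | f in [set f : E -> R | lip_seminorm f <= 1]].

End wasserstein.

Section kernel_action.
Context d d' (X : measurableType d) (Y : measurableType d') (R : realType).

Definition kernel_op (k : R.-pker X ~> Y) (f : Y -> R) (x : X) : R :=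
  (\int[k x]_y f y)%R.

Definition kernel_push (mu : probability X R) (k : R.-pker X ~> Y)
  (A : set Y) : \bar R := \int[mu]_x k x A.

Variables (mu : probability X R) (k : R.-pker X ~> Y).

Let kernel_push0 : kernel_push mu k set0 = 0.
Proof. by apply: integral0_eq => x _; rewrite measure0. Qed.

Let kernel_push_ge0 A : 0 <= kernel_push mu k A.
Proof. by apply: integral_ge0 => x _; exact: measure_ge0. Qed.

Let kernel_push_sigma_additive : semi_sigma_additive (kernel_push mu k).
Proof.
move=> F mF tF mUF; rewrite [X in _ --> X](_ : _ =
    \sum_(n <oo) kernel_push mu k (F n)); last first.
  rewrite /kernel_push -integral_nneseries//; last first.
    by move=> n; exact: measurable_kernel.
  apply: eq_integral => x _.
  by apply/esym/cvg_lim => //; exact: measure_semi_sigma_additive.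
by apply/cvg_ex; exists (\sum_(n <oo) kernel_push mu k (F n));
  exact: is_cvg_ereal_nneg_natsum.
Qed.

HB.instance Definition _ := isMeasure.Build _ _ _ (kernel_push mu k)
  kernel_push0 kernel_push_ge0 kernel_push_sigma_additive.

Let kernel_push_setT : kernel_push mu k [set: Y] = 1.
Proof.
rewrite /kernel_push; under eq_integral do rewrite prob_kernel.
by rewrite integral_cst//= mul1e probability_setT.
Qed.

HB.instance Definition _ := Measure_isProbability.Build _ _ _
  (kernel_push mu k) kernel_push_setT.

End kernel_action.

Section markov.
Context {R : realType} {E : polishMetricType R}.

(* Time is indexed by R; only nonnegative times are constrained or used, here
   and below. *)
Definition transition_semigroup (Pt : R -> R.-pker (borel E) ~> (borel E)) :
    Prop :=
  (forall x A, measurable A -> Pt 0%R x A = \d_x A) /\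
  (forall s t : R, (0 <= s)%R -> (0 <= t)%R -> forall x A, measurable A ->
    Pt (s + t)%R x A = kcomp_noparam (Pt s) (Pt t) x A).

(* Probability measures are functions on all sets, including non-measurable
   ones, hence equality of measures is stated on measurable sets. *)
Definition invariant_law (Pt : R -> R.-pker (borel E) ~> (borel E))
    (mu : probability (borel E) R) : Prop :=
  forall t : R, (0 <= t)%R -> kernel_push mu (Pt t) ≡μ mu.

Context {d : measure_display} {Omega : measurableType d}.
Variable P : probability Omega R.

(* Y is a version of the conditional probability P(B | G). *)
Definition is_cond_prob (G : set_system Omega) (B : set Omega)
    (Y : Omega -> \bar R) : Prop :=
  (forall U : set (\bar R), measurable U -> G (Y @^-1` U)) /\
  (forall A, G A -> \int[P]_(w in A) Y w = P (A `&` B)).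

Definition natural_filtration (X : R -> {RV P >-> borel E}) (t : R) :
    set_system Omega :=
  <<s \bigcup_(s in `[0%R, t]) preimage_set_system setT (X s) measurable >>.

(* Joint measurability makes the time integrals of psi(X_s) random variables. *)
Definition markov_process (X : R -> {RV P >-> borel E})
    (Pt : R -> R.-pker (borel E) ~> (borel E))
    (mu0 : probability (borel E) R) : Prop :=
  [/\ measurable_fun (`[0%R, +oo[ `*` [set: Omega] :
        set (measurableTypeR R * Omega)) (fun z => X z.1 z.2 : borel E),
      distribution P (X 0%R) ≡μ mu0 &
      forall s t : R, (0 <= s)%R -> (0 <= t)%R ->
        forall B : set (borel E), measurable B ->
        is_cond_prob (natural_filtration X s) (X (s + t)%R @^-1` B)
          (fun w => Pt t (X s w) B)].

Definition cvg_in_probability (Y : R -> Omega -> R) (l : R) : Prop :=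
  forall eps : R, (0 < eps)%R ->
    P [set w | (eps <= `|Y T w - l|)%R] @[T --> +oo%R] --> 0.

Definition time_integral (X : R -> {RV P >-> borel E}) (f : E -> R) (T : R)
    (w : Omega) : R :=
  (\int[lebesgue_measure]_(s in `[0, T]) f (X s w))%R.

End markov.

Section hypotheses.
Context {R : realType} {E : polishMetricType R}.
Variable Pt : R -> R.-pker (borel E) ~> (borel E).

Definition H0 : Prop :=
  (forall t : R, (0 <= t)%R -> forall f : E -> R,
    bounded_continuous f -> bounded_continuous (kernel_op (Pt t) f)) /\
  (forall (x : E) (f : E -> R), bounded_continuous f ->
    kernel_op (Pt t) f x @[t --> (0%R : R)^'+] --> f x).

Definition H1 : Prop :=
  (forall (t : R) (mu : probability (borel E) R), (0 <= t)%R ->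
    finite_first_moment mu -> finite_first_moment (kernel_push mu (Pt t))) /\
  (exists c gamma : R, [/\ (0 < c)%R, (0 < gamma)%R &
    forall (t : R) (mu nu : probability (borel E) R), (0 <= t)%R ->
      finite_first_moment mu -> finite_first_moment nu ->
      wasserstein (kernel_push mu (Pt t)) (kernel_push nu (Pt t)) <=
        (c * expR (- gamma * t))%:E * wasserstein mu nu]).

Definition H2 (delta : R) : Prop :=
  exists x0 : E, forall r T : R, (0 <= T)%R ->
    ereal_sup [set ereal_sup [set
        \int[Pt t x]_y (mdist y x0 `^ (2 + delta))%:E
      | x in ball x0 r] | t in `[0%R, T]] < +oo.

Definition H3 {d : measure_display} {Omega : measurableType d}
    (P : probability Omega R) (X : R -> {RV P >-> borel E}) (delta : R) : Prop :=
  exists x0 : E,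
    ereal_sup [set 'E_P[fun w => (mdist (X t w : E) x0 `^ (2 + delta))%R]
              | t in `[0%R, +oo[] < +oo.

End hypotheses.

(* normal_prob m 0 is by convention the uniform law on [0, 1], whereas the
   centered normal law with variance 0 is the Dirac mass at 0. *)
Definition normal_cdf {R : realType} (sigma xi : R) : \bar R :=
  if sigma == 0%R then \d_(0%R : R) `]-oo, xi]
  else normal_prob 0%R sigma `]-oo, xi].

(* Main.v *)
Require Import Defs.
From HB Require Import structures.
From mathcomp Require Import all_boot all_order all_algebra ring lra.
From mathcomp Require Import all_classical all_reals all_analysis measurable_realfun giry.

(** Contraction in the Wasserstein distance means, by duality, that the semigroup
    maps a Lipschitz function to one whose Lipschitz constant decays
    exponentially. Hence the laws started from a point form a Cauchy sequence
    against bounded Lipschitz functions; their limit is the invariant law, and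
    P^t f converges to its stationary mean at an exponential rate, with an error
    proportional to the distance of the starting point to a base point
    (invariant_exists, Pf_ergodic).

    For a centered Lipschitz g this makes the integral chi of P^t g over all
    times a Lipschitz function, a solution of the Poisson equation
    (chi_poisson). By the Markov property chi(X_b) - chi(X_a) plus the integral
    of g(X_s) over [a, b] is a martingale increment (ceq_increment). If g is
    bounded, the second moment of the integral over [0, T] is therefore of order
    T; truncating psi gives the law of large numbers in mean (wlln_L1).

    For the central limit theorem, the conditional second moment of the
    martingale increment over [a, b] is the integral of twice the correlation
    g chi along the process, up to bounded terms; since time averages of g chi
    converge, it is sigma^2 (b - a) up to an error which is small with respect to
    b - a on long intervals (sq_mart). The uniformly integrable squares provided
    by the moments of order 2 + delta make all truncations legitimate. This gives
    the variance, and then the Lindeberg exchange argument, run with the heat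
    flow of the indicator of a half line as test function on blocks of large
    fixed length, gives the limit law (lindeberg): no characteristic functions
    are needed. Starting the heat flow at a small positive variance makes the
    argument uniform in sigma, including sigma = 0.

    Conditioning is expressed by integrals over the events of the past (ceq). A
    nonlinear function of a time integral is not measurable with respect to the
    natural filtration in general, so that functionals which are limits in mean
    of measurable ones are used as weights (approx). *)

Set Implicit Arguments.
Unset Strict Implicit.
Unset Printing Implicit Defensive.
Import Order.TTheory GRing.Theory Num.Theory.
Import numFieldNormedType.Exports.
Local Open Scope classical_set_scope.
Local Open Scope ring_scope.

Local Notation L1 mu f := (integrable mu setT (EFin \o f)).
Local Notation Ex mu f := (Rintegral mu setT f).

Section integrals.
Context d (T : measurableType d) (R : realType).
Variable mu : {measure set T -> \bar R}.
Implicit Types f g h : T -> R.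

Lemma L1_meas f : L1 mu f -> measurable_fun setT f.
Proof. by move=> /measurable_int /measurable_EFinP. Qed.

Lemma L1_dom f g : measurable_fun setT f -> (forall x, `|f x| <= g x) ->
  L1 mu g -> L1 mu f.
Proof.
move=> mf fg ig; apply: le_integrable ig => //; first exact/measurable_EFinP.
by move=> x _ /=; rewrite lee_fin (le_trans (fg x))// ler_norm.
Qed.

Lemma L1D f g : L1 mu f -> L1 mu g -> L1 mu (fun x => f x + g x).
Proof. by move=> iF ig; exact: (integrableD measurableT iF ig). Qed.

Lemma L1B f g : L1 mu f -> L1 mu g -> L1 mu (fun x => f x - g x).
Proof. by move=> iF ig; exact: (integrableB measurableT iF ig). Qed.

Lemma L1N f : L1 mu f -> L1 mu (fun x => - f x).
Proof. by move=> iF; exact: (integrableN iF). Qed.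

Lemma L1Z k f : L1 mu f -> L1 mu (fun x => k * f x).
Proof. by move=> iF; exact: (integrableZl measurableT k iF). Qed.

Lemma L1_norm f : L1 mu f -> L1 mu (fun x => `|f x|).
Proof. by move=> iF; exact: (integrable_norm iF). Qed.

Lemma eq_L1 f g : f =1 g -> L1 mu f -> L1 mu g.
Proof. by move=> /funext ->. Qed.

Lemma eq_Ex f g : f =1 g -> Ex mu f = Ex mu g.
Proof. by move=> /funext ->. Qed.

Lemma L1_0 : L1 mu (fun=> 0).
Proof. exact: integrable0. Qed.

Lemma L1_sum (I : Type) (s : seq I) (F : I -> T -> R) :
  (forall i, L1 mu (F i)) -> L1 mu (fun x => \sum_(i <- s) F i x).
Proof.
move=> iF; elim: s => [|i s IH].
  by apply: (eq_L1 _ L1_0) => x; rewrite big_nil.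
by apply: (eq_L1 _ (L1D (iF i) IH)) => x; rewrite big_cons.
Qed.

Lemma ExD f g : L1 mu f -> L1 mu g ->
  Ex mu (fun x => f x + g x) = Ex mu f + Ex mu g.
Proof. by move=> iF ig; exact: RintegralD. Qed.

Lemma ExB f g : L1 mu f -> L1 mu g ->
  Ex mu (fun x => f x - g x) = Ex mu f - Ex mu g.
Proof. by move=> iF ig; exact: RintegralB. Qed.

Lemma ExZ k f : L1 mu f -> Ex mu (fun x => k * f x) = k * Ex mu f.
Proof. by move=> iF; exact: RintegralZl. Qed.

Lemma ExN f : L1 mu f -> Ex mu (fun x => - f x) = - Ex mu f.
Proof.
by move=> iF; rewrite -mulN1r -ExZ//; apply: eq_Ex => x; rewrite mulN1r.
Qed.

Lemma Ex0 : Ex mu (fun=> 0) = 0.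
Proof. by rewrite /Rintegral integral0. Qed.

Lemma Ex_sum (I : Type) (s : seq I) (F : I -> T -> R) :
  (forall i, L1 mu (F i)) ->
  Ex mu (fun x => \sum_(i <- s) F i x) = \sum_(i <- s) Ex mu (F i).
Proof.
move=> iF; elim: s => [|i s IH].
  by rewrite big_nil -[RHS]Ex0; apply: eq_Ex => x; rewrite big_nil.
rewrite big_cons -IH -ExD//; last exact: L1_sum.
by apply: eq_Ex => x; rewrite big_cons.
Qed.

Lemma Ex_ge0 f : (forall x, 0 <= f x) -> 0 <= Ex mu f.
Proof. by move=> f0; apply: Rintegral_ge0. Qed.

Lemma Ex_le f g : L1 mu f -> L1 mu g -> (forall x, f x <= g x) ->
  Ex mu f <= Ex mu g.
Proof. by move=> iF ig fg; apply: le_Rintegral. Qed.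

Lemma Ex_normr f : L1 mu f -> `|Ex mu f| <= Ex mu (fun x => `|f x|).
Proof. by move=> iF; apply: le_normr_Rintegral. Qed.

Lemma Ex_dom f g : measurable_fun setT f -> (forall x, `|f x| <= g x) ->
  L1 mu g -> `|Ex mu f| <= Ex mu g.
Proof.
move=> mf fg ig; have iF := L1_dom mf fg ig.
by apply: (le_trans (Ex_normr iF)); apply: Ex_le => //; exact: L1_norm.
Qed.

Lemma ExE f : L1 mu f -> (\int[mu]_x (f x)%:E)%E = (Ex mu f)%:E.
Proof. by move=> iF; rewrite fineK//; exact: integrable_fin_num. Qed.

Lemma L1_ge0 f : measurable_fun setT f -> (forall x, 0 <= f x) ->
  (\int[mu]_x (f x)%:E < +oo)%E -> L1 mu f.
Proof.
move=> mf f0 fi; apply/integrableP; split; first exact/measurable_EFinP.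
by under eq_integral do rewrite /= ger0_norm//.
Qed.

Lemma Ex_ae_eq f g : measurable_fun setT f -> measurable_fun setT g ->
  {ae mu, forall x, f x = g x} -> Ex mu f = Ex mu g.
Proof.
move=> mf mg fg; congr fine; apply: ae_eq_integral => //.
- exact/measurable_EFinP.
- exact/measurable_EFinP.
- by apply: filterS fg => x /= -> _.
Qed.

Lemma Ex_dct (f_ : nat -> T -> R) f g : (forall n, measurable_fun setT (f_ n)) ->
  (forall x, f_ n x @[n --> \oo] --> f x) ->
  (forall n x, `|f_ n x| <= g x) -> L1 mu g ->
  L1 mu f /\ Ex mu (f_ n) @[n --> \oo] --> Ex mu f.
Proof.
move=> mf ff fg ig.
have mF : measurable_fun setT f by apply: (measurable_fun_cvg mf) => x _.
have [] := @dominated_convergence _ T R mu setT measurableT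
  (fun n => EFin \o f_ n) (EFin \o f) (EFin \o g).
- by move=> n; apply/measurable_EFinP.
- exact/measurable_EFinP.
- by apply: aeW => x _; apply/fine_cvgP; split => /=; [apply: nearW|exact: ff].
- exact: ig.
- by apply: aeW => x n _; rewrite /= lee_fin.
move=> iF _ cF; split=> //.
by apply: fine_cvg; rewrite fineK//; exact: integrable_fin_num.
Qed.

End integrals.

Section finite_integrals.
Context d (T : measurableType d) (R : realType).
Variable mu : {finite_measure set T -> \bar R}.
Implicit Types f g h : T -> R.

Lemma L1_cst (k : R) : L1 mu (fun=> k).
Proof. by have := finite_measure_integrable_cst mu k measurableT. Qed.

Lemma L1_bounded f M : measurable_fun setT f -> (forall x, `|f x| <= M) -> L1 mu f.
Proof. by move=> mf fM; apply: (L1_dom mf fM); exact: L1_cst. Qed.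

Lemma L1_addcst f M : L1 mu f -> L1 mu (fun x => M + f x).
Proof. by move=> iF; apply: L1D => //; exact: L1_cst. Qed.

Lemma L1_mulbounded f g M : measurable_fun setT f -> (forall x, `|f x| <= M) -> L1 mu g ->
  L1 mu (fun x => f x * g x).
Proof.
move=> mf fM ig; apply: (@L1_dom _ _ _ mu _ (fun x => M * `|g x|)).
- by apply: measurable_funM => //; exact: L1_meas ig.
- by move=> x; rewrite normrM ler_wpM2r.
- by apply: L1Z; exact: L1_norm.
Qed.

End finite_integrals.

Section probability_integrals.
Context d (T : measurableType d) (R : realType).
Variable mu : probability T R.

Lemma Ex_cst (k : R) : Ex mu (fun=> k) = k.
Proof. by rewrite Rintegral_cst// [X in fine X]probability_setT mulr1. Qed.

End probability_integrals.

Section fubini.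
Context d1 d2 (T1 : measurableType d1) (T2 : measurableType d2) (R : realType).
Variable m1 : {sigma_finite_measure set T1 -> \bar R}.
Variable m2 : {sigma_finite_measure set T2 -> \bar R}.
Variable f : T1 * T2 -> R.
Hypothesis imf : L1 (m1 \x m2)%E f.

Let imfE : (m1 \x m2)%E.-integrable setT (EFin \o f). Proof. exact: imf. Qed.

Lemma L1_fubini1 : {ae m1, forall x, L1 m2 (fun y => f (x, y))}.
Proof. exact: (ae_integrable1 imfE). Qed.

Lemma L1_fubini2 : {ae m2, forall y, L1 m1 (fun x => f (x, y))}.
Proof. exact: (ae_integrable2 imfE). Qed.

Let ae_fineF : {ae m1, forall x, setT x ->
  fubini_F m2 (EFin \o f) x = (Ex m2 (fun y => f (x, y)))%:E}.
Proof. by apply: filterS L1_fubini1 => x /ExE <-. Qed.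

Let ae_fineG : {ae m2, forall y, setT y ->
  fubini_G m1 (EFin \o f) y = (Ex m1 (fun x => f (x, y)))%:E}.
Proof. by apply: filterS L1_fubini2 => x /ExE <-. Qed.

Lemma meas_fubini1 : measurable_fun setT (fun x => Ex m2 (fun y => f (x, y))).
Proof.
by apply: measurableT_comp => //; exact: (measurable_fubini_F imfE).
Qed.

Lemma meas_fubini2 : measurable_fun setT (fun y => Ex m1 (fun x => f (x, y))).
Proof.
by apply: measurableT_comp => //; exact: (measurable_fubini_G imfE).
Qed.

Lemma L1_Ex1 : L1 m1 (fun x => Ex m2 (fun y => f (x, y))).
Proof.
have [mF iF] := integrableP _ _ _ (integrable_fubini_F imfE).
apply/integrableP; split; first exact/measurable_EFinP/meas_fubini1.
rewrite (_ : integral _ _ _ = \int[m1]_x `|fubini_F m2 (EFin \o f) x|)%E//.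
apply/esym/ae_eq_integral => //.
- exact: measurableT_comp.
- by apply/measurableT_comp => //; exact/measurable_EFinP/meas_fubini1.
- by apply: filterS ae_fineF => x h /h ->.
Qed.

Lemma L1_Ex2 : L1 m2 (fun y => Ex m1 (fun x => f (x, y))).
Proof.
have mf : measurable_fun setT (EFin \o f) by exact: measurable_int imfE.
apply/integrableP; split; first exact/measurable_EFinP/meas_fubini2.
apply: le_lt_trans ((integrable21ltyP m1 m2 mf).1 imfE).
apply: ae_ge0_le_integral => //.
- by apply/measurableT_comp => //; exact/measurable_EFinP/meas_fubini2.
- by move=> y _; exact: integral_ge0.
- apply: (@measurable_fun_fubini_tonelli_G _ _ T1 T2 _ m1 (abse \o (EFin \o f))) => //.
  by apply: measurableT_comp. by move=> ?; exact: abse_ge0.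
- apply: filterS L1_fubini2 => y iy _ /=.
  rewrite (ExE (L1_norm iy)) lee_fin.
  exact: Ex_normr.
Qed.

Lemma Ex_fubini : Ex m1 (fun x => Ex m2 (fun y => f (x, y))) =
  Ex m2 (fun y => Ex m1 (fun x => f (x, y))).
Proof.
congr fine; transitivity (\int[m1]_x fubini_F m2 (EFin \o f) x)%E.
  apply/esym/ae_eq_integral => //.
  - exact: (measurable_fubini_F imfE).
  - exact/measurable_EFinP/meas_fubini1.
transitivity (\int[m2]_y fubini_G m1 (EFin \o f) y)%E.
  exact: (Fubini imfE).
apply/ae_eq_integral => //.
- exact: (measurable_fubini_G imfE).
- exact/measurable_EFinP/meas_fubini2.
Qed.

End fubini.

(** Uniformly bounded second marginal norms give joint integrability. *)
Lemma L1_prod d1 d2 (T1 : measurableType d1) (T2 : measurableType d2)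
    (R : realType) (m1 : {sigma_finite_measure set T1 -> \bar R})
    (m2 : {finite_measure set T2 -> \bar R}) (f : T1 * T2 -> R) (C : R) :
  measurable_fun setT f ->
  (forall y, L1 m1 (fun x => f (x, y))) ->
  (forall y, Ex m1 (fun x => `|f (x, y)|) <= C) ->
  L1 (m1 \x m2)%E f.
Proof.
move=> mf fi fC; apply/(integrable21ltyP _ _).
  exact/measurable_EFinP.
have intE y : (\int[m1]_x `|(EFin \o f) (x, y)| = (Ex m1 (fun x => `|f (x, y)|))%:E)%E.
  by rewrite -ExE//; exact: L1_norm.
under eq_integral do rewrite intE.
apply: (@le_lt_trans _ _ (\int[m2]_y `|C|%:E)%E).
  apply: ge0_le_integral => //.
  - by move=> y _; rewrite lee_fin Ex_ge0.
  - under eq_fun do rewrite -intE.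
    apply: (@measurable_fun_fubini_tonelli_G _ _ T1 T2 _ m1 (fun z => `|(EFin \o f) z|%E)) => //.
    by apply: measurableT_comp => //; exact/measurable_EFinP.
  - by move=> y _; rewrite lee_fin (le_trans (fC y))// ler_norm.
rewrite integral_cst// lte_mul_pinfty//.
by rewrite ltey_eq fin_num_measure.
Qed.

Section pushforward.
Context d1 d2 (T1 : measurableType d1) (T2 : measurableType d2) (R : realType).
Variables (mu : {measure set T1 -> \bar R}) (phi : T1 -> T2).
Hypothesis mphi : measurable_fun setT phi.
Variable f : T2 -> R.
Hypothesis mf : measurable_fun setT f.

Lemma L1_pushforward : L1 (pushforward mu phi) f <-> L1 mu (f \o phi).
Proof.
split => /integrableP[_ h]; apply/integrableP; split.
- by apply/measurable_EFinP; exact: measurableT_comp.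
- move: h; rewrite ge0_integral_pushforward//; apply: measurableT_comp => //.
  exact/measurable_EFinP.
- exact/measurable_EFinP.
- rewrite ge0_integral_pushforward//; apply: measurableT_comp => //.
  exact/measurable_EFinP.
Qed.

Lemma Ex_pushforward : L1 mu (f \o phi) ->
  fine (\int[pushforward mu phi]_y (f y)%:E)%E = Ex mu (f \o phi).
Proof.
by move=> fi; congr fine; rewrite integral_pushforward//; exact/measurable_EFinP.
Qed.

End pushforward.

Section time.
Context {R : realType}.
Local Notation TR := (measurableTypeR R).
Implicit Types (a b c h : R) (f g : TR -> R).

Lemma lebesgue_itv_lty a b : (@lebesgue_measure R `[a, b] < +oo)%E.
Proof. by rewrite lebesgue_measure_itv/=; case: ifP => // _; rewrite -EFinB ltry. Qed.

(** Time integrals over [a, b] are integrals with respect to a finite measure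
    on the whole line: joint integrability and Fubini then need no side
    conditions on the range of the time variable. *)
Definition tm a b : {finite_measure set TR -> \bar R} :=
  @mfrestr _ TR R `[a, b] lebesgue_measure
    (measurable_itv `[a, b]) (lebesgue_itv_lty a b).

Lemma tmE a b (A : set TR) : tm a b A = @lebesgue_measure R (A `&` `[a, b]).
Proof. by []. Qed.

Lemma tm_ge0E a b (f : TR -> \bar R) : measurable_fun setT f -> (forall x, 0 <= f x)%E ->
  (\int[tm a b]_x f x = \int[lebesgue_measure]_(x in `[a, b]) f x)%E.
Proof.
move=> mf f0.
rewrite -(@eq_measure_integral _ TR R `[a, b]%classic _ (tm a b)); last first.
  by move=> A mA /setIidPl AE; exact: (congr1 lebesgue_measure AE).
rewrite (@ge0_negligible_integral _ TR R (tm a b) setT (~` `[a, b]) f) => //.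
- by rewrite setTD setCK.
- exact: measurableC.
- by rewrite [LHS]tmE setICl measure0.
Qed.

Lemma tm_L1E a b f : measurable_fun setT f ->
  L1 (tm a b) f <-> lebesgue_measure.-integrable `[a, b] (EFin \o f).
Proof.
move=> mf; have mF : measurable_fun setT (EFin \o f) by exact/measurable_EFinP.
have maf : measurable_fun setT (fun x => `|(EFin \o f) x|)%E by exact: measurableT_comp.
split=> /integrableP[_ h]; apply/integrableP; split => //.
- exact: measurable_funTS.
- by rewrite -tm_ge0E.
- by rewrite tm_ge0E.
Qed.

Lemma Ex_tmE a b f : measurable_fun setT f ->
  Ex (tm a b) f = \int[lebesgue_measure]_(x in `[a, b]) f x.
Proof.
move=> mf; have mF : measurable_fun setT (EFin \o f) by exact/measurable_EFinP.
congr fine; rewrite integralE [RHS]integralE; congr (_ - _)%E.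
- by rewrite tm_ge0E//; exact: measurable_funepos.
- by rewrite tm_ge0E//; exact: measurable_funeneg.
Qed.

Lemma Ex_tm_cst a b k : a <= b -> Ex (tm a b) (fun=> k) = k * (b - a).
Proof.
move=> ab; rewrite Ex_tmE// Rintegral_cst// [X in fine X]lebesgue_measure_itv/= lte_fin.
case: ltP => [//|ba].
by have /eqP -> : a == b by [rewrite eq_le ab]; rewrite subrr.
Qed.

Lemma Ex_tm_le a b f g : L1 (tm a b) f -> L1 (tm a b) g ->
  (forall s, a <= s <= b -> f s <= g s) -> Ex (tm a b) f <= Ex (tm a b) g.
Proof.
move=> iF ig fg; have [mf mg] := (L1_meas iF, L1_meas ig).
by rewrite !Ex_tmE//; apply: le_Rintegral => //; exact/tm_L1E.
Qed.

Lemma Ex_tm_eq a b f g : measurable_fun setT f -> measurable_fun setT g ->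
  (forall s, a <= s <= b -> f s = g s) -> Ex (tm a b) f = Ex (tm a b) g.
Proof.
move=> mf mg fg; rewrite !Ex_tmE//; apply: eq_Rintegral => s.
by rewrite inE/= in_itv/=; exact: fg.
Qed.

Lemma L1_tm_dom a b f g : measurable_fun setT f -> L1 (tm a b) g ->
  (forall s, a <= s <= b -> `|f s| <= g s) -> L1 (tm a b) f.
Proof.
move=> mf ig fg; apply/tm_L1E => //.
move/(tm_L1E _ _ (L1_meas ig)) : ig; apply: le_integrable => //.
  by apply: measurable_funTS; exact/measurable_EFinP.
move=> s /=; rewrite in_itv/= => /fg h.
by rewrite lee_fin (le_trans h)// ler_norm.
Qed.

Lemma Ex_tm_dom a b f g : measurable_fun setT f -> L1 (tm a b) g ->
  (forall s, a <= s <= b -> `|f s| <= g s) -> `|Ex (tm a b) f| <= Ex (tm a b) g.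
Proof.
move=> mf ig fg; have iF := L1_tm_dom mf ig fg.
by apply: (le_trans (Ex_normr iF)); apply: Ex_tm_le => //; exact: L1_norm.
Qed.

Lemma Ex_tm_bound a b f M : a <= b -> measurable_fun setT f ->
  (forall s, a <= s <= b -> `|f s| <= M) -> `|Ex (tm a b) f| <= M * (b - a).
Proof.
move=> ab mf fM; rewrite -Ex_tm_cst//.
by apply: Ex_tm_dom => //; exact: L1_cst.
Qed.

Lemma L1_tm_sub a b a' b' f : a <= a' -> b' <= b -> L1 (tm a b) f -> L1 (tm a' b') f.
Proof.
move=> aa bb iF; have mf := L1_meas iF; apply/tm_L1E => //.
move/(tm_L1E _ _ mf) : iF; apply: integrableS => // s /=.
rewrite !in_itv/= => /andP[h1 h2].
by rewrite (le_trans aa)//= (le_trans h2).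
Qed.

Lemma Ex_tm_split a b c f : a <= b -> b <= c -> L1 (tm a c) f ->
  Ex (tm a c) f = Ex (tm a b) f + Ex (tm b c) f.
Proof.
move=> ab bc iF; have mf := L1_meas iF.
have iac := (tm_L1E _ _ mf).1 iF.
rewrite !Ex_tmE//; apply/eqP; rewrite addrC -subr_eq; apply/eqP.
rewrite (@Rintegral_itvB _ f (BLeft a) (BRight c) b)//.
rewrite Rintegral_itv_obnd_cbnd//.
by apply: integrableS iac => //; apply: subset_itvr; rewrite bnd_simp.
Qed.

Lemma tm_shift a b h (A : set TR) : measurable A ->
  tm (a + h) (b + h) A = pushforward (tm a b) ((fun s => s + h) : TR -> TR) A.
Proof.
move=> mA; rewrite /pushforward [LHS]tmE.
pose mu' : {measure set (measurableTypeR R) -> \bar R} :=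
  pushforward (@lebesgue_measure R) ((fun s => s + h) : TR -> TR).
have ms : measurable_fun setT ((fun s => s + h) : TR -> TR).
  exact: measurable_funD.
rewrite (@lebesgue_measure_unique R (mu' ms))//.
- congr (lebesgue_measure _); apply/seteqP; split => s /= [h1]; rewrite !in_itv/= !lerD2r => h2; split=> //.
- move=> _ [[x y]] _ <- /=.
  transitivity (@lebesgue_measure R `]x - h, y - h]).
    rewrite [LHS]lebesgue_measure_itv [RHS]lebesgue_measure_itv/= !lte_fin ltrD2r.
    by case: ifP => // _; rewrite -!EFinB; congr EFin; lra.
  congr (lebesgue_measure _); apply/seteqP.
  by split => s /=; rewrite !in_itv/= ltrBlDr lerBrDr.
- exact: measurableI.
Qed.

Lemma Ex_tm_shift a b h f : measurable_fun setT f -> L1 (tm (a + h) (b + h)) f ->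
  Ex (tm (a + h) (b + h)) f = Ex (tm a b) (fun s : TR => f (s + h)).
Proof.
move=> mf iF.
have ms : measurable_fun setT ((fun s => s + h) : TR -> TR).
  exact: measurable_funD.
rewrite -(Ex_pushforward ms mf).
  by congr fine; apply: eq_measure_integral => A mA _; exact: tm_shift.
apply/(L1_pushforward _ ms mf).
move: iF => /integrableP[mF ltF]; apply/integrableP; split => //.
move: ltF; rewrite (eq_measure_integral (pushforward (tm a b) ((fun s => s + h) : TR -> TR)))//.
by move=> A mA _; exact: tm_shift.
Qed.

End time.

Definition clamp {R : realType} (K y : R) : R := Num.max (- K) (Num.min K y).

Section clamp.
Context {R : realType}.
Implicit Types K y z : R.

Lemma clampP K y : 0 <= K ->
  [\/ y < - K /\ clamp K y = - K, (- K <= y /\ y <= K) /\ clamp K y = y |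
      K < y /\ clamp K y = K].
Proof.
move=> K0; rewrite /clamp; case: (leP K y) => ?.
  rewrite max_r; last lra.
  by have [->|Ky] := eqVneq K y; [apply: Or32; split => //; lra|apply: Or33; split; lra].
case: (leP (- K) y) => ?; first by apply: Or32; split; lra.
by apply: Or31; split.
Qed.

Lemma clamp_norm K y : 0 <= K -> `|clamp K y| <= K.
Proof.
move=> K0; rewrite ler_norml.
by have [[? ->]|[? ->]|[? ->]] := clampP y K0; apply/andP; split; lra.
Qed.

Lemma clamp_1lip K y z : 0 <= K -> `|clamp K y - clamp K z| <= `|y - z|.
Proof.
move=> K0; rewrite ler_norml; have := ler_norm (y - z); have := ler_norm (- (y - z)).
rewrite normrN; move: (`|_|) => D ? ?.
by have [[? ->]|[? ->]|[? ->]] := clampP y K0;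
   have [[? ->]|[? ->]|[? ->]] := clampP z K0; apply/andP; split; lra.
Qed.

Lemma clamp_id K y : `|y| <= K -> clamp K y = y.
Proof.
move=> yK; have K0 : 0 <= K by apply: le_trans yK.
move: yK; rewrite ler_norml => /andP[? ?].
by have [[? ->]|[? ->]|[? ->]] := clampP y K0; lra.
Qed.

Lemma clamp_le K y : 0 <= K -> `|clamp K y| <= `|y|.
Proof.
move=> K0; rewrite ler_norml; have := ler_norm y; have := ler_norm (- y).
rewrite normrN; move: (`|_|) => D ? ?.
by have [[? ->]|[? ->]|[? ->]] := clampP y K0; apply/andP; split; lra.
Qed.

(** The truncation error is the excess of |y| over K, itself a Lipschitz function. *)
Lemma clamp_err K y : 0 <= K -> `|y - clamp K y| = Num.max 0 (`|y| - K).
Proof.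
move=> K0; have [[? ->]|[? ->]|[? ->]] := clampP y K0.
- by rewrite opprK ltr0_norm ?(@ltr0_norm _ y) ?max_r; lra.
- by rewrite subrr normr0 max_l// subr_le0 ler_norml; apply/andP; split; lra.
- by rewrite gtr0_norm ?(@gtr0_norm _ y) ?max_r; lra.
Qed.

Lemma cvg_clamp y : clamp n%:R y @[n --> \oo] --> y.
Proof.
apply: cvg_near_cst.
near=> n; rewrite clamp_id//; near: n; exact: nbhs_infty_ger.
Unshelve. all: by end_near. Qed.

End clamp.

Section lipschitz.
Context {R : realType} {E : polishMetricType R}.
Implicit Types (f g : E -> R) (L K : R) (x y : E).

Definition lip L f := forall x y, `|f x - f y| <= L * mdist x y.

Lemma lip_seminormP L f : 0 <= L -> (lip_seminorm f <= L%:E)%E <-> lip L f.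
Proof.
move=> L0; split => [h x y|h].
  have [->|xy] := eqVneq x y; first by rewrite subrr normr0 mulr_ge0// mdist_ge0.
  have := ereal_sup_ubound; rewrite /ubound => ub.
  have : ((`|f x - f y| / mdist x y)%:E <= L%:E)%E.
    by apply: le_trans h; apply: ereal_sup_ubound; exists (x, y).
  by rewrite lee_fin ler_pdivrMr// mdist_gt0.
apply: ge_ereal_sup => _ [[x y] _ <-]/=; rewrite lee_fin.
have [->|xy] := eqVneq x y; first by rewrite mdistxx invr0 mulr0.
by rewrite ler_pdivrMr ?mdist_gt0.
Qed.

Lemma lipschitz_funP f : lipschitz_fun f -> exists2 L, 0 <= L & lip L f.
Proof.
rewrite /lipschitz_fun; case e : (lip_seminorm f) => [l| |]// _.
  exists `|l| => //; apply/lip_seminormP => //.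
  by rewrite e lee_fin ler_norm.
exists 0 => //; apply/lip_seminormP => //.
by rewrite e leNye.
Qed.

Lemma lip_cst k : lip 0 (fun=> k).
Proof. by move=> x y; rewrite subrr normr0 mul0r. Qed.

Lemma lip_le L L' f : L <= L' -> lip L f -> lip L' f.
Proof. by move=> LL h x y; rewrite (le_trans (h x y))// ler_wpM2r// mdist_ge0. Qed.

Lemma lipD L L' f g : lip L f -> lip L' g -> lip (L + L') (fun x => f x + g x).
Proof.
move=> hf hg x y; rewrite mulrDl (_ : _ - _ = (f x - f y) + (g x - g y)); last by ring.
by rewrite (le_trans (ler_normD _ _))// lerD.
Qed.

Lemma lipN L f : lip L f -> lip L (fun x => - f x).
Proof. by move=> h x y; rewrite -opprD normrN. Qed.

Lemma lipB L L' f g : lip L f -> lip L' g -> lip (L + L') (fun x => f x - g x).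
Proof. by move=> hf /lipN; exact: lipD. Qed.

Lemma lipBc L f k : lip L f -> lip L (fun x => f x - k).
Proof. by move=> hf x y; rewrite opprB addrA subrK. Qed.

Lemma lipZ L f k : lip L f -> lip (`|k| * L) (fun x => k * f x).
Proof. by move=> h x y; rewrite -mulrBr normrM -mulrA ler_wpM2l. Qed.

Lemma lip_comp L K f (h : R -> R) : 0 <= K -> (forall u v, `|h u - h v| <= K * `|u - v|) ->
  lip L f -> lip (K * L) (h \o f).
Proof.
by move=> K0 hh hf x y; rewrite (le_trans (hh _ _))// -mulrA ler_wpM2l.
Qed.

Lemma lip_comp1 L f (h : R -> R) : (forall u v, `|h u - h v| <= `|u - v|) ->
  lip L f -> lip L (h \o f).
Proof. by move=> hh hf x y; rewrite (le_trans (hh _ _)). Qed.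

Lemma lip_clamp L f K : 0 <= K -> lip L f -> lip L (fun x => clamp K (f x)).
Proof. by move=> K0; apply: lip_comp1 => u v; exact: clamp_1lip. Qed.

Lemma lip_norm L f : lip L f -> lip L (fun x => `|f x|).
Proof. by apply: lip_comp1 => u v; exact: ler_dist_dist. Qed.

Lemma lip_pos L f : lip L f -> lip L (fun x => Num.max 0 (f x)).
Proof.
apply: lip_comp1 => u v; have := ler_norm (u - v); have := ler_norm (- (u - v)).
rewrite normrN ler_norml; move: (`|_|) => D ? ?.
have max2 (w : R) : (0 <= w /\ Num.max 0 w = w) \/ (w < 0 /\ Num.max 0 w = 0).
  by case: (leP 0 w); [left|right].
by have [[? ->]|[? ->]] := max2 u; have [[? ->]|[? ->]] := max2 v;
   apply/andP; split; lra.
Qed.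

Lemma lip_min L f g : lip L f -> lip L g -> lip L (fun x => Num.min (f x) (g x)).
Proof.
move=> hf hg x y; have := hf x y; have := hg x y.
rewrite !ler_norml; move: (L * _) => D /andP[? ?] /andP[? ?].
have min2 (u v : R) : (u <= v /\ Num.min u v = u) \/ (v < u /\ Num.min u v = v).
  by case: (leP u v); [left|right].
by have [[? ->]|[? ->]] := min2 (f x) (g x);
   have [[? ->]|[? ->]] := min2 (f y) (g y); apply/andP; split; lra.
Qed.

Lemma lipM L K M N f g : 0 <= M -> 0 <= N -> lip L f -> lip K g ->
  (forall x, `|f x| <= M) -> (forall x, `|g x| <= N) ->
  lip (M * K + N * L) (fun x => f x * g x).
Proof.
move=> M0 N0 hf hg fM gN x y.
rewrite (_ : _ - _ = f x * (g x - g y) + g y * (f x - f y)); last by ring.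
rewrite (le_trans (ler_normD _ _))// mulrDl !normrM -!mulrA.
by apply: lerD; apply: ler_pM.
Qed.

Lemma lip_mdist o : lip 1 (fun x => mdist x o).
Proof.
move=> x y; rewrite mul1r ler_norml; have := metric_triangle x y o.
have := metric_triangle y x o; rewrite (metric_sym y x) => ? ?; apply/andP; split; lra.
Qed.

Lemma lip_growth L f o x : lip L f -> `|f x| <= `|f o| + L * mdist x o.
Proof.
move=> h; rewrite -[f x](subrK (f o)) (le_trans (ler_normD _ _))//.
by rewrite addrC lerD2l.
Qed.

Lemma lip_continuous L f : lip L f -> continuous f.
Proof.
move=> h x; apply/cvgrPdist_lt => e e0.
have L1 : 0 < `|L| + 1 by rewrite ltr_pwDr.
near=> y; apply: le_lt_trans (h x y) _.
have : mdist x y < e / (`|L| + 1).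
  near: y; have := @nbhsx_ballx _ E x (e / (`|L| + 1)) (divr_gt0 e0 L1).
  by rewrite ballEmdist.
rewrite ltr_pdivlMr// mulrC; apply: le_lt_trans.
by rewrite ler_wpM2r ?mdist_ge0//; have := ler_norm L; lra.
Unshelve. all: by end_near. Qed.

Lemma continuous_meas f : continuous f -> measurable_fun setT (f : borel E -> R).
Proof.
move=> cf; apply: (measurability _ (RGenOpens.measurableE R)).
move=> _ [_ [a [b ->] <-]]; rewrite setTI; apply: sub_sigma_algebra.
by apply: (@open_comp E R f) => [x _|]; [exact: cf|exact: interval_open].
Qed.

Lemma lip_meas L f : lip L f -> measurable_fun setT (f : borel E -> R).
Proof. by move=> /lip_continuous; exact: continuous_meas. Qed.

Lemma lip_bc L f M : lip L f -> (forall x, `|f x| <= M) -> bounded_continuous f.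
Proof.
move=> hf fM; split; first exact: lip_continuous hf.
exists M; split; first by rewrite num_real.
by move=> N MN x _ /=; rewrite (le_trans (fM x))// ltW.
Qed.

End lipschitz.

(** * Bounded Lipschitz functions determine a measure *)

Section open_approximation.
Context {R : realType} {E : polishMetricType R}.
Implicit Types (f g : E -> R) (L K : R) (x y : E) (G : set E).

(** Distance to the complement of G, cut off at 1 so that G = E needs no
    separate treatment. *)
Definition codist G x : R := inf ([set 1] `|` [set mdist x y | y in ~` G]).

Let codist_lb G x : has_lbound ([set 1] `|` [set mdist x y | y in ~` G]).
Proof. by exists 0 => _ [->|[y _ <-]]; [exact: ler01|exact: mdist_ge0]. Qed.

Let codist_inf G x : has_inf ([set 1] `|` [set mdist x y | y in ~` G]).
Proof. by split; [exists 1; left|exact: codist_lb]. Qed.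

Lemma codist_ge0 G x : 0 <= codist G x.
Proof.
by apply: lb_le_inf; [exists 1; left|move=> _ [->|[y _ <-]]; [exact: ler01|exact: mdist_ge0]].
Qed.

Lemma codist_out G x : ~ G x -> codist G x = 0.
Proof.
move=> Gx; apply/eqP; rewrite eq_le codist_ge0 andbT.
by apply: ge_inf; [exact: codist_lb|right; exists x => //; rewrite mdistxx].
Qed.

Lemma codist_gt0 G x : open G -> G x -> 0 < codist G x.
Proof.
move=> oG Gx; have /nbhs_ballP[e/= e0 xG] : nbhs x G by exact: open_nbhs_nbhs.
apply: (@lt_le_trans _ _ (Num.min 1 e)); first by rewrite lt_min ltr01.
apply: lb_le_inf; first by exists 1; left.
move=> _ [->|[y Gy <-]]; first by rewrite ge_min lexx.
rewrite ge_min; apply/orP; right; rewrite leNgt; apply/negP => xy.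
by apply: Gy; apply: xG; rewrite ballEmdist.
Qed.

Lemma lip_codist G : lip 1 (codist G).
Proof.
have half x y : codist G x <= codist G y + mdist x y.
  rewrite -lerBlDr; apply: lb_le_inf; first by exists 1; left.
  move=> _ [->|[z Gz <-]]; rewrite lerBlDr.
    rewrite (@le_trans _ _ 1)//; last by rewrite lerDl mdist_ge0.
    by apply: ge_inf; [exact: codist_lb|left].
  rewrite (@le_trans _ _ (mdist x z))//; last by rewrite addrC metric_triangle.
  by apply: ge_inf; [exact: codist_lb|right; exists z].
move=> x y; rewrite mul1r ler_norml lerBlDl (addrC _ (mdist _ _)) addrC half andbT.
by rewrite lerNl opprB lerBlDl metric_sym half.
Qed.

Definition bump G k x : R := Num.min 1 (k * codist G x).

Lemma bump_ge0 G k x : 0 <= k -> 0 <= bump G k x.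
Proof. by move=> k0; rewrite le_min ler01 mulr_ge0 ?codist_ge0. Qed.

Lemma bump_le1 G k x : bump G k x <= 1.
Proof. by rewrite ge_min lexx. Qed.

Lemma bump_out G k x : ~ G x -> bump G k x = 0.
Proof. by move=> Gx; rewrite /bump codist_out// mulr0 min_r. Qed.

Lemma lip_bump G k : lip `|k| (bump G k).
Proof.
apply: lip_min; first by apply: lip_le (lip_cst 1).
by have := lipZ k (lip_codist G); rewrite mulr1.
Qed.

Lemma bump_cvg G x : open G -> bump G n%:R x @[n --> \oo] --> (\1_G x : R).
Proof.
move=> oG; have [Gx|Gx] := pselect (G x); last first.
  rewrite indicE memNset//.
  by rewrite (_ : (fun _ => _) = fun=> 0)//; [exact: cvg_cst|apply/funext => n; exact: bump_out].
rewrite indicE mem_set//=; have d0 := codist_gt0 oG Gx.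
apply: cvg_near_cst; near=> n; rewrite /bump min_l// -ler_pdivrMr// mul1r.
by near: n; exact: nbhs_infty_ger.
Unshelve. all: by end_near. Qed.

End open_approximation.

Section determination.
Context {R : realType} {E : polishMetricType R}.
Implicit Types mu nu : probability (borel E) R.

Definition lip01 (f : E -> R) := (exists L, lip L f) /\ (forall x, 0 <= f x <= 1).

Lemma lip01_norm f : lip01 f -> forall x, `|f x| <= 1.
Proof. by move=> [_ h] x; have /andP[? ?] := h x; rewrite ger0_norm. Qed.

Lemma lip01_meas f : lip01 f -> measurable_fun setT (f : borel E -> R).
Proof. by move=> [[L h] _]; exact: lip_meas h. Qed.

Lemma lip01_L1 mu f : lip01 f -> L1 mu (f : borel E -> R).
Proof.
by move=> hf; apply: (@L1_bounded _ (borel E) R mu f 1 (lip01_meas hf)); exact: lip01_norm.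
Qed.

Lemma lip01_bump (G : set E) k : 0 <= k -> lip01 (bump G k).
Proof.
move=> k0; split; first by exists `|k|; exact: lip_bump.
by move=> x; rewrite bump_ge0 ?bump_le1.
Qed.

Lemma open_borel (G : set E) : open G -> measurable (G : set (borel E)).
Proof. by move=> oG; exact: sub_sigma_algebra. Qed.

Lemma open_Ex mu (G : set E) : open G -> (Ex mu (\1_G : borel E -> R))%:E = mu G.
Proof.
move=> oG; have mG := open_borel oG.
by rewrite -ExE ?integral_indic ?setIT//; exact: integrable_indic.
Qed.

Lemma lip_determination mu nu : (forall f, lip01 f -> Ex mu (f : borel E -> R) = Ex nu (f : borel E -> R)) ->
  forall A : set (borel E), measurable A -> mu A = nu A.
Proof.
move=> h; apply: (@measure_unique _ R (borel E) open (fun=> setT)) => //.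
- exact: openI.
- by move=> _; exact: openT.
- by rewrite bigcup_const.
- move=> G oG; rewrite -[LHS](open_Ex mu oG) -[RHS](open_Ex nu oG); congr EFin.
  have cv (m : probability (borel E) R) :
      Ex m (bump G n%:R : borel E -> R) @[n --> \oo] --> Ex m (\1_G : borel E -> R).
    apply: (@Ex_dct _ _ _ m _ _ (fun=> 1) _ _ _ _).2.
    - by move=> n; apply: lip01_meas; exact: lip01_bump.
    - by move=> x; exact: bump_cvg.
    - by move=> n x; apply: lip01_norm; exact: lip01_bump.
    - exact: L1_cst.
  rewrite -(cvg_lim (@Rhausdorff R) (cv mu)) -(cvg_lim (@Rhausdorff R) (cv nu)).
  by congr (lim (_ @ \oo)); apply/funext => n; apply: h; exact: lip01_bump.
- by move=> _; rewrite /= -ge0_fin_numE ?fin_num_measure.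
Qed.

End determination.

Section finite_nets.
Context {R : realType} {E : polishMetricType R}.
Implicit Types (f g : E -> R) (x y : E) (F : seq E) (e : R).

Definition netdist F e x : R := foldr (fun y a => Num.min (mdist x y) a) e F.

(** Equals 1 outside the e-neighbourhood of the finite set F and vanishes on its
    e/2-neighbourhood: its integral controls the mass far from F. *)
Definition farfrom F e x : R := Num.max 0 (2 / e * netdist F e x - 1).

Lemma netdist_le F e x : netdist F e x <= e.
Proof. by elim: F => //= y F IH; rewrite ge_min IH orbT. Qed.

Lemma netdist_mem F e x y : y \in F -> netdist F e x <= mdist x y.
Proof.
elim: F => //= z F IH; rewrite in_cons => /orP[/eqP ->|yF]; rewrite ge_min ?lexx//.
by rewrite IH ?orbT.
Qed.

Lemma netdist_lt F e x : netdist F e x < e -> exists2 y, y \in F & mdist x y < e.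
Proof.
elim: F => [|z F IH]/=; first by rewrite ltxx.
rewrite gt_min => /orP[xz|/IH[y yF xy]]; first by exists z; rewrite ?mem_head.
by exists y; rewrite ?in_cons ?yF ?orbT.
Qed.

Lemma lip_netdist F e : lip 1 (netdist F e).
Proof.
elim: F => [|z F IH]/=; first exact: lip_le ler01 (lip_cst e).
by apply: lip_min => //; exact: lip_mdist.
Qed.

Lemma lip_farfrom F e : 0 < e -> lip (2 / e) (farfrom F e).
Proof.
move=> e0; apply: lip_pos; apply: lipBc.
have := lipZ (2 / e) (lip_netdist F e); rewrite mulr1 ger0_norm//.
by rewrite divr_ge0// ltW.
Qed.

Lemma farfrom_ge0 F e x : 0 <= farfrom F e x.
Proof. by rewrite le_max lexx. Qed.

Lemma farfrom_le1 F e x : 0 < e -> farfrom F e x <= 1.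
Proof.
move=> e0; rewrite ge_max ler01/= lerBlDr mulrAC ler_pdivrMr//.
by have := netdist_le F e x; lra.
Qed.

Lemma lip01_farfrom F e : 0 < e -> lip01 (farfrom F e).
Proof.
move=> e0; split; first by exists (2 / e); exact: lip_farfrom.
by move=> x; rewrite farfrom_ge0 farfrom_le1.
Qed.

Lemma farfrom_lt1 F e x : 0 < e -> farfrom F e x < 1 -> exists2 y, y \in F & mdist x y < e.
Proof.
move=> e0; rewrite gt_max => /andP[_]; rewrite ltrBlDr mulrAC ltr_pdivrMr// => h.
by apply: netdist_lt; lra.
Qed.

Lemma farfrom_mem F e x y : 0 < e -> y \in F -> mdist x y < e / 2 -> farfrom F e x = 0.
Proof.
move=> e0 yF xy; apply: max_l; rewrite subr_le0 mulrAC ler_pdivrMr//.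
by have := netdist_mem e x yF; lra.
Qed.

Lemma ultra_net (U : set_system E) F e : UltraFilter U ->
  U [set z | exists2 y, y \in F & mdist z y < e] -> exists y, U (ball y e).
Proof.
move=> UU; elim: F => [|y F IH] h.
  by have [z [? //]] := @filter_ex _ _ _ _ h.
have [h1|h1] := in_ultra_setVsetC (ball y e) UU; first by exists y.
apply: IH; apply: filterS (filterI h h1) => z [[w wF zw]] yz.
exists w => //; move: wF; rewrite in_cons => /orP[/eqP wy|//].
by case: yz; rewrite ballEmdist/= metric_sym -wy.
Qed.

(** Compactness argument behind countable subadditivity: a sequence violating
    the inequality for every k would stay close to finite nets at every scale,
    hence would have a cluster point by completeness, and at this point one of
    the bumps would already exceed f. *)
Lemma net_cover (F_ : nat -> seq E) (e_ : nat -> R) (G_ : nat -> set E) f L eta :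
  (forall j, 0 < e_ j) -> (forall e, 0 < e -> exists j, e_ j < e) ->
  (forall i, open (G_ i)) -> lip L f -> (forall x, f x <= 1) ->
  (forall x, 0 < f x -> exists i, G_ i x) -> 0 < eta ->
  exists k : nat, forall x, f x <= \sum_(i < k) bump (G_ i) k%:R x + eta +
    \sum_(j < k) farfrom (F_ j) (e_ j) x.
Proof.
move=> e_0 e_cvg oG hf f1 fG eta0; apply: contrapT => /forallNP hk.
have /choice[x_ hx] : forall k : nat, exists x, \sum_(i < k) bump (G_ i) k%:R x + eta +
    \sum_(j < k) farfrom (F_ j) (e_ j) x < f x.
  by move=> k; have /existsNP[x /negP] := hk k; rewrite -ltNge => h; exists x.
have bsum_ge0 k x : 0 <= \sum_(i < k) bump (G_ i) k%:R x.
  by apply: sumr_ge0 => i _; exact: bump_ge0.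
have fsum_ge0 k x : 0 <= \sum_(j < k) farfrom (F_ j) (e_ j) x.
  by apply: sumr_ge0 => i _; exact: farfrom_ge0.
have [U [UU xU]] := @ultraFilterLemma _ (x_ @ \oo) _.
have UC : cauchy U.
  apply: cauchy_exP => e e0; have [j je] := e_cvg _ e0.
  have [|y Uy] := @ultra_net U (F_ j) (e_ j) UU; last first.
  - exists y; apply: filterS Uy; apply: le_ball; exact: ltW.
  - apply: xU; change (\forall k \near \oo, exists2 y, y \in F_ j & mdist (x_ k) y < e_ j).
    near=> k; have jk : (j < k)%N by near: k; exact: nbhs_infty_gt.
    apply: farfrom_lt1 => //; have := hx k; rewrite [X in _ + eta + X](bigD1 (Ordinal jk))//=.
    have := f1 (x_ k); have := bsum_ge0 k (x_ k).
    have : 0 <= \sum_(i < k | i != Ordinal jk) farfrom (F_ i) (e_ i) (x_ k).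
      by apply: sumr_ge0 => i _; exact: farfrom_ge0.
    by move: eta0; lra.
have /cvg_ex[x Ux] : cvg U by apply/cauchy_cvgP.
have fx : 0 < f x.
  rewrite ltNge; apply/negP => fx.
  have h1 : U [set z | f z < eta].
    apply: Ux; have /cvgrPdist_lt/(_ _ eta0) := (lip_continuous hf : continuous f) (x : E).
    apply: filterS => z /=; rewrite distrC => h; have := ler_norm (f z - f x); lra.
  have h2 : U [set z | eta < f z].
    apply: xU; change (\forall k \near \oo, eta < f (x_ k)); apply: nearW => k.
     have := hx k; have := bsum_ge0 k (x_ k).
    by have := fsum_ge0 k (x_ k); lra.
  by have [z [/=]] := @filter_ex _ _ _ _ (filterI h1 h2); lra.
have [i Gix] := fG _ fx; have r0 := codist_gt0 (oG i) Gix.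
set r := codist (G_ i) x in r0.
have h1 : U [set z | r / 2 < codist (G_ i) z].
  have r20 : 0 < r / 2 by rewrite divr_gt0.
  apply: Ux; have /cvgrPdist_lt/(_ _ r20) := (lip_continuous (lip_codist (G_ i)) : continuous _) (x : E).
  by apply: filterS => z /= h; have := ler_norm (codist (G_ i) x - codist (G_ i) z);
    rewrite -/r in h *; lra.
have h2 : U [set z | exists k : nat, [/\ (i < k)%N, 2 / r <= k%:R & z = x_ k]].
  apply: xU.
  change (\forall l \near \oo, exists k : nat, [/\ (i < k)%N, 2 / r <= k%:R & x_ l = x_ k]).
  near=> k; exists k; split => //; near: k.
    exact: nbhs_infty_gt.
  exact: nbhs_infty_ger.
have [z [/= + [k [ik rk zk]]]] := @filter_ex _ _ _ _ (filterI h1 h2).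
rewrite zk => rz.
have := hx k; rewrite [X in X + eta](bigD1 (Ordinal ik))//= [bump _ _ _]min_l; last first.
  have : 2 / r * (r / 2) <= k%:R * codist (G_ i) (x_ k).
    by rewrite ler_pM// ?divr_ge0// ltW.
  by rewrite (_ : 2 / r * (r / 2) = 1)//; field; rewrite gt_eqF.
have := fsum_ge0 k (x_ k); have := f1 (x_ k).
have : 0 <= \sum_(i0 < k | i0 != Ordinal ik) bump (G_ i0) k%:R (x_ k).
  by apply: sumr_ge0 => j _; exact: bump_ge0.
lra.
Unshelve. all: by end_near. Qed.

Lemma dense_sequence : E -> exists x_ : nat -> E, forall x e, 0 < e -> exists n, mdist x (x_ n) < e.
Proof.
move=> o; have [D cD dD] := @separable_space R E.
have Dx x e : 0 < e -> exists2 y, D y & mdist x y < e.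
  move=> e0; have [|y [xy Dy]] := dD (ball x e)° _ (@open_interior _ _).
    by exists x; apply: nbhs_singleton; apply: nbhs_interior; exact: nbhsx_ballx.
  by exists y => //; have := interior_subset xy; rewrite ballEmdist.
move: cD => /pfcard_geP[D0|[s]].
  by have [y] := Dx o 1 ltr01; rewrite D0.
exists s => x e e0; have [y Dy xy] := Dx x e e0.
by have [n _ sn] := 'surj_s Dy; exists n; rewrite sn.
Qed.

End finite_nets.

Lemma layer_sum (R : realType) (n : nat) (t : R) : 0 <= t ->
  \sum_(i < n) Num.min 1 (Num.max 0 (t - i%:R)) = Num.min t n%:R.
Proof.
move=> t0; elim: n => [|n IH]; first by rewrite big_ord0 min_r.
rewrite big_ord_recr/= IH -natr1.
have [tn|nt] := leP t n%:R.
  rewrite (@max_l _ _ 0 (t - n%:R)) ?subr_le0// (@min_r _ _ 1 0)//.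
  by rewrite (@min_l _ _ t) ?addr0//; lra.
rewrite (@max_r _ _ 0 (t - n%:R)) ?subr_ge0 1?ltW//.
have [h|h] := leP 1 (t - n%:R); first by rewrite (@min_r _ _ t) ; lra.
by rewrite (@min_l _ _ t); lra.
Qed.

Lemma layer_count (R : realType) (n : nat) (t : R) : 0 <= t ->
  Num.min t n%:R <= \sum_(i < n) ((i%:R < t)%R)%:R <= t + 1.
Proof.
move=> t0; suff /and3P[-> -> _] : [&& Num.min t n%:R <= \sum_(i < n) ((i%:R < t)%R)%:R,
  \sum_(i < n) ((i%:R < t)%R)%:R <= t + 1 & \sum_(i < n) ((i%:R < t)%R)%:R <= n%:R :> R] by [].
elim: n => [|n /and3P[h1 h2 h3]]; first by rewrite big_ord0 lexx !addr_ge0// ge_min lexx orbT.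
rewrite big_ord_recr/= -natr1; have [nt|tn] := ltP n%:R t.
  have h1p : n%:R <= \sum_(i < n) ((i%:R < t)%R)%:R :> R by move: h1; rewrite (min_r (ltW nt)).
  rewrite (_ : true%:R = 1 :> R)//.
  by apply/and3P; split; [rewrite ge_min; apply/orP; right| |]; lra.
rewrite (_ : false%:R = 0 :> R)//.
move: h1; rewrite min_l// => h1; rewrite addr0; apply/and3P; split => //.
  by rewrite ge_min h1.
by rewrite (le_trans h3)// lerDl.
Qed.

Section weak_limit.
Context {R : realType} {E : polishMetricType R}.
Variables (mu_ : nat -> probability (borel E) R) (o : E).
Hypothesis cau : forall e : R, 0 < e -> exists N : nat, forall n m, (N <= n)%N -> (N <= m)%N ->
  forall f : E -> R, lip 1 f -> (forall x, 0 <= f x <= 1) ->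
  `|Ex (mu_ n) (f : borel E -> R) - Ex (mu_ m) (f : borel E -> R)| <= e.
Implicit Types (f g : E -> R) (G : set E) (e : R).

Local Notation I n f := (Ex (mu_ n) (f : borel E -> R)).

Let cauK K e : 1 <= K -> 0 < e -> exists N : nat, forall n m, (N <= n)%N -> (N <= m)%N ->
  forall f, lip K f -> (forall x, 0 <= f x <= 1) -> `|I n f - I m f| <= e.
Proof.
move=> K1 e0; have K0 : 0 < K by apply: lt_le_trans K1.
have [N hN] := cau (divr_gt0 e0 K0); exists N => n m Nn Nm f hf f01.
have := hN n m Nn Nm (fun x => K^-1 * f x) _ _.
have fL l : L1 (mu_ l) (f : borel E -> R) by apply: lip01_L1; split => //; exists K.
rewrite !ExZ ?fL// -mulrBr normrM gtr0_norm ?invr_gt0// ler_pdivlMr// mulrAC mulVf ?gt_eqF// mul1r.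
apply.
  have := lipZ K^-1 hf; rewrite gtr0_norm ?invr_gt0//.
  by rewrite mulVf ?gt_eqF.
move=> x; have /andP[f0 f1] := f01 x.
have Ki0 : 0 <= K^-1 by rewrite invr_ge0 ltW.
by rewrite mulr_ge0//= mulr_ile1// invf_le1.
Qed.

Let is_cvgI f : lip01 f -> cvgn (fun n => I n f).
Proof.
move=> [[L hf] f01]; apply/cauchy_cvgP/cauchy_exP => e e0.
have LL : 1 <= `|L| + 1 by rewrite lerDr.
have e20 : 0 < e / 2 by rewrite divr_gt0.
have [N hN] := cauK LL e20.
exists (I N f); change (\forall n \near \oo, ball (I N f) e (I n f)).
near=> n; rewrite -ball_normE/=.
rewrite (@le_lt_trans _ _ (e / 2))//; last by lra.
apply: hN => //; first by near: n; exact: nbhs_infty_ge.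
by apply: lip_le hf; have := ler_norm L; lra.
Unshelve. all: by end_near. Qed.

Let Lam f : R := limn (fun n => I n f).

Let Lam_cvg f : lip01 f -> I n f @[n --> \oo] --> Lam f.
Proof. exact: is_cvgI. Qed.

Let Lam_le f a : lip01 f -> (forall n, I n f <= a) -> Lam f <= a.
Proof.
move=> hf ha; apply: limr_le; first exact: is_cvgI.
exact: nearW.
Qed.

Let Lam_ge f a : lip01 f -> (forall n, a <= I n f) -> a <= Lam f.
Proof.
move=> hf ha; apply: limr_ge; first exact: is_cvgI.
exact: nearW.
Qed.

Let Lam_sum (k : nat) (F : nat -> E -> R) : (forall i, lip01 (F i)) ->
  (\sum_(i < k) I n (F i)) @[n --> \oo] --> \sum_(i < k) Lam (F i).
Proof.
move=> hF; elim: k => [|k IH].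
  by under eq_fun do rewrite big_ord0; rewrite big_ord0; exact: cvg_cst.
under eq_fun do rewrite big_ord_recr; rewrite big_ord_recr.
by apply: cvgD => //; exact: Lam_cvg.
Qed.

(** Asymptotic tightness: the mass far from a suitable finite set is small,
    uniformly in n; finitely many indices are handled by separability, the
    others by comparison with one of them. *)
Let tight e : 0 < e -> exists F : seq E, forall n, I n (farfrom F e) <= e.
Proof.
move=> e0; have [x_ dx] := dense_sequence o.
pose F_ k := map x_ (iota 0 k); pose phi k := farfrom (F_ k) e.
have phi_cvg n : I n (phi k) @[k --> \oo] --> (0 : R).
  rewrite -(Ex0 (mu_ n)); apply: (@Ex_dct _ _ _ (mu_ n) _ _ (fun=> 1) _ _ _ _).2.
  - by move=> k; apply: lip01_meas; exact: lip01_farfrom.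
  - move=> x; apply: cvg_near_cst; have e20 : 0 < e / 2 by rewrite divr_gt0.
    have [m xm] := dx x _ e20; near=> k; apply: (farfrom_mem e0 _ xm).
    by apply: map_f; rewrite mem_iota/= add0n; near: k; exact: nbhs_infty_gt.
  - by move=> k x; apply: lip01_norm; exact: lip01_farfrom.
  - exact: L1_cst.
have K1 : 1 <= 2 / e + 1 by rewrite lerDr divr_ge0// ltW.
have e20 : 0 < e / 2 by rewrite divr_gt0.
have [N hN] := cauK K1 e20.
have small : \forall k \near \oo, forall n : 'I_N.+1, I n (phi k) < e / 2.
  apply: filter_forall => n; have /cvgrPdist_lt/(_ _ e20) := phi_cvg n.
  apply: filterS => k; rewrite sub0r normrN; apply: le_lt_trans; exact: ler_norm.
have [k _ hk] := small; exists (F_ k) => n; have {}hk := hk k (leqnn _).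
have [nN|Nn] := leqP n N.
  have nN1 : (n < N.+1)%N by [].
  by have := hk (Ordinal nN1); rewrite /= -/(phi k); lra.
have := hN n N (ltnW Nn) (leqnn _) (phi k) _ _.
have := hk ord_max; rewrite /= -/(phi k) => hk1 h.
have {}h : `|I n (phi k) - I N (phi k)| <= e / 2.
  apply: h; last by move=> x; rewrite farfrom_ge0 farfrom_le1.
  by apply: lip_le (lip_farfrom _ e0); rewrite lerDl.
have := ler_norm (I n (phi k) - I N (phi k)); lra.
Unshelve. all: by end_near. Qed.

Let below G f := lip01 f /\ forall x, ~ G x -> f x = 0.

Let lam G : \bar R := ereal_sup [set (Lam f)%:E | f in below G].

Let nu (A : set E) : \bar R := ereal_inf [set lam G | G in [set G | open G /\ A `<=` G]].

Let lip010 : @lip01 R E (fun=> 0).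
Proof. by split => [|x]; [exists 0; exact: lip_cst|rewrite lexx ler01]. Qed.

Let Lam0 : Lam (fun=> 0) = 0.
Proof.
rewrite /Lam (_ : (fun n : nat => _) = fun=> 0); first exact: lim_cst.
by apply/funext => n; exact: Ex0.
Qed.

Let lam_ge0 G : (0 <= lam G)%E.
Proof. by apply: ereal_sup_ubound; exists (fun=> 0); rewrite ?Lam0//; split. Qed.

Let lam_sub G H : G `<=` H -> (lam G <= lam H)%E.
Proof.
move=> GH; apply: le_ereal_sup => _ [f [hf fG] <-]; exists f => //.
by split=> // x Hx; apply: fG => /GH.
Qed.

Let lamT : lam setT = 1%E.
Proof.
have one : @lip01 R E (fun=> 1).
  by split => [|x]; [exists 0; exact: lip_cst|rewrite lexx ler01].
apply/eqP; rewrite eq_le; apply/andP; split.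
  apply: ge_ereal_sup => _ [f [hf _] <-]; rewrite lee_fin.
  apply: Lam_le => // n; rewrite -(Ex_cst (mu_ n) 1); apply: Ex_le.
  - exact: lip01_L1.
  - exact: lip01_L1.
  - by move=> x; case: hf => _ /(_ x)/andP[].
apply: ereal_sup_ubound; exists (fun=> 1); first by split=> // x /(_ Logic.I).
congr EFin; rewrite /Lam (_ : (fun n : nat => _) = fun=> 1); first exact: lim_cst.
by apply/funext => n; exact: Ex_cst.
Qed.

Let lam_bigcup (G_ : nat -> set E) : (forall i, open (G_ i)) ->
  (lam (\bigcup_i G_ i) <= \sum_(i <oo) lam (G_ i))%E.
Proof.
move=> oG; apply: ge_ereal_sup => _ [f [hf fG] <-].
apply/lee_addgt0Pr => e e0.
have [[L hL] f01] := hf.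
pose e_ (j : nat) : R := e / 2 / (2 ^ j.+1)%:R.
have e_0 j : 0 < e_ j by rewrite !divr_gt0// ltr0n expn_gt0.
have /choice[F_ hF] : forall j, exists F, forall n, I n (farfrom F (e_ j)) <= e_ j.
  by move=> j; exact: tight.
have [||||k hk] := @net_cover R E F_ e_ G_ f L (e / 2) e_0 _ oG hL.
- move=> e1 e10; have [j hj] : exists j : nat, e / 2 / e1 < j%:R.
    by exists (Num.truncn (e / 2 / e1)).+1; exact: truncnS_gt.
  exists j; rewrite /e_ ltr_pdivrMr ?ltr0n ?expn_gt0//.
  move: hj; rewrite ltr_pdivrMr// => hj; apply: lt_trans hj _.
  rewrite mulrC ltr_pM2l// ltr_nat.
  by rewrite (ltn_trans (ltnSn j))// ltn_expl.
- by move=> x; have /andP[] := f01 x.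
- move=> x fx; apply: contrapT => h; move: fx; rewrite fG ?ltxx// => -[i _ Gi].
  by apply: h; exists i.
- by rewrite divr_gt0.
have fsum n : I n f <= \sum_(i < k) I n (bump (G_ i) k%:R) + e / 2 + e / 2.
  have ib i : L1 (mu_ n) (bump (G_ i) k%:R : borel E -> R) by exact/lip01_L1/lip01_bump.
  have ia j : L1 (mu_ n) (farfrom (F_ j) (e_ j) : borel E -> R) by exact/lip01_L1/lip01_farfrom.
  have i1 : L1 (mu_ n) (fun x : borel E => \sum_(i < k) bump (G_ i) k%:R x).
    by apply: (@L1_sum _ _ _ (mu_ n) _ _ (fun (i : 'I_k) (x : borel E) => bump (G_ i) k%:R x)).
  have i2 : L1 (mu_ n) (fun x : borel E => \sum_(j < k) farfrom (F_ j) (e_ j) x).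
    by apply: (@L1_sum _ _ _ (mu_ n) _ _ (fun (j : 'I_k) (x : borel E) => farfrom (F_ j) (e_ j) x)).
  have ic : L1 (mu_ n) (fun=> e / 2 : R) by exact: L1_cst.
  apply: le_trans (Ex_le (lip01_L1 _ hf) (L1D (L1D i1 ic) i2) hk) _.
  rewrite (ExD (L1D i1 ic) i2) (ExD i1 ic) Ex_cst lerD//.
    rewrite lerD2r.
    by rewrite (Ex_sum (index_enum 'I_k) (F := fun (i : 'I_k) (x : borel E) => bump (G_ i) k%:R x)).
  rewrite (Ex_sum (index_enum 'I_k) (F := fun (j : 'I_k) (x : borel E) => farfrom (F_ j) (e_ j) x))//.
  apply: (@le_trans _ _ (\sum_(j < k) e_ j)); first by apply: ler_sum => j _; exact: hF.
  have -> : \sum_(j < k) e_ j = e / 2 - e / 2 / (2 ^ k)%:R.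
    elim: k {hk ib i1 i2} => [|k IH]; first by rewrite big_ord0 expn0 divr1 subrr.
    rewrite big_ord_recr/= IH /e_ expnS natrM; field.
    by rewrite pnatr_eq0 expn_eq0.
  by rewrite lerBlDr lerDl divr_ge0 ?divr_ge0 ?ltW.
have b01 i : lip01 (bump (G_ i) k%:R) by exact: lip01_bump.
have : Lam f <= \sum_(i < k) Lam (bump (G_ i) k%:R) + e / 2 + e / 2.
  apply: (ler_cvg_to (Lam_cvg hf) _ (nearW _ fsum)).
  apply: cvgD; last exact: cvg_cst.
  by apply: cvgD; [exact: (@Lam_sum k (fun i => bump (G_ i) k%:R) b01)|exact: cvg_cst].
rewrite -addrA -splitr -lee_fin EFinD => /le_trans; apply.
rewrite leeD2r// -sumEFin.
apply: (@le_trans _ _ (\sum_(i < k) lam (G_ i))%E).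
  apply: lee_sum => i _; apply: ereal_sup_ubound; exists (bump (G_ i) k%:R) => //.
  by split=> // x; exact: bump_out.
rewrite -(big_mkord xpredT (fun i => lam (G_ i))).
by apply: nneseries_lim_ge => i _ _; exact: lam_ge0.
Qed.

Let nu_open G : open G -> nu G = lam G.
Proof.
move=> oG; apply/eqP; rewrite eq_le; apply/andP; split.
  by apply: ereal_inf_lbound; exists G => //; split.
by apply: le_ereal_inf_tmp => _ [H [oH GH] <-]; exact: lam_sub.
Qed.

Let nu0 : nu set0 = 0%E.
Proof.
rewrite (nu_open open0); apply/eqP; rewrite eq_le lam_ge0 andbT.
apply: ge_ereal_sup => _ [f [hf f0] <-]; rewrite (_ : f = fun=> 0) ?Lam0//.
by apply/funext => x; exact: f0.
Qed.

Let nu_ge0 A : (0 <= nu A)%E.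
Proof. by apply: le_ereal_inf_tmp => _ [G _ <-]; exact: lam_ge0. Qed.

Let nu_le : {homo nu : A B / A `<=` B >-> (A <= B)%E}.
Proof.
move=> A B AB; apply: le_ereal_inf => _ [G [oG BG] <-]; exists G => //.
by split=> //; exact: subset_trans BG.
Qed.

Let nu_sigma : sigma_subadditive nu.
Proof.
move=> A; apply/lee_addgt0Pr => e e0.
have : forall i, exists G, [/\ open G, A i `<=` G & (lam G <= nu (A i) + (e / (2 ^ i.+1)%:R)%:E)%E].
  move=> i; have d0 : 0 < e / (2 ^ i.+1)%:R by rewrite divr_gt0// ltr0n expn_gt0.
  have fnu : nu (A i) \is a fin_num.
    rewrite ge0_fin_numE//; apply: le_lt_trans (nu_le (@subsetT _ _)) _.
    by rewrite (nu_open openT) lamT ltry.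
  have [_ [G [oG AG] <-] h] := lb_ereal_inf_adherent d0 fnu.
  by exists G; split => //; exact: ltW.
move=> /choice[G_ hG].
apply: (@le_trans _ _ (lam (\bigcup_i G_ i))).
  apply: ereal_inf_lbound; exists (\bigcup_i G_ i) => //; split.
    by apply: bigcup_open => i _; case: (hG i).
  by apply: subset_bigcup => i _; case: (hG i).
apply: le_trans (lam_bigcup _) _; first by move=> i; case: (hG i).
apply: le_trans (epsilon_trick xpredT _ (ltW e0)) => //.
by apply: lee_nneseries => [i *|i *]; [exact: lam_ge0|case: (hG i)].
Qed.

HB.instance Definition _ := isOuterMeasure.Build R E nu nu0 nu_ge0 nu_le nu_sigma.

Let nu_outer : {outer_measure set E -> \bar R} := nu.

Let lip01_excess f eta : lip01 f -> 0 <= eta -> lip01 (fun x => Num.max 0 (f x - eta)).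
Proof.
move=> [[L hL] f01] eta0; split; first by exists L; apply: lip_pos; exact: lipBc.
move=> x; rewrite le_max lexx/= ge_max ler01/=.
by have /andP[_] := f01 x; lra.
Qed.

Let open_caratheodory U : open U -> nu_outer.-caratheodory U.
Proof.
move=> oU; apply: le_caratheodory_measurable => X.
apply: le_ereal_inf_tmp => _ [G [oG XG] <-].
apply: (@le_trans _ _ (lam (G `&` U) + nu (G `&` ~` U))%E).
  rewrite leeD//; last by apply: nu_le; exact: setSI.
  by rewrite -nu_open; [apply: nu_le; exact: setSI|exact: openI].
have lamfin H : lam H \is a fin_num.
  by rewrite ge0_fin_numE// (@le_lt_trans _ _ (lam setT)) ?lam_sub// lamT ltry.
rewrite -leeBrDr; last first.
  by rewrite ge0_fin_numE// (@le_lt_trans _ _ (nu setT)) ?nu_le// (nu_open openT) lamT ltry.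
apply: ge_ereal_sup => _ [f [hf fGU] <-].
rewrite leeBrDr; last first.
  by rewrite ge0_fin_numE// (@le_lt_trans _ _ (nu setT)) ?nu_le// (nu_open openT) lamT ltry.
apply/lee_addgt0Pr => eta eta0.
pose W := G `&` [set x | f x < eta].
have oW : open W.
  apply: openI => //; have [[L hL] _] := hf.
  exact: (open_comp (fun x _ => (lip_continuous hL : continuous f) x) (@open_lt R eta)).
have : (nu (G `&` ~` U) <= lam W)%E.
  apply: ereal_inf_lbound; exists W => //; split => // x [Gx Ux]; split => //=.
  by rewrite fGU// => -[].
move=> nuW; rewrite -leeBlDr//; apply: (@le_trans _ _ ((Lam f - eta)%:E + lam W)%E).
  by rewrite addeAC -EFinB leeD2l.
rewrite addeC -leeBrDr//; apply: ge_ereal_sup => _ [g [hg gW] <-].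
rewrite leeBrDr// addeC.
pose h x := Num.max 0 (f x - eta) + g x.
have h01 : lip01 h.
  have [[L hL] f01] := hf; have [[K hK] g01] := hg; split.
    exists (L + K); apply: lipD => //; have [[L' ?] _] := lip01_excess hf (ltW eta0).
    by apply: lip_pos; exact: lipBc.
  move=> x; have /andP[g0 g1] := g01 x; have /andP[f0 f1] := f01 x.
  rewrite /h; case: (leP 0 (f x - eta)) => fe; last by rewrite add0r g0.
  rewrite gW ?addr0 => [|[_ /=]]; last by lra.
  by rewrite fe/=; lra.
apply: (@le_trans _ _ (Lam h)%:E); last first.
  apply: ereal_sup_ubound; exists h => //; split => // x Gx.
  rewrite /h gW ?addr0 => [|[]//]; rewrite fGU => [|[]//].
  by rewrite sub0r max_l// oppr_le0 ltW.
rewrite -EFinD lee_fin.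
apply: (@ler_cvg_to _ \oo _ _ (fun n => I n f - eta + I n g) (fun n => I n h)).
- by apply: cvgD; [apply: cvgB; [exact: Lam_cvg|exact: cvg_cst]|exact: Lam_cvg].
- exact: Lam_cvg.
apply: nearW => n; rewrite -[X in _ - X](Ex_cst (mu_ n)).
have ife := lip01_L1 (mu_ n) hf; have ig := lip01_L1 (mu_ n) hg.
rewrite -(ExB ife (L1_cst _ _)) -(ExD (L1B ife (L1_cst _ _)) ig).
apply: Ex_le; [exact: (L1D (L1B ife (L1_cst _ _)) ig)|exact: lip01_L1|].
by move=> x; rewrite /h lerD2r le_max lexx orbT.
Qed.

Let borel_caratheodory (A : set (borel E)) : measurable A -> nu_outer.-caratheodory A.
Proof.
move=> mA; have : <<s open >> `<=` nu_outer.-caratheodory.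
  apply: smallest_sub => [|G oG]; last exact: open_caratheodory.
  split.
  - exact: caratheodory_measurable_set0.
  - by move=> B mB; rewrite setTD; exact: caratheodory_measurable_setC.
  - exact: caratheodory_measurable_bigcup.
by apply.
Qed.

Let nuB (A : set (borel E)) : \bar R := nu A.

Let nuB_sigma_additive : semi_sigma_additive nuB.
Proof.
move=> A mA tA mbigcupA.
suff -> : nuB (\bigcup_n A n) = (\sum_(n <oo) nuB (A n))%E.
  by apply: is_cvg_ereal_nneg_natsum => n _; exact: nu_ge0.
apply/eqP; rewrite eq_le; apply/andP; split; first exact: nu_sigma.
have mA' n : nu_outer.-caratheodory (A n) by exact: borel_caratheodory.
have := caratheodory_lime_le mA' tA (\bigcup_n A n).
rewrite setICr outer_measure0 adde0; apply: le_trans.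
apply: lee_nneseries => [n *|n _]; first exact: nu_ge0.
by apply: nu_le => x Anx; split => //; exists n.
Qed.

HB.instance Definition _ := isMeasure.Build _ (borel E) R nuB nu0
  (fun A => nu_ge0 A) nuB_sigma_additive.

Let nuB_T : nuB setT = 1%E.
Proof. by rewrite /nuB (nu_open openT) lamT. Qed.

HB.instance Definition _ := Measure_isProbability.Build _ (borel E) R nuB nuB_T.

(** Layer by layer, f is bounded by the open sets where it exceeds i/n. *)
Let Lam_le_int f : lip01 f -> Lam f <= Ex nuB (f : borel E -> R).
Proof.
move=> hf; have [[L' /(lip_le (ler_norm L')) hL] f01] := hf.
set L := `|L'| in hL; apply/ler_addgt0Pr => e e0.
pose n := (Num.truncn e^-1).+1.
have n0 : 0 < n%:R :> R by rewrite ltr0n.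
have ne : n%:R^-1 < e by rewrite -[e]invrK ltf_pV2 ?posrE ?invr_gt0//; exact: truncnS_gt.
pose g i x : R := Num.min 1 (Num.max 0 (n%:R * f x - i%:R)).
have g01 i : lip01 (g i).
  split; last by move=> x; rewrite ge_min lexx le_min ler01 le_max lexx.
  exists (n%:R * L); apply: lip_min.
    by apply: lip_le (lip_cst 1); rewrite /L mulr_ge0. 
  by apply: lip_pos; apply: lipBc; have := lipZ n%:R hL; rewrite ger0_norm.
pose G i := [set x | i%:R / n%:R < f x].
have oG i : open (G i).
  exact: (open_comp (fun x _ => (lip_continuous hL : continuous f) x) (@open_gt R (i%:R / n%:R))).
have fE x : n%:R * f x = \sum_(i < n) g i x.
  have /andP[f0 f1] := f01 x.
  by rewrite layer_sum ?mulr_ge0// min_l// ler_piMr.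
have LamE : n%:R * Lam f = \sum_(i < n) Lam (g i).
  apply: (@cvg_unique _ (@Rhausdorff R) ((fun m => n%:R * I m f) @ \oo)).
    by apply: cvgMl_tmp; exact: Lam_cvg.
  rewrite (_ : (fun _ => _) = (fun m => \sum_(i < n) I m (g i))); first exact: Lam_sum.
  apply/funext => m; rewrite -ExZ ?lip01_L1//.
  rewrite -(Ex_sum (index_enum 'I_n) (F := fun (i : 'I_n) (x : borel E) => g i x)).
    by apply: eq_Ex.
  by move=> i; exact: lip01_L1.
have Lam_g i : Lam (g i) <= Ex nuB (\1_(G i) : borel E -> R).
  rewrite -lee_fin (open_Ex _ (oG i)) /= [X in (_ <= X)%E]nu_open//.
  apply: ereal_sup_ubound; exists (g i) => //; split => // x Gx.
  rewrite /g max_l ?min_r// subr_le0 leNgt; apply/negP => h; apply: Gx.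
  by rewrite /G/= ltr_pdivrMr// mulrC.
have iG i : L1 nuB (\1_(G i) : borel E -> R).
  by apply: integrable_indic => //; exact: open_borel.
have ife := lip01_L1 nuB hf.
have : n%:R * Lam f <= n%:R * Ex nuB (f : borel E -> R) + 1.
  rewrite LamE; apply: (@le_trans _ _ (\sum_(i < n) Ex nuB (\1_(G i) : borel E -> R))).
    by apply: ler_sum => i _; exact: Lam_g.
  rewrite -(Ex_sum (index_enum 'I_n) (F := fun (i : 'I_n) => \1_(G i) : borel E -> R))//.
  rewrite -(ExZ _ ife) -[X in _ + X](Ex_cst nuB) -(ExD (L1Z _ ife) (L1_cst _ _)).
  apply: Ex_le; [exact: L1_sum|exact: (L1D (L1Z _ ife) (L1_cst _ _))|].
  move=> x; have /andP[f0 f1] := f01 x.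
  have /andP[_] := @layer_count R n (n%:R * f x) (mulr_ge0 (ltW n0) f0); apply: le_trans.
  apply: ler_sum => i _; rewrite indicE ler_nat; case: (boolP (x \in G i)) => //.
  by rewrite inE /G/= ltr_pdivrMr// mulrC => ->.
rewrite -ler_pdivlMl// mulrDr mulrA mulVf ?gt_eqF// mul1r mulr1 => h.
by rewrite (le_trans h)// lerD2l ltW.
Qed.

Lemma weak_limit_exists : exists mu : probability (borel E) R,
  forall f, lip01 f -> I n f @[n --> \oo] --> Ex mu (f : borel E -> R).
Proof.
exists nuB => f hf; suff <- : Lam f = Ex nuB (f : borel E -> R) by exact: Lam_cvg.
apply/eqP; rewrite eq_le Lam_le_int//=.
have h1 : lip01 (fun x => 1 - f x).
  have [[L hL] f01] := hf; split.
    by exists (0 + L); apply: lipB => //; exact: lip_cst.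
  by move=> x; have /andP[? ?] := f01 x; apply/andP; split; lra.
have := Lam_le_int h1; rewrite ExB ?Ex_cst; [|exact: L1_cst|exact: lip01_L1].
suff -> : Lam (fun x => 1 - f x) = 1 - Lam f by lra.
apply: (@cvg_unique _ (@Rhausdorff R) _ _ _ _ (Lam_cvg h1)).
rewrite (_ : (fun _ => _) = (fun m => 1 - I m f)).
  by apply: cvgB; [exact: cvg_cst|exact: Lam_cvg].
by apply/funext => m; rewrite ExB ?Ex_cst; [|exact: L1_cst|exact: lip01_L1].
Qed.

End weak_limit.

Definition pk d d' (X : measurableType d) (Y : measurableType d') (R : realType)
  (k : R.-pker X ~> Y) (x : X) : set Y -> \bar R := k x.

Section pk.
Context d d' (X : measurableType d) (Y : measurableType d') (R : realType).
Variables (k : R.-pker X ~> Y) (x : X).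
HB.instance Definition _ := Measure.on (pk k x).
Let pk_setT : pk k x setT = 1%E. Proof. exact: prob_kernel. Qed.
HB.instance Definition _ := Measure_isProbability.Build _ _ _ (pk k x) pk_setT.
End pk.

Section constant_kernel.
Context d d' (X : measurableType d) (Y : measurableType d') (R : realType).
Variable m : {finite_measure set Y -> \bar R}.

Definition kcst (x : X) : {measure set Y -> \bar R} := m.

Let kcst_meas U : measurable U -> measurable_fun setT (kcst ^~ U).
Proof. by move=> mU; exact: measurable_cst. Qed.

HB.instance Definition _ := isKernel.Build _ _ _ _ _ kcst kcst_meas.

Let kcst_uub : measure_fam_uub kcst.
Proof.
exists (fine (m setT) + 1)%R => x; rewrite EFinD fineK ?fin_num_measure//.
by rewrite lteDl ?fin_num_measure// lte01.
Qed.

HB.instance Definition _ := @Kernel_isFinite.Build _ _ _ _ _ kcst kcst_uub.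
End constant_kernel.

Section mixture.
Context d d' (X : measurableType d) (Y : measurableType d') (R : realType).
Variables (k : R.-pker X ~> Y) (m : {finite_measure set X -> \bar R}).

Lemma ge0_integral_mixture (nu : {measure set Y -> \bar R}) (f : Y -> \bar R) :
  (forall B, measurable B -> nu B = \int[m]_x k x B)%E ->
  measurable_fun setT f -> (forall y, 0 <= f y)%E ->
  (\int[nu]_y f y = \int[m]_x \int[k x]_y f y)%E.
Proof.
move=> nuE mf f0.
have := @integral_kcomp _ _ _ unit X Y R (@kcst _ _ unit X R m) (kernel.kernel_snd k) tt f f0 mf.
move=> <-; apply: eq_measure_integral => B mB _.
by rewrite nuE.
Qed.

End mixture.

Section kernel_integrals.
Context d d' (X : measurableType d) (Y : measurableType d') (R : realType).
Variable (k : R.-pker X ~> Y).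
Implicit Type f : Y -> R.

Lemma meas_kernel_ge0 f : measurable_fun setT f -> (forall y, 0 <= f y) ->
  measurable_fun setT (fun x => \int[k x]_y (f y)%:E)%E.
Proof.
move=> mf f0; apply: (@measurable_fun_integral_kernel _ _ X Y R k _ (EFin \o f)).
- by move=> U mU; exact: measurable_kernel.
- by move=> y; rewrite lee_fin.
- exact/measurable_EFinP.
Qed.

Lemma meas_kernel_Ex f : measurable_fun setT f -> (forall x, L1 (k x) f) ->
  measurable_fun setT (fun x => Ex (k x) f).
Proof.
move=> mf kf; have mn : measurable_fun setT (fun y => `|f y|) by exact: measurableT_comp.
have mp : measurable_fun setT (fun y => `|f y| + f y) by exact: measurable_funD.
rewrite (_ : (fun x => _) = (fun x => fine (\int[k x]_y (`|f y| + f y)%:E)%E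
    - fine (\int[k x]_y (`|f y|)%:E)%E)).
  apply: measurable_funB; apply: measurableT_comp => //; apply: meas_kernel_ge0 => // y.
  by rewrite -lerBlDr sub0r; have := ler_norm (- f y); rewrite normrN.
apply/funext => x; rewrite -(ExB (L1D (L1_norm (kf x)) (kf x)) (L1_norm (kf x))).
by apply: eq_Ex => y; rewrite addrC addKr.
Qed.

Variables (m : {finite_measure set X -> \bar R}) (nu : {measure set Y -> \bar R}).
Hypothesis nuE : (forall B, measurable B -> nu B = \int[m]_x k x B)%E.

Lemma L1_mixture f : measurable_fun setT f -> (forall x, L1 (k x) f) ->
  L1 m (fun x => Ex (k x) (fun y => `|f y|)) -> L1 nu f.
Proof.
move=> mf kf im; have mn : measurable_fun setT (fun y => `|f y|) by exact: measurableT_comp.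
apply/integrableP; split; first exact/measurable_EFinP.
rewrite (ge0_integral_mixture (k := k) nuE) //; last exact/measurable_EFinP.
move: im => /integrableP[_]; apply: le_lt_trans; apply: ge0_le_integral => //.
- by move=> x _; exact: integral_ge0.
- exact: meas_kernel_ge0.
- by apply/measurable_EFinP; apply: measurableT_comp => //; apply: meas_kernel_Ex => // x; exact: L1_norm.
- by move=> x _; rewrite /= ger0_norm ?Ex_ge0// -(ExE (L1_norm (kf x))).
Qed.

Lemma L1_kernel_Ex f : measurable_fun setT f -> (forall x, L1 (k x) f) ->
  L1 nu f -> L1 m (fun x => Ex (k x) f).
Proof.
move=> mf kf im; have mn : measurable_fun setT (fun y => `|f y|) by exact: measurableT_comp.
have L1n : L1 m (fun x => Ex (k x) (fun y => `|f y|)).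
  apply: L1_ge0.
  - by apply: meas_kernel_Ex => // x; exact: L1_norm.
  - by move=> x; exact: Ex_ge0.
  - move: im => /integrableP[_]; rewrite (ge0_integral_mixture (k := k) nuE)//; last first.
      exact/measurable_EFinP.
    apply: le_lt_trans; rewrite le_eqVlt; apply/orP; left; apply/eqP.
    by apply: eq_integral => x _; exact/esym/(ExE (L1_norm (kf x))).
apply: L1_dom L1n; first exact: meas_kernel_Ex.
by move=> x; exact: Ex_normr.
Qed.

Lemma Ex_mixture f : measurable_fun setT f -> (forall x, L1 (k x) f) ->
  L1 nu f -> Ex nu f = Ex m (fun x => Ex (k x) f).
Proof.
move=> mf kf im; have mn : measurable_fun setT (fun y => `|f y|) by exact: measurableT_comp.
have mp : measurable_fun setT (fun y => `|f y| + f y) by exact: measurable_funD.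
have p0 y : 0 <= `|f y| + f y.
  by rewrite -lerBlDr sub0r; have := ler_norm (- f y); rewrite normrN.
have kn x := L1_norm (kf x); have kp x := L1D (kn x) (kf x).
have pos (g : Y -> R) : measurable_fun setT g -> (forall y, 0 <= g y) -> (forall x, L1 (k x) g) ->
    Ex nu g = Ex m (fun x => Ex (k x) g).
  move=> mg g0 kg; congr fine.
  rewrite (ge0_integral_mixture (k := k) nuE)//; last exact/measurable_EFinP.
  by apply: eq_integral => x _; rewrite (ExE (kg x)).
transitivity (Ex nu (fun y => `|f y| + f y) - Ex nu (fun y => `|f y|)).
  rewrite -(ExB (L1D (L1_norm im) im) (L1_norm im)).
  by apply: eq_Ex => y; rewrite addrC addKr.
rewrite (pos _ mp p0 kp) (pos _ mn _ kn)// -ExB.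
- by apply: eq_Ex => x; rewrite (ExD (kn x) (kf x)) addrC addKr.
- by apply: L1_kernel_Ex => //; exact: L1D (L1_norm im) im.
- by apply: L1_kernel_Ex => //; exact: L1_norm.
Qed.

End kernel_integrals.

(** * Contraction of the semigroup on Lipschitz functions *)

Section first_moments.
Context {R : realType} {E : polishMetricType R}.
Implicit Types (nu : probability (borel E) R) (f : E -> R) (o x : E).

Definition dist_to o : borel E -> R := fun x => mdist x o.

Lemma meas_dist o : measurable_fun setT (dist_to o).
Proof. exact: (lip_meas (lip_mdist o)). Qed.

Lemma dist_ge0 o x : 0 <= dist_to o x. Proof. exact: mdist_ge0. Qed.

Lemma L1_lip (nu : {finite_measure set (borel E) -> \bar R}) o f L :
  L1 nu (dist_to o) -> lip L f -> L1 nu (f : borel E -> R).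
Proof.
move=> io hf; apply: (@L1_dom _ _ _ nu _ (fun x => `|f o| + L * dist_to o x)).
- exact: lip_meas hf.
- by move=> x; exact: lip_growth.
- by apply: L1_addcst; exact: L1Z.
Qed.

Lemma finite_first_momentP nu o : finite_first_moment nu <-> L1 nu (dist_to o).
Proof.
split=> [[x0 h]|h].
  apply: (@L1_lip nu x0 _ 1 _ (lip_mdist o)).
  by apply: L1_ge0 => //; [exact: meas_dist|exact: dist_ge0].
by exists o; rewrite (ExE h) ltry.
Qed.

Lemma wasserstein_ge nu1 nu2 f : lip 1 f ->
  ((`|Ex nu1 (f : borel E -> R) - Ex nu2 (f : borel E -> R)|)%:E <= wasserstein nu1 nu2)%E.
Proof.
by move=> hf; apply: ereal_sup_ubound; exists f => //=; apply/lip_seminormP.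
Qed.

Lemma Ex_dirac (x : borel E) (f : borel E -> R) : measurable_fun setT f ->
  Ex (\d_x) f = f x.
Proof.
move=> mf; rewrite /Rintegral integral_dirac ?diracT ?mul1e//.
exact/measurable_EFinP.
Qed.

Lemma L1_dirac (x : borel E) (f : borel E -> R) : measurable_fun setT f -> L1 (\d_x) f.
Proof.
move=> mf; apply/integrableP; split; first exact/measurable_EFinP.
rewrite integral_dirac ?diracT ?mul1e//= ?ltry//.
by apply/measurable_EFinP; exact: measurableT_comp.
Qed.

Lemma wasserstein_dirac (x y : borel E) :
  (wasserstein (\d_x : probability (borel E) R) (\d_y : probability (borel E) R)
    <= (mdist (x : E) y)%:E)%E.
Proof.
apply: ge_ereal_sup => _ [f hf <-]; rewrite lee_fin.
have {}hf : lip 1 f by apply/lip_seminormP.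
have mf := lip_meas hf; rewrite (Ex_dirac x mf) (Ex_dirac y mf).
by have := hf x y; rewrite mul1r.
Qed.

End first_moments.

Section contraction.
Context {R : realType} {E : polishMetricType R}.
Variable Pt : R -> R.-pker (borel E) ~> (borel E).
Hypothesis sg : transition_semigroup Pt.
Variables (c gam : R).
Hypotheses (c0 : 0 < c) (gam0 : 0 < gam).
Hypothesis P1_stable : forall (t : R) (mu : probability (borel E) R), 0 <= t ->
  finite_first_moment mu -> finite_first_moment (kernel_push mu (Pt t)).
Hypothesis contr : forall (t : R) (mu nu : probability (borel E) R), 0 <= t ->
  finite_first_moment mu -> finite_first_moment nu ->
  (wasserstein (kernel_push mu (Pt t)) (kernel_push nu (Pt t)) <=
   (c * expR (- gam * t))%:E * wasserstein mu nu)%E.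
Implicit Types (f g : E -> R) (s t : R) (o x y : E).

Definition kappa (t : R) : R := c * expR (- gam * t).

Lemma kappa_ge0 t : 0 <= kappa t.
Proof. by rewrite mulr_ge0 ?expR_ge0 ?ltW. Qed.

Local Notation Pf t f := (kernel_op (Pt t) f).

Let pushE x t (A : set (borel E)) : measurable A ->
  kernel_push (\d_(x : borel E)) (Pt t) A = Pt t x A.
Proof.
move=> mA; rewrite /kernel_push integral_dirac ?diracT ?mul1e//.
exact: measurable_kernel.
Qed.

Let Ex_push x t (f : borel E -> R) : Ex (kernel_push (\d_(x : borel E)) (Pt t)) f = Ex (Pt t x) f.
Proof. by congr fine; apply: eq_measure_integral => A mA _; exact: pushE. Qed.

Let P1_dirac x : finite_first_moment (\d_(x : borel E) : probability (borel E) R).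
Proof. by apply/(finite_first_momentP _ x); exact: (L1_dirac _ (meas_dist x)). Qed.

Lemma L1_pt_dist x t o : 0 <= t -> L1 (Pt t x) (dist_to o).
Proof.
move=> t0; have /(finite_first_momentP _ o) := P1_stable t0 (P1_dirac x).
move=> /integrableP[mF h]; apply/integrableP; split => //.
move: h; congr (_ < _)%E; apply: eq_measure_integral => A mA _; exact: pushE.
Qed.

Lemma L1_pt x t f L : 0 <= t -> lip L f -> L1 (Pt t x) (f : borel E -> R).
Proof. by move=> t0 hf; exact: (@L1_lip _ _ (pk (Pt t) x) x _ L (L1_pt_dist _ _ t0)). Qed.

(** Duality turns the contraction of the laws started at points into a
    contraction of the Lipschitz seminorm. *)
Lemma lip_Pf t f L : 0 <= t -> 0 <= L -> lip L f -> lip (kappa t * L) (Pf t f).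
Proof.
move=> t0; rewrite le_eqVlt => /predU1P[<-|L0] hf x y.
  have fE z : f z = f x.
    by apply/eqP; rewrite -subr_eq0 -normr_le0 (le_trans (hf z x))// mul0r.
  rewrite /kernel_op (_ : Ex _ _ = f x).
    rewrite (_ : Ex _ _ = f x) ?subrr ?normr0 ?mulr0 ?mul0r//.
    by rewrite -(Ex_cst (pk (Pt t) y) (f x)); apply: eq_Ex.
  by rewrite -(Ex_cst (pk (Pt t) x) (f x)); apply: eq_Ex.
have hg : lip 1 (fun z => L^-1 * f z).
  by have := lipZ L^-1 hf; rewrite gtr0_norm ?invr_gt0// mulVf ?gt_eqF.
have := wasserstein_ge (kernel_push (\d_(x : borel E)) (Pt t)) (kernel_push (\d_(y : borel E)) (Pt t)) hg.
move/le_trans => /(_ _ (contr t0 (P1_dirac x) (P1_dirac y))).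
have /(lee_wpmul2l (x := (c * expR (- gam * t))%:E)) := wasserstein_dirac x y.
rewrite lee_fin => /(_ (kappa_ge0 t)) h1 h2; have := le_trans h2 h1.
rewrite !Ex_push -EFinM lee_fin -/(kappa t).
rewrite !ExZ; [|exact: (L1_pt _ t0 hf)|exact: (L1_pt _ t0 hf)].
rewrite -mulrBr normrM gtr0_norm ?invr_gt0// ler_pdivrMl//.
by rewrite mulrCA mulrA.
Qed.

Lemma sgE s t x (A : set (borel E)) : 0 <= s -> 0 <= t -> measurable A ->
  (Pt (s + t) x A = \int[pk (Pt s) x]_y Pt t y A)%E.
Proof. by move=> s0 t0 mA; rewrite sg.2. Qed.

Lemma Pf_semigroup s t x (f : borel E -> R) : 0 <= s -> 0 <= t -> measurable_fun setT f ->
  (forall y, L1 (Pt t y) f) -> L1 (Pt (s + t) x) f ->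
  Pf (s + t) f x = Pf s (Pf t f) x.
Proof.
move=> s0 t0 mf ft fst; rewrite /kernel_op.
exact: (Ex_mixture (k := Pt t) (m := pk (Pt s) x) (fun A mA => sgE x s0 t0 mA) mf ft fst).
Qed.

Lemma Pf_semigroup_lip s t x f L : 0 <= s -> 0 <= t -> lip L f ->
  Pf (s + t) f x = Pf s (Pf t f) x.
Proof.
move=> s0 t0 hf; apply: Pf_semigroup => //; first exact: lip_meas hf.
- by move=> y; exact: L1_pt hf.
- by apply: L1_pt hf; exact: addr_ge0.
Qed.

Lemma Pf0 (f : borel E -> R) x : measurable_fun setT f -> Pf 0 f x = f x.
Proof.
move=> mf; rewrite -(Ex_dirac x mf) /kernel_op; congr fine.
by apply: eq_measure_integral => A mA _; exact: sg.1.
Qed.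

Lemma lip01_Pf t f : 0 <= t -> lip01 f -> lip01 (Pf t f).
Proof.
move=> t0 [[L /(lip_le (ler_norm L)) hf] f01]; split.
  by exists (kappa t * `|L|); exact: lip_Pf.
move=> x; rewrite /kernel_op.
have i1 : L1 (pk (Pt t) x) (fun=> 1 : R) by exact: L1_cst.
have iF : L1 (Pt t x) (f : borel E -> R) by exact: L1_pt hf.
apply/andP; split; first by apply: Ex_ge0 => y; case/andP: (f01 y).
rewrite -(Ex_cst (pk (Pt t) x) 1); apply: Ex_le => // y; by case/andP: (f01 y).
Qed.

Lemma Pf_near s t f L o : 0 <= s -> 0 <= t -> 0 <= L -> lip L f ->
  `|Pf (s + t) f o - Pf t f o| <= kappa t * L * Ex (Pt s o) (dist_to o).
Proof.
move=> s0 t0 L0 hf; rewrite (Pf_semigroup_lip _ s0 t0 hf).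
have hg := lip_Pf t0 L0 hf; have ig := L1_pt o s0 hg.
have i1 : L1 (Pt s o) (fun=> Pf t f o) by exact: (L1_cst (pk (Pt s) o)).
rewrite -[X in _ - X](Ex_cst (pk (Pt s) o)) -(ExB ig i1).
rewrite -(ExZ _ (L1_pt_dist o o s0)).
apply: Ex_dom => [|y|].
- by apply: measurable_funB => //; exact: lip_meas hg.
- exact: hg.
- by apply: L1Z; exact: L1_pt_dist.
Qed.

End contraction.

Lemma geometric_telescope {R : realType} (u : nat -> R) (C q : R) : 0 <= C -> 0 <= q -> q < 1 ->
  (forall n, `|u n.+1 - u n| <= C * q ^+ n) ->
  forall n m, (n <= m)%N -> `|u m - u n| <= C / (1 - q) * q ^+ n.
Proof.
move=> C0 q0 q1 hu n m nm.
have q10 : 0 < 1 - q by rewrite subr_gt0.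
suff : forall k, `|u (n + k)%N - u n| <= C / (1 - q) * (q ^+ n - q ^+ (n + k)).
  move=> /(_ (m - n)%N); rewrite subnKC// => /le_trans; apply.
  apply: ler_wpM2l; first by rewrite divr_ge0// ltW.
  by rewrite lerBlDr lerDl exprn_ge0.
elim=> [|k IH]; first by rewrite addn0 !subrr normr0 mulr0.
rewrite addnS -(subrK (u (n + k)%N) (u _)) -addrA (le_trans (ler_normD _ _))//.
rewrite (le_trans (lerD (hu _) IH))// exprS le_eqVlt; apply/orP; left; apply/eqP.
by field; rewrite gt_eqF.
Qed.

Lemma cvg_geo {R : realType} (q : R) : 0 <= q -> q < 1 -> q ^+ n @[n --> \oo] --> (0 : R).
Proof. by move=> q0 q1; apply: cvg_expr; rewrite ger0_norm. Qed.

Section invariant.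
Context {R : realType} {E : polishMetricType R}.
Variable Pt : R -> R.-pker (borel E) ~> (borel E).
Hypothesis sg : transition_semigroup Pt.
Variables (c gam : R).
Hypotheses (c0 : 0 < c) (gam0 : 0 < gam).
Hypothesis P1_stable : forall (t : R) (mu : probability (borel E) R), 0 <= t ->
  finite_first_moment mu -> finite_first_moment (kernel_push mu (Pt t)).
Hypothesis contr : forall (t : R) (mu nu : probability (borel E) R), 0 <= t ->
  finite_first_moment mu -> finite_first_moment nu ->
  (wasserstein (kernel_push mu (Pt t)) (kernel_push nu (Pt t)) <=
   (c * expR (- gam * t))%:E * wasserstein mu nu)%E.
Implicit Types (f g : E -> R) (s t : R) (x y : E).

Local Notation Pf t f := (kernel_op (Pt t) f).
Local Notation kap := (kappa c gam).
Let kap0 t : 0 <= kap t. Proof. exact: kappa_ge0. Qed.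
Let lip_Pf' := lip_Pf c0 P1_stable contr.
Let L1_pt' := L1_pt P1_stable.
Let Pf_near' := Pf_near sg c0 P1_stable contr.

Let q := expR (- gam).

Let q0 : 0 <= q. Proof. exact: expR_ge0. Qed.

Let q1 : q < 1. Proof. by rewrite expR_lt1 oppr_lt0. Qed.

Lemma kappa_nat n : kap n%:R = c * q ^+ n.
Proof. by rewrite /kappa /q -expRM_natr. Qed.

Lemma kappa_nat_cvg0 (C : R) : kap n%:R * C @[n --> \oo] --> (0 : R).
Proof.
have := cvg_geo q0 q1; move=> /(cvgMl_tmp (a := c)) /(cvgMr_tmp (b := C)).
rewrite mulr0 mul0r; apply: cvg_trans; apply: near_eq_cvg; apply: nearW => n.
by rewrite kappa_nat.
Qed.

Section existence.
Variable o : E.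

Let mu_ n : probability (borel E) R := pk (Pt n%:R) o.

Let M := Ex (Pt 1 o) (dist_to o).
Let M0 : 0 <= M. Proof. by apply: Ex_ge0 => x; exact: dist_ge0. Qed.

Let step f L n m : 0 <= L -> lip L f -> (n <= m)%N ->
  `|Ex (mu_ m) (f : borel E -> R) - Ex (mu_ n) (f : borel E -> R)| <=
  c * L * M / (1 - q) * q ^+ n.
Proof.
move=> L0 hf nm; apply: (@geometric_telescope _ (fun n => Ex (mu_ n) (f : borel E -> R))) => //.
  by rewrite !mulr_ge0// ltW.
move=> {nm}n; have := @Pf_near' 1 n%:R f L o ler01 (ler0n _ _) L0 hf.
rewrite (addrC 1) natr1 => /le_trans; apply; rewrite kappa_nat -/M.
by rewrite le_eqVlt; apply/orP; left; apply/eqP; ring.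
Qed.

Lemma invariant_exists : exists mu : probability (borel E) R,
  invariant_law Pt mu /\ finite_first_moment mu.
Proof.
have [|mu hmu] := @weak_limit_exists R E mu_ o.
  move=> e e0; have := cvg_geo q0 q1.
  have C1 : 0 < c * 1 * M / (1 - q) * 2 + 1.
    by rewrite ltr_pwDr// mulr_ge0// divr_ge0 ?mulr_ge0// ?subr_ge0 ltW.
  have e'0 : 0 < e / (c * 1 * M / (1 - q) * 2 + 1) by rewrite divr_gt0.
  move=> /cvgrPdist_lt/(_ _ e'0)[N _ hN]; exists N => n m Nn Nm f hf _.
  have {hN} := hN N (leqnn _); rewrite /= sub0r normrN ger0_norm ?exprn_ge0// => hN.
  rewrite -(subrK (Ex (mu_ N) (f : borel E -> R)) (Ex (mu_ n) _)) -addrA (le_trans (ler_normD _ _))//.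
  have h1 := step ler01 hf Nn; have h2 := step ler01 hf Nm; rewrite distrC in h2.
  rewrite (le_trans (lerD h1 h2))//.
  move: hN; rewrite ltr_pdivlMr// => hN.
  rewrite -mulr2n -mulr_natr mulrAC mulrC (le_trans _ (ltW hN))//.
  by rewrite ler_wpM2l ?exprn_ge0// lerDl.
have mu_dist n : Ex (mu_ n) (dist_to o) <= c * M / (1 - q).
  have := @step _ 1 0%N n ler01 (lip_mdist o) (leq0n _); rewrite expr0 !mulr1.
  rewrite [X in _ - X](_ : _ = 0) ?subr0; last first.
    have := Pf0 sg o (meas_dist o); rewrite /kernel_op => e0.
    by rewrite -[LHS]/(Ex (Pt 0 o) (dist_to o)) e0 /dist_to mdistxx.
  by apply: le_trans; exact: ler_norm.
exists mu; split; last first.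
  exists o.
  pose rk (k : nat) x := Num.min k%:R (mdist x o).
  have rk_lip k : lip 1 (rk k).
    by apply: lip_min; [exact: lip_le ler01 (lip_cst _)|exact: lip_mdist].
  have rk0 k x : 0 <= rk k x by rewrite le_min ler0n mdist_ge0.
  have rkk k x : rk k x <= k%:R by rewrite ge_min lexx.
  have rk_cvg x : rk k x @[k --> \oo] --> mdist x o.
    apply: cvg_near_cst; near=> k; rewrite /rk min_r//.
    by near: k; exact: nbhs_infty_ger.
  have rk_L1 (m : probability (borel E) R) k : L1 m (rk k : borel E -> R).
    apply: (@L1_bounded _ _ _ m _ k%:R); first exact: lip_meas (rk_lip k).
    by move=> x; rewrite ger0_norm.
  have mu_rk k : Ex mu (rk k : borel E -> R) <= c * M / (1 - q).
    case: k => [|k].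
      apply: (@le_trans _ _ 0); last first.
        by rewrite divr_ge0 ?mulr_ge0// ?subr_ge0 ltW.
      rewrite -(Ex0 mu); apply: Ex_le; [exact: rk_L1|exact: L1_0|by move=> x; exact: rkk].
    have k0 : 0 < k.+1%:R :> R by rewrite ltr0n.
    have h01 : lip01 (fun x => k.+1%:R^-1 * rk k.+1 x).
      split; first by eexists; apply: lipZ; exact: rk_lip.
      by move=> x; rewrite mulr_ge0 ?invr_ge0//= mulrC ler_pdivrMr// mul1r.
    have ik0 : 0 <= k.+1%:R^-1 :> R by rewrite invr_ge0 ltW.
    have : Ex mu (fun x => k.+1%:R^-1 * rk k.+1 x : R) <= k.+1%:R^-1 * (c * M / (1 - q)).
      apply: (ler_cvg_to (hmu _ h01) (cvg_cst _)); apply: nearW => n.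
      rewrite (ExZ _ (rk_L1 (mu_ n) _)) ler_wpM2l//.
      apply: le_trans (mu_dist n); apply: Ex_le; [exact: rk_L1|exact: L1_pt_dist|].
      by move=> x; rewrite ge_min lexx orbT.
    by rewrite (ExZ _ (rk_L1 mu _)) ler_pM2l// invr_gt0.
  have h : (\int[mu]_x (mdist (x : E) o)%:E <= (c * M / (1 - q))%:E)%E.
    have -> : (\int[mu]_x (mdist (x : E) o)%:E = \int[mu]_x limn (fun k => (rk k x)%:E))%E.
      apply: eq_integral => x _; apply/esym/cvg_lim => //.
      by apply: cvg_EFin; [exact: nearW|exact: rk_cvg].
    rewrite monotone_convergence//.
    - apply: lime_le.
        apply: ereal_nondecreasing_is_cvgn => i j ij.
        rewrite (ExE (rk_L1 mu i)) (ExE (rk_L1 mu j)) lee_fin.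
        apply: Ex_le; [exact: rk_L1|exact: rk_L1|move=> x].
        by rewrite /rk le_min ge_min ler_nat ij/= ge_min lexx orbT.
      by apply: nearW => k; rewrite (ExE (rk_L1 mu k)) lee_fin.
    - by move=> k; apply/measurable_EFinP; apply: lip_meas (rk_lip k).
    - by move=> k x _; rewrite lee_fin.
    - move=> x _ i j ij; rewrite lee_fin /rk le_min ge_min ler_nat ij/=.
      by rewrite ge_min lexx orbT.
  exact: le_lt_trans h (ltry _).
move=> t t0 A mA.
apply: (@lip_determination R E (kernel_push mu (Pt t)) mu) => // f hf.
have hPf := lip01_Pf c0 P1_stable contr t0 hf.
have fx y : L1 (Pt t y) (f : borel E -> R) by have [[L hL] _] := hf; exact: L1_pt' hL.
have -> : Ex (kernel_push mu (Pt t)) (f : borel E -> R) = Ex mu (Pf t f).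
  by apply: (Ex_mixture (k := Pt t) (m := mu)) => //; [exact: lip01_meas|exact: lip01_L1].
have [[L /(lip_le (ler_norm L)) hL] _] := hf.
have mE n : Ex (mu_ n) (Pf t f) = Pf (n%:R + t) f o.
  by rewrite (Pf_semigroup_lip sg P1_stable _ (ler0n _ n) t0 hL).
have h1 : Pf (n%:R + t) f o - Pf n%:R f o @[n --> \oo] --> (0 : R).
  apply/cvgrPdist_le => e e0; have := kappa_nat_cvg0 (`|L| * Ex (Pt t o) (dist_to o)).
  move=> /cvgrPdist_le/(_ _ e0); apply: filterS => n; rewrite !sub0r !normrN => h.
  have := Pf_near' o t0 (ler0n _ n) (normr_ge0 L) hL; rewrite (addrC t) => /le_trans; apply.
  by rewrite -mulrA (le_trans _ h)// ler_norm.
have cv : Ex (mu_ n) (Pf t f) @[n --> \oo] --> Ex mu (f : borel E -> R).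
  rewrite -[X in _ --> X]add0r (_ : (fun n => _) =
    (fun n => (Pf (n%:R + t) f o - Pf n%:R f o) + Ex (mu_ n) (f : borel E -> R))).
    exact: cvgD h1 (hmu _ hf).
  by apply/funext => n; rewrite mE addrNK.
exact: (@cvg_unique _ (@Rhausdorff R) _ _ _ _ (hmu _ hPf) cv).
Unshelve. all: by end_near. Qed.

End existence.

Section properties.
Variable mu : probability (borel E) R.
Hypothesis mu_inv : invariant_law Pt mu.
Hypothesis mu_P1 : finite_first_moment mu.

Lemma L1_inv f L : lip L f -> L1 mu (f : borel E -> R).
Proof.
have [x0 _] := mu_P1 => hf; apply: (@L1_lip _ _ mu x0 _ L) => //.
exact/(finite_first_momentP mu x0).
Qed.

Lemma Ex_inv t f L : 0 <= t -> lip L f -> Ex mu (Pf t f) = Ex mu (f : borel E -> R).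
Proof.
move=> t0 hf; apply/esym/(Ex_mixture (k := Pt t) (m := mu)).
- by move=> B mB; exact: (esym (mu_inv t0 mB)).
- exact: lip_meas hf.
- by move=> x; exact: L1_pt' hf.
- exact: L1_inv hf.
Qed.

(** Exponential convergence to equilibrium, tested on Lipschitz functions. *)
Lemma Pf_ergodic t f L x o : 0 <= t -> 0 <= L -> lip L f ->
  `|Pf t f x - Ex mu (f : borel E -> R)| <= kap t * L * (dist_to o x + Ex mu (dist_to o)).
Proof.
move=> t0 L0 hf; rewrite -(Ex_inv t0 hf).
have hP := lip_Pf' t0 L0 hf; have iP := L1_inv hP.
have ic : L1 mu (fun=> Pf t f x) by exact: L1_cst.
have id : L1 mu (dist_to o) by exact/(finite_first_momentP mu o).
rewrite -[X in `|X - _|](Ex_cst mu) -(ExB ic iP) -[dist_to o x](Ex_cst mu).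
have ic' : L1 mu (fun=> dist_to o x) by exact: L1_cst.
rewrite -(ExD ic' id) -(ExZ _ (L1D ic' id)).
apply: Ex_dom => [|y|]; [|apply: le_trans (hP x y) _|].
- by apply: measurable_funB => //; exact: lip_meas hP.
- apply: ler_wpM2l; first exact: mulr_ge0 (kap0 t) L0.
  by have := metric_triangle x o y; rewrite (metric_sym o y). 
- by apply: L1Z; exact: L1D.
Qed.

Lemma invariant_unique (nu : probability (borel E) R) : invariant_law Pt nu ->
  forall A : set (borel E), measurable A -> nu A = mu A.
Proof.
move=> nu_inv A mA; apply: lip_determination => // f hf.
have [[L /(lip_le (ler_norm L)) hL] _] := hf.
have [x0 _] := mu_P1.
have nuE n : Ex nu (Pf n%:R f) = Ex nu (f : borel E -> R).
  apply/esym/(Ex_mixture (k := Pt n%:R) (m := nu)).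
  - by move=> B mB; exact: (esym (nu_inv _ (ler0n R n) _ mB)).
  - exact: lip01_meas.
  - by move=> x; exact: L1_pt' hL.
  - exact: lip01_L1.
rewrite -(Ex_cst nu (Ex mu (f : borel E -> R))).
have hn n := lip01_Pf c0 P1_stable contr (ler0n R n) hf.
have [||||_ h] := @Ex_dct _ (borel E) R nu (fun n => Pf n%:R f) (fun=> Ex mu (f : borel E -> R)) (fun=> 1).
- by move=> n; exact: lip01_meas.
- move=> x; apply/cvgrPdist_le => e e0.
  have := kappa_nat_cvg0 (`|L| * (dist_to x0 x + Ex mu (dist_to x0))).
  move=> /cvgrPdist_le/(_ _ e0); apply: filterS => n; rewrite sub0r normrN distrC => h.
  have := Pf_ergodic x x0 (ler0n R n) (normr_ge0 L) hL => /le_trans; apply.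
  by rewrite -mulrA (le_trans _ h)// ler_norm.
- by move=> n x; exact: lip01_norm.
- exact: L1_cst.
have h' : Ex nu (Pf n%:R f) @[n --> \oo] --> Ex nu (f : borel E -> R).
  by rewrite (funext nuE); exact: cvg_cst.
exact: (@cvg_unique _ (@Rhausdorff R) _ _ _ _ h' h).
Qed.

End properties.
End invariant.

(** * Measurability in time and the potential *)

Section time_grid.
Context {R : realType}.
Local Notation TR := (measurableTypeR R).
Implicit Types (t : R) (n : nat).

Definition pos_time t : R := Num.max 0 t.

Lemma pos_time_ge0 t : 0 <= pos_time t. Proof. by rewrite le_max lexx. Qed.

Lemma pos_timeE t : 0 <= t -> pos_time t = t. Proof. exact: max_r. Qed.

Lemma meas_pos_time : measurable_fun setT (pos_time : TR -> TR).
Proof. exact: measurable_maxr. Qed.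

Definition tick n t : nat := Num.truncn (n.+1%:R * pos_time t).

(** The next point of the grid of mesh 1/(n+1), strictly after t. *)
Definition grid n t : R := (tick n t).+1%:R / n.+1%:R.

Lemma grid_gt n t : pos_time t < grid n t.
Proof. by rewrite ltr_pdivlMr ?ltr0n// mulrC truncnS_gt. Qed.

Lemma grid_le n t : grid n t <= pos_time t + n.+1%:R^-1.
Proof.
rewrite ler_pdivrMr ?ltr0n// mulrDl mulVf ?pnatr_eq0// -natr1 lerD2r mulrC.
have y0 : 0 <= n.+1%:R * pos_time t by rewrite mulr_ge0 ?pos_time_ge0.
by have /andP[] := truncn_itv y0.
Qed.

Lemma grid_cvg t : grid n t @[n --> \oo] --> pos_time t.
Proof.
apply: (@squeeze_cvgr _ _ _ _ (fun=> pos_time t) (fun n => pos_time t + n.+1%:R^-1)).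
- by apply: nearW => n; rewrite ltW ?grid_gt//= grid_le.
- exact: cvg_cst.
- by rewrite -[X in _ --> X]addr0; apply: cvgD; [exact: cvg_cst|exact: cvg_harmonic].
Qed.

Lemma meas_tick n k : measurable ([set t | tick n t = k] : set TR).
Proof.
have -> : [set t | tick n t = k] =
    (fun t : TR => n.+1%:R * pos_time t) @^-1` `[k%:R, k.+1%:R[%classic.
  have y0 t : 0 <= n.+1%:R * pos_time t by rewrite mulr_ge0 ?pos_time_ge0.
  apply/seteqP; split => t /=; rewrite in_itv/=.
    by move=> <-; exact: truncn_itv.
  by move=> ?; apply/eqP; rewrite truncn_eq.
rewrite -[X in measurable X]setTI.
have : measurable_fun setT (fun t : TR => n.+1%:R * pos_time t : R).
  by apply: measurable_funM => //; exact: meas_pos_time.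
by apply.
Qed.

(** A function of two variables depending on the first one only through a
    countable measurable partition is jointly measurable. *)
Lemma meas_step d d' (T : measurableType d) (U : measurableType d')
    (q : TR -> nat) (H : nat -> T -> U) :
  (forall k, measurable [set t | q t = k]) -> (forall k, measurable_fun setT (H k)) ->
  measurable_fun setT (fun z : TR * T => H (q z.1) z.2).
Proof.
move=> mq mH _ B mB; rewrite setTI.
have -> : (fun z : TR * T => H (q z.1) z.2) @^-1` B =
    \bigcup_k ([set t | q t = k] `*` (H k @^-1` B)).
  apply/seteqP; split => [[t x] /= h|[t x] [k _ [/= <- h]]]//.
  by exists (q t).
apply: bigcup_measurable => k _; apply: measurableX => //.
by rewrite -[X in measurable X]setTI; exact: mH.
Qed.

End time_grid.

Section time_measurability.
Context {R : realType} {E : polishMetricType R}.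
Variable Pt : R -> R.-pker (borel E) ~> (borel E).
Hypothesis sg : transition_semigroup Pt.
Hypothesis h0 : H0 Pt.
Local Notation TR := (measurableTypeR R).
Implicit Types (f g : E -> R) (t : R) (x : E).
Local Notation Pf t f := (kernel_op (Pt t) f).

Lemma bc_meas f : bounded_continuous f -> measurable_fun setT (f : borel E -> R).
Proof. by move=> [cf _]; exact: continuous_meas. Qed.

Lemma bc_bound f : bounded_continuous f -> exists M, forall x, `|f x| <= M.
Proof.
move=> [_ [M [_ hM]]]; exists (M + 1) => x.
by apply: (hM (M + 1)) => //; rewrite ltrDl.
Qed.

Lemma bc_L1 (mu : {finite_measure set (borel E) -> \bar R}) f :
  bounded_continuous f -> L1 mu (f : borel E -> R).
Proof.
move=> hf; have [M hM] := bc_bound hf.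
exact: (L1_bounded _ (bc_meas hf) hM).
Qed.

Lemma Pf_right_cvg t f x (u : nat -> R) : 0 <= t -> bounded_continuous f ->
  (forall n, t < u n) -> u n @[n --> \oo] --> t -> Pf (u n) f x @[n --> \oo] --> Pf t f x.
Proof.
move=> t0 bf ut ucvg; have bg := h0.1 _ t0 _ bf.
have := h0.2 x _ bg => /cvg_at_rightP/(_ (fun n => u n - t)) h.
have -> : (fun n => Pf (u n) f x) = (fun n => Pf (u n - t) (Pf t f) x).
  apply/funext => n; rewrite -[in LHS](subrK t (u n)).
  apply: Pf_semigroup => //.
  - by rewrite subr_ge0 ltW.
  - exact: bc_meas.
  - by move=> y; exact: (bc_L1 (pk (Pt t) y)).
  - exact: (bc_L1 (pk (Pt _) x)).
apply: h; split; first by move=> n; rewrite subr_gt0.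
by rewrite -(subrr t); apply: cvgB => //; exact: cvg_cst.
Qed.

Lemma meas_Pf_bc f : bounded_continuous f ->
  measurable_fun setT (fun z : TR * borel E => Pf (pos_time z.1) f z.2).
Proof.
move=> bf.
apply: (@measurable_fun_cvg _ _ _ _ (fun n (z : TR * borel E) => Pf (grid n z.1) f z.2)).
  move=> n; apply: (@meas_step _ _ _ _ _ (tick n) (fun k y => Pf (k.+1%:R / n.+1%:R) f y)).
    exact: meas_tick.
  move=> k; apply: bc_meas; apply: h0.1 => //.
move=> [t x] _ /=; apply: Pf_right_cvg => //; first exact: pos_time_ge0.
- by move=> n; exact: grid_gt.
- exact: grid_cvg.
Qed.

Lemma meas_Pf f L : (forall t x, 0 <= t -> L1 (Pt t x) (f : borel E -> R)) -> lip L f ->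
  measurable_fun setT (fun z : TR * borel E => Pf (pos_time z.1) f z.2).
Proof.
move=> fi hf.
apply: (@measurable_fun_cvg _ _ _ _
  (fun n (z : TR * borel E) => Pf (pos_time z.1) (fun y => clamp n%:R (f y)) z.2)).
  move=> n; apply: meas_Pf_bc; apply: (lip_bc (L := L) (M := n%:R)); first exact: lip_clamp.
  by move=> x; exact: clamp_norm.
move=> [t x] _ /=.
have it := fi _ x (pos_time_ge0 t).
apply: (@Ex_dct _ (borel E) R (Pt (pos_time t) x) _ _ (fun y => `|f y|) _ _ _ _).2.
- by move=> n; apply: (lip_meas (L := L)); exact: lip_clamp.
- by move=> y; exact: cvg_clamp.
- by move=> n y; exact: clamp_le.
- exact: L1_norm.
Qed.

End time_measurability.

Section potential.
Context {R : realType} {E : polishMetricType R}.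
Variable Pt : R -> R.-pker (borel E) ~> (borel E).
Hypothesis sg : transition_semigroup Pt.
Hypothesis h0 : H0 Pt.
Variables (c gam : R).
Hypotheses (c0 : 0 < c) (gam0 : 0 < gam).
Hypothesis P1_stable : forall (t : R) (mu : probability (borel E) R), 0 <= t ->
  finite_first_moment mu -> finite_first_moment (kernel_push mu (Pt t)).
Hypothesis contr : forall (t : R) (mu nu : probability (borel E) R), 0 <= t ->
  finite_first_moment mu -> finite_first_moment nu ->
  (wasserstein (kernel_push mu (Pt t)) (kernel_push nu (Pt t)) <=
   (c * expR (- gam * t))%:E * wasserstein mu nu)%E.
Variable mu : probability (borel E) R.
Hypothesis mu_inv : invariant_law Pt mu.
Hypothesis mu_P1 : finite_first_moment mu.
Variable o : E.
Local Notation TR := (measurableTypeR R).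
Implicit Types (f : E -> R) (s t : R) (x y : E).

Local Notation Pf t f := (kernel_op (Pt t) f).
Local Notation kap := (kappa c gam).
Let kap0 t : 0 <= kap t. Proof. exact: kappa_ge0. Qed.
Let lip_Pf' := lip_Pf c0 P1_stable contr.
Let L1_pt' := L1_pt P1_stable.
Let Pf_ergodic' := Pf_ergodic c0 P1_stable contr mu_inv mu_P1.

Lemma kappa_homo s t : s <= t -> kap t <= kap s.
Proof.
by move=> st; rewrite ler_pM2l// ler_expR !mulNr lerN2 ler_wpM2l// ltW.
Qed.

(** Size of the starting point as seen by the ergodic estimate. *)
Definition weight : borel E -> R := fun x => dist_to o x + Ex mu (dist_to o).

Lemma weight_ge0 x : 0 <= weight x.
Proof. by rewrite addr_ge0 ?dist_ge0// Ex_ge0// => ?; exact: dist_ge0. Qed.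

Lemma lip_weight : lip 1 weight.
Proof. by move=> x y; rewrite /weight opprD addrACA subrr addr0; exact: lip_mdist. Qed.

Variables (g : E -> R) (L : R).
Hypotheses (L0 : 0 <= L) (hg : lip L g) (g0 : Ex mu (g : borel E -> R) = 0).

Lemma Pf_decay t x : 0 <= t -> `|Pf t g x| <= kap t * L * weight x.
Proof. by move=> t0; have := Pf_ergodic' x o t0 L0 hg; rewrite g0 subr0. Qed.

Lemma meas_Pfg : measurable_fun setT (fun z : TR * borel E => Pf (pos_time z.1) g z.2).
Proof. by apply: (meas_Pf sg h0 _ hg) => t x t0; exact: L1_pt' hg. Qed.

Let path x : TR -> R := fun t => Pf (pos_time t) g x.

Let meas_path x : measurable_fun setT (path x).
Proof. exact: (measurable_fun_pair1 (f := fun z : TR * borel E => Pf (pos_time z.1) g z.2) x meas_Pfg). Qed.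

Let path_bound x t : `|path x t| <= c * L * weight x.
Proof.
apply: le_trans (Pf_decay _ (pos_time_ge0 t)) _.
apply: ler_wpM2r; first exact: weight_ge0.
apply: ler_wpM2r => //; apply: le_trans (kappa_homo (pos_time_ge0 t)) _.
by rewrite /kappa mulr0 expR0 mulr1.
Qed.

Let L1_path x a b : L1 (tm a b) (path x).
Proof. exact: (L1_bounded (tm a b) (meas_path x) (path_bound x)). Qed.

Definition chi_ (n : nat) x : R := Ex (tm 0 n%:R) (fun t : TR => Pf (pos_time t) g x).

Let chi_S n x : chi_ n.+1 x - chi_ n x = Ex (tm n%:R n.+1%:R) (path x).
Proof.
rewrite /chi_ (@Ex_tm_split _ 0 n%:R n.+1%:R (path x)) ?ler0n ?ler_nat//.
by rewrite addrAC subrr add0r.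
Qed.

Let unit_len n : n.+1%:R - n%:R = 1 :> R.
Proof. by rewrite -natr1 addrAC subrr add0r. Qed.

Let chi_step x n : `|chi_ n.+1 x - chi_ n x| <= c * L * weight x * expR (- gam) ^+ n.
Proof.
rewrite (chi_S n x); have := @Ex_tm_bound _ n%:R n.+1%:R (path x) (kap n%:R * L * weight x) _ (meas_path x).
rewrite unit_len mulr1 kappa_nat ler_nat => /(_ (leqnSn n)) h.
rewrite [leRHS](_ : _ = c * expR (- gam) ^+ n * L * weight x); last by ring.
apply: h => t /andP[nt _]; have t0 : 0 <= t by rewrite (le_trans _ nt).
apply: le_trans (Pf_decay _ (pos_time_ge0 t)) _.
rewrite pos_timeE// -kappa_nat ler_wpM2r ?weight_ge0// ler_wpM2r//.
exact: kappa_homo.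
Qed.

Let chi_lip_step x y n : `|(chi_ n.+1 x - chi_ n.+1 y) - (chi_ n x - chi_ n y)|
  <= c * L * mdist x y * expR (- gam) ^+ n.
Proof.
have swap (a1 a2 a3 a4 : R) : (a1 - a2) - (a3 - a4) = (a1 - a3) - (a2 - a4) by ring.
rewrite swap.
rewrite (chi_S n x) (chi_S n y) -(ExB (L1_path x n%:R n.+1%:R) (L1_path y n%:R n.+1%:R)).
have := @Ex_tm_bound _ n%:R n.+1%:R (fun t => path x t - path y t) (kap n%:R * L * mdist x y) _ _.
rewrite unit_len mulr1 kappa_nat ler_nat => /(_ (leqnSn n)) h.
rewrite [leRHS](_ : _ = c * expR (- gam) ^+ n * L * mdist x y); last by ring.
apply: h => [|t /andP[nt _]]; first exact: measurable_funB.
have t0 : 0 <= t by rewrite (le_trans _ nt).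
apply: le_trans (lip_Pf' (pos_time_ge0 t) L0 hg x y) _.
rewrite pos_timeE// -kappa_nat ler_wpM2r ?mdist_ge0// ler_wpM2r//.
exact: kappa_homo.
Qed.

Let q0 : 0 <= expR (- gam). Proof. exact: expR_ge0. Qed.
Let q1 : expR (- gam) < 1. Proof. by rewrite expR_lt1 oppr_lt0. Qed.
Let q10 : 0 <= (1 - expR (- gam))^-1. Proof. by rewrite invr_ge0 subr_ge0 ltW. Qed.

Let cLw0 x : 0 <= c * L * weight x.
Proof. by rewrite !mulr_ge0 ?weight_ge0// ltW. Qed.

Let chi_0 x : chi_ 0 x = 0.
Proof. by apply/eqP; rewrite -normr_le0; have := @Ex_tm_bound _ 0 0 (path x) _ (lexx 0) (meas_path x) (fun t _ => path_bound x t); rewrite subrr mulr0. Qed.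

Lemma chi_bound n x : `|chi_ n x| <= c * L / (1 - expR (- gam)) * weight x.
Proof.
have := geometric_telescope (cLw0 x) q0 q1 (chi_step x) (leq0n n).
by rewrite expr0 mulr1 chi_0 subr0 mulrAC.
Qed.

Lemma chi_is_cvg x : cvgn (chi_ ^~ x).
Proof.
apply/cauchy_cvgP/cauchy_exP => e e0.
have := cvg_geo q0 q1; move=> /(cvgMl_tmp (a := c * L * weight x / (1 - expR (- gam)))).
rewrite mulr0 => /cvgrPdist_lt/(_ _ e0)[N _ hN].
exists (chi_ N x); change (\forall n \near \oo, ball (chi_ N x) e (chi_ n x)).
near=> n; rewrite -ball_normE/= distrC.
apply: le_lt_trans (geometric_telescope (cLw0 x) q0 q1 (chi_step x) _) _.
  by near: n; exact: nbhs_infty_ge.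
by have := hN N (leqnn N); rewrite /= sub0r normrN; apply: le_lt_trans; exact: ler_norm.
Unshelve. all: by end_near. Qed.

(** The potential (Poisson corrector): the integral over all times of the
    centred semigroup, obtained as a limit over finite horizons so that only
    finite measures in time occur. *)
Definition chi x : R := limn (chi_ ^~ x).

Lemma chi_cvg x : chi_ n x @[n --> \oo] --> chi x.
Proof. exact: chi_is_cvg. Qed.

Definition chi_lipc : R := c * L / (1 - expR (- gam)).

Lemma chi_lipc_ge0 : 0 <= chi_lipc.
Proof. by rewrite mulr_ge0// mulr_ge0// ltW. Qed.

Lemma lip_chi_ n : lip chi_lipc (chi_ n).
Proof.
move=> x y.
have C0 : 0 <= c * L * mdist x y by rewrite !mulr_ge0 ?mdist_ge0// ltW.
have := geometric_telescope C0 q0 q1 (chi_lip_step x y) (leq0n n).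
by rewrite expr0 mulr1 (chi_0 x) (chi_0 y) !subrr subr0 mulrAC.
Qed.

Lemma lip_chi : lip chi_lipc chi.
Proof.
move=> x y.
have h : `|chi_ n x - chi_ n y| @[n --> \oo] --> `|chi x - chi y|.
  by apply: cvg_norm; apply: cvgB; exact: chi_cvg.
apply: (ler_cvg_to h (cvg_cst _)); apply: nearW => n; exact: lip_chi_.
Qed.

(** The Poisson equation, in integrated form. *)
Lemma chi_poisson h x : 0 <= h ->
  chi x - Pf h chi x = Ex (tm 0 h) (fun t : TR => Pf (pos_time t) g x).
Proof.
move=> hh0.
have Pfchi_ n : Pf h (chi_ n) x = chi_ n x + Ex (tm n%:R (n%:R + h)) (path x) - Ex (tm 0 h) (path x).
  have -> : Pf h (chi_ n) x = Ex (tm 0 n%:R) (fun t : TR => Pf (h + pos_time t) g x).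
    rewrite /kernel_op /chi_.
    have mz : measurable_fun setT (fun z : borel E * TR => Pf (pos_time z.2) g z.1).
      have msw : measurable_fun setT (fun z : borel E * TR => (z.2, z.1)).
        by apply/measurable_fun_pairP; split; [exact: measurable_snd|exact: measurable_fst].
      exact: (measurableT_comp meas_Pfg msw).
    have iw : L1 (pk (Pt h) x) (fun y => c * L * weight y).
      by apply: L1Z; exact: (L1_pt' x hh0 lip_weight).
    have mP t : measurable_fun setT (Pf (pos_time t) g : borel E -> R).
      exact: (lip_meas (lip_Pf' (pos_time_ge0 t) L0 hg)).
    have iP t : L1 (pk (Pt h) x) (Pf (pos_time t) g).
      by apply: (L1_dom (mP t) _ iw) => y; exact: path_bound.
    have iB t : Ex (pk (Pt h) x) (fun y => `|Pf (pos_time t) g y|) <=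
        Ex (pk (Pt h) x) (fun y => c * L * weight y).
      by apply: (Ex_le (L1_norm (iP t)) iw) => y; exact: path_bound.
    have iF := @L1_prod _ _ _ _ R (pk (Pt h) x) (tm 0 n%:R)
      (fun z : borel E * TR => Pf (pos_time z.2) g z.1) _ mz iP iB.
    etransitivity; first exact: (Ex_fubini iF).
    by apply: eq_Ex => t; exact: (esym (Pf_semigroup_lip sg P1_stable x hh0 (pos_time_ge0 t) hg)).
  have -> : Ex (tm 0 n%:R) (fun t : TR => Pf (h + pos_time t) g x) =
            Ex (tm (0 + h) (n%:R + h)) (path x).
    rewrite (@Ex_tm_shift R 0 n%:R h (path x) (meas_path x) (L1_path x _ _)).
    have mh : measurable_fun setT (fun t : TR => t + h : TR) by exact: measurable_funD.
    apply: Ex_tm_eq.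
    - have -> : (fun t : TR => Pf (h + pos_time t) g x) = path x \o (fun t : TR => pos_time t + h : TR).
        apply/funext => t; have p0 := pos_time_ge0 t.
        by rewrite /path/= (pos_timeE (addr_ge0 p0 hh0)) (addrC h).
      apply: measurableT_comp => //.
      by apply: measurable_funD => //; exact: meas_pos_time.
    - exact: (measurableT_comp (meas_path x) mh).
    - move=> s /andP[s0 _]; by rewrite /path (pos_timeE s0) (pos_timeE (addr_ge0 s0 hh0)) (addrC h).
  have hn : h <= n%:R + h by rewrite lerDr.
  have nh : n%:R <= n%:R + h by rewrite lerDl.
  have e1 := Ex_tm_split hh0 hn (L1_path x 0 (n%:R + h)).
  have e2 := Ex_tm_split (ler0n R n) nh (L1_path x 0 (n%:R + h)).
  by rewrite add0r /chi_ -/(path x); lra.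
have ctail : Ex (tm n%:R (n%:R + h)) (path x) @[n --> \oo] --> (0 : R).
  apply/cvgrPdist_le => e e0.
  have := kappa_nat_cvg0 c gam0 (L * weight x * h).
  move=> /cvgrPdist_le/(_ _ e0); apply: filterS => n; rewrite !sub0r !normrN => hn.
  apply: le_trans (le_trans (ler_norm _) hn).
  have := @Ex_tm_bound _ n%:R (n%:R + h) (path x) (kap n%:R * L * weight x) _ (meas_path x).
  rewrite addrAC subrr add0r lerDl !mulrA => -> // t /andP[nt _].
  have t0 : 0 <= t by rewrite (le_trans _ nt).
  apply: le_trans (Pf_decay _ (pos_time_ge0 t)) _.
  rewrite pos_timeE// ler_wpM2r ?weight_ge0// ler_wpM2r//.
  exact: kappa_homo.
have c1 : Pf h (chi_ n) x @[n --> \oo] --> Pf h chi x.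
  apply: (@Ex_dct _ (borel E) R (Pt h x) _ _ (fun y => chi_lipc * weight y) _ _ _ _).2.
  - by move=> n; exact: (lip_meas (lip_chi_ n)).
  - exact: chi_cvg.
  - move=> n y; exact: chi_bound.
  - by apply: L1Z; exact: L1_pt' lip_weight.
have c2 : Pf h (chi_ n) x @[n --> \oo] --> chi x - Ex (tm 0 h) (path x).
  rewrite (funext Pfchi_) -[in X in _ --> X](addr0 (chi x)).
  by apply: cvgB; [apply: cvgD => //; exact: chi_cvg|exact: cvg_cst].
have ce := @cvg_unique _ (@Rhausdorff R) _ _ _ _ c1 c2.
by rewrite ce opprD opprK addrA subrr add0r.
Qed.

End potential.

(** * Conditional expectations given the past *)

Section restriction.
Context d (T : measurableType d) (R : realType).
Variables (mu : {measure set T -> \bar R}) (A : set T) (mA : measurable A).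

Lemma L1_indic (f : T -> R) : L1 mu f -> L1 mu (fun x => \1_A x * f x).
Proof.
move=> iF; apply: (@L1_dom _ _ _ mu _ (fun x => `|f x|)) => [|x|]; last exact: L1_norm.
  by apply: measurable_funM => //; exact: L1_meas iF.
by rewrite normrM indicE; case: (x \in A); rewrite ?normr1 ?mul1r// normr0 mul0r.
Qed.

Lemma ge0_integral_mrestr (f : T -> \bar R) : measurable_fun setT f -> (forall x, 0 <= f x)%E ->
  (\int[mrestr mu mA]_x f x = \int[mu]_(x in A) f x)%E.
Proof.
move=> mf f0.
rewrite -(@eq_measure_integral _ T R A mu (mrestr mu mA)); last first.
  by move=> B mB /setIidPl AE; exact: (congr1 mu AE).
rewrite (@ge0_negligible_integral _ T R (mrestr mu mA) setT (~` A) f) => //.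
- by rewrite setTD setCK.
- exact: measurableC.
- by rewrite [LHS](_ : _ = mu (~` A `&` A))// setICl measure0.
Qed.

Lemma L1_mrestr (f : T -> R) : L1 mu f -> L1 (mrestr mu mA) f.
Proof.
move=> iF; have mf := L1_meas iF; apply/integrableP; split; first exact/measurable_EFinP.
rewrite ge0_integral_mrestr//; last by apply: measurableT_comp => //; exact/measurable_EFinP.
have /integrableP[_] : mu.-integrable A (EFin \o f) by exact: (integrableS measurableT).
by [].
Qed.

Lemma Ex_mrestr (f : T -> R) : L1 mu f -> Ex (mrestr mu mA) f = Ex mu (fun x => \1_A x * f x).
Proof.
move=> iF; have mf := L1_meas iF; have mF : measurable_fun setT (EFin \o f) by exact/measurable_EFinP.
transitivity (Rintegral mu A f).
  congr fine; rewrite integralE [RHS]integralE; congr (_ - _)%E.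
  - by rewrite ge0_integral_mrestr//; exact: measurable_funepos.
  - by rewrite ge0_integral_mrestr//; exact: measurable_funeneg.
rewrite Rintegral_mkcond; apply: eq_Ex => x.
by rewrite patchE indicE; case: (x \in A); rewrite ?mul1r ?mul0r.
Qed.

End restriction.

Section kernel_precomposition.
Context d1 d2 d3 (W : measurableType d1) (X : measurableType d2) (Y : measurableType d3)
  (R : realType).
Variables (k : R.-pker X ~> Y) (phi : W -> X).
Hypothesis mphi : measurable_fun setT phi.

Definition kprecomp (w : W) : {measure set Y -> \bar R} := k (phi w).

Let kprecomp_meas U : measurable U -> measurable_fun setT (kprecomp ^~ U).
Proof. by move=> mU; exact: (measurableT_comp (measurable_kernel k U mU) mphi). Qed.

HB.instance Definition _ := isKernel.Build _ _ _ _ _ kprecomp kprecomp_meas.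

Let kprecomp_prob w : kprecomp w setT = 1%E.
Proof. exact: prob_kernel. Qed.

HB.instance Definition _ := Kernel_isProbability.Build _ _ _ _ _ kprecomp kprecomp_prob.

Definition kprecomp_pker : R.-pker W ~> Y := kprecomp.

End kernel_precomposition.

Section conditional.
Context d (T : measurableType d) (R : realType) (P : probability T R).
Implicit Types (G : set_system T) (f g W : T -> R).

(** Equality of the conditional expectations given G, stated through integrals
    over the events of G so that no version has to be chosen. *)
Definition ceq G g g' := [/\ L1 P g, L1 P g' & forall A, G A ->
  Ex P (fun w => \1_A w * g w) = Ex P (fun w => \1_A w * g' w)].

Variable G : set_system T.
Hypothesis GT : G setT.
Hypothesis Gm : forall A, G A -> measurable A.

Lemma ceq_refl g : L1 P g -> ceq G g g.
Proof. by split. Qed.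

Lemma ceq_sym g g' : ceq G g g' -> ceq G g' g.
Proof. by case=> i1 i2 h; split => // A GA; rewrite h. Qed.

Lemma ceq_trans g g' g'' : ceq G g g' -> ceq G g' g'' -> ceq G g g''.
Proof. by case=> i1 i2 h [i2' i3 h']; split => // A GA; rewrite h// h'. Qed.

Let ind_lin A f g : G A -> L1 P f -> L1 P g ->
  Ex P (fun w => \1_A w * (f w + g w)) = Ex P (fun w => \1_A w * f w) + Ex P (fun w => \1_A w * g w).
Proof.
move=> GA iF ig; have mA := Gm GA.
rewrite -(ExD (L1_indic mA iF) (L1_indic mA ig)).
by apply: eq_Ex => w; rewrite mulrDr.
Qed.

Lemma ceqD f f' g g' : ceq G f f' -> ceq G g g' -> ceq G (fun w => f w + g w) (fun w => f' w + g' w).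
Proof.
move=> [f1 f2 hf] [g1 g2 hg]; split; [exact: L1D|exact: L1D|move=> A GA].
by rewrite !ind_lin// hf// hg.
Qed.

Lemma ceqZ k f f' : ceq G f f' -> ceq G (fun w => k * f w) (fun w => k * f' w).
Proof.
move=> [f1 f2 hf]; split; [exact: L1Z|exact: L1Z|move=> A GA; have mA := Gm GA].
have e g : L1 P g -> Ex P (fun w => \1_A w * (k * g w)) = k * Ex P (fun w => \1_A w * g w).
  by move=> ig; rewrite -(ExZ _ (L1_indic mA ig)); apply: eq_Ex => w; ring.
by rewrite !e// hf.
Qed.

Lemma eq_ceq f f' g g' : f =1 g -> f' =1 g' -> ceq G f f' -> ceq G g g'.
Proof. by move=> /funext -> /funext ->. Qed.

Lemma ceqB f f' g g' : ceq G f f' -> ceq G g g' -> ceq G (fun w => f w - g w) (fun w => f' w - g' w).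
Proof.
by move=> hf /(ceqZ (-1)) hg; apply: (eq_ceq _ _ (ceqD hf hg)) => w; rewrite mulN1r.
Qed.

Lemma ceq_Ex g g' : ceq G g g' -> Ex P g = Ex P g'.
Proof.
move=> [_ _ /(_ _ GT)].
have e f : Ex P (fun w => \1_(setT : set T) w * f w) = Ex P f.
  by apply: eq_Ex => w; rewrite indicE in_setT mul1r.
by rewrite !e.
Qed.

(** Measurability with respect to G, in the form used for layer approximations. *)
Definition gmeas W := forall c : R, G [set w | c < W w].

Let layer01 W g n : gmeas W -> (forall w, 0 <= W w <= 1) -> measurable_fun setT W -> L1 P g ->
  `|Ex P (fun w => W w * g w) - n.+1%:R^-1 * \sum_(i < n.+1)
     Ex P (fun w => \1_([set w | i%:R / n.+1%:R < W w]) w * g w)| <= n.+1%:R^-1 * Ex P (fun w => `|g w|).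
Proof.
move=> gW W01 mW ig.
have mI i := Gm (gW (i%:R / n.+1%:R)).
have n0 : 0 < n.+1%:R :> R by rewrite ltr0n.
have iI (i : nat) := L1_indic (mI i) ig.
have iS : L1 P (fun w => \sum_(i < n.+1) \1_([set w | i%:R / n.+1%:R < W w]) w * g w).
  exact: (@L1_sum _ _ _ P _ _ (fun (i : 'I_n.+1) w => \1_([set w | i%:R / n.+1%:R < W w]) w * g w)).
have iW : L1 P (fun w => W w * g w).
  by apply: (L1_mulbounded (M := 1)) => // w; have /andP[? ?] := W01 w; rewrite ger0_norm.
rewrite -(Ex_sum (index_enum 'I_n.+1) (F := fun (i : 'I_n.+1) w => \1_([set w | i%:R / n.+1%:R < W w]) w * g w))//.
rewrite -(ExZ _ iS) -(ExB iW (L1Z _ iS)) -(ExZ _ (L1_norm ig)).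
apply: Ex_dom; [exact: (L1_meas (L1B iW (L1Z _ iS)))|move=> w|exact: (L1Z _ (L1_norm ig))].
rewrite -big_distrl/= mulrA -mulrBl normrM ler_wpM2r//.
have /andP[W0 W1] := W01 w.
have -> : \sum_(i < n.+1) \1_([set w | i%:R / n.+1%:R < W w]) w = \sum_(i < n.+1) ((i%:R < n.+1%:R * W w)%R)%:R :> R.
  apply: eq_bigr => i _; rewrite indicE.
  have -> : (w \in [set w | i%:R / n.+1%:R < W w]) = (i%:R / n.+1%:R < W w).
    by apply/idP/idP; rewrite inE.
  by rewrite ltr_pdivrMr// mulrC.
have /andP[] := @layer_count R n.+1 (n.+1%:R * W w) (mulr_ge0 (ltW n0) W0).
rewrite min_l; last by rewrite ler_piMr// ltW.
move: (\sum_(i < _) _) => S h1 h2; rewrite distrC ger0_norm; last first.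
  by rewrite subr_ge0 mulrC ler_pdivlMr// mulrC.
by rewrite lerBlDr mulrC ler_pdivrMr// mulrDl mulVf ?gt_eqF// addrC mulrC.
Qed.

Let ceq_01 W g g' : gmeas W -> (forall w, 0 <= W w <= 1) -> measurable_fun setT W -> ceq G g g' ->
  Ex P (fun w => W w * g w) = Ex P (fun w => W w * g' w).
Proof.
move=> gW W01 mW [ig ig' hg]; apply/eqP; rewrite -subr_eq0 -normr_le0; apply/ler_addgt0Pr => e e0.
rewrite add0r; set C := Ex P (fun w => `|g w|) + Ex P (fun w => `|g' w|).
have C0 : 0 <= C by rewrite addr_ge0// Ex_ge0.
pose n := Num.truncn (C / e).
have h1 := layer01 n gW W01 mW ig; have h2 := layer01 n gW W01 mW ig'.
set s := (X in Ex P _ - X) in h1; set s' := (X in Ex P _ - X) in h2.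
have ss : s = s' by congr (_ * _); apply: eq_bigr => i _; apply: hg.
rewrite (_ : _ - _ = (Ex P (fun w => W w * g w) - s) - (Ex P (fun w => W w * g' w) - s')); last first.
  by rewrite ss; ring.
rewrite (le_trans (ler_normB _ _))// (le_trans (lerD h1 h2))// -mulrDr -/C.
rewrite mulrC ler_pdivrMr ?ltr0n// mulrC -ler_pdivrMr//.
by rewrite ltW// truncnS_gt.
Qed.

Lemma ceq_bounded W g g' M : gmeas W -> (forall w, `|W w| <= M) -> measurable_fun setT W ->
  ceq G g g' -> Ex P (fun w => W w * g w) = Ex P (fun w => W w * g' w).
Proof.
move=> gW WM mW hg; have [ig ig' _] := hg.
have M10 : 0 < 2 * (`|M| + 1) by rewrite mulr_gt0// ltr_pwDr.
pose V w := (2 * (`|M| + 1))^-1 * (W w + (`|M| + 1)).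
have WE w : W w = 2 * (`|M| + 1) * V w - (`|M| + 1).
  by rewrite /V mulrA divff ?gt_eqF// mul1r addrK.
have mV : measurable_fun setT V by apply: measurable_funM => //; exact: measurable_funD.
have V01 w : 0 <= V w <= 1.
  have := WM w; rewrite ler_norml => /andP[w1 w2]; have := ler_norm M => hM.
  apply/andP; split; first by rewrite mulr_ge0 ?invr_ge0 ?(ltW M10)//; lra.
  by rewrite /V mulrC ler_pdivrMr// mul1r; lra.
have gV : gmeas V.
  move=> k; rewrite (_ : [set w | _] = [set w | 2 * (`|M| + 1) * k - (`|M| + 1) < W w])//.
  by apply/seteqP; split => w /=; rewrite WE ltrD2r ltr_pM2l.
have hV := ceq_01 gV V01 mV hg.
have bV f : L1 P f -> L1 P (fun w => V w * f w).
  by move=> iF; apply: (L1_mulbounded (M := 1)) => // w; have /andP[? ?] := V01 w; rewrite ger0_norm.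
have e f : L1 P f -> Ex P (fun w => W w * f w) =
    2 * (`|M| + 1) * Ex P (fun w => V w * f w) - (`|M| + 1) * Ex P f.
  move=> iF; rewrite -(ExZ _ (bV _ iF)) -(ExZ _ iF) -(ExB (L1Z _ (bV _ iF)) (L1Z _ iF)).
  by apply: eq_Ex => w; rewrite WE; ring.
by rewrite !e// hV (ceq_Ex hg).
Qed.

Hypothesis GI : forall A B, G A -> G B -> G (A `&` B).
Hypothesis GC : forall A, G A -> G (~` A).

(** Known factors can be taken out of the conditional expectation. *)
Lemma ceq_mul W g g' : gmeas W -> measurable_fun setT W -> L1 P (fun w => W w * g w) ->
  L1 P (fun w => W w * g' w) -> ceq G g g' -> ceq G (fun w => W w * g w) (fun w => W w * g' w).
Proof.
move=> gW mW iWg iWg' hg; have [ig ig' _] := hg; split => // A GA; have mA := Gm GA.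
pose V (n : nat) w := \1_A w * clamp n%:R (W w).
have mcl (n : nat) : measurable_fun setT (fun w => clamp n%:R (W w)).
  by apply: measurable_maxr => //; exact: measurable_minr.
have mV n : measurable_fun setT (V n) by exact: measurable_funM.
have V_le n w : `|V n w| <= n%:R.
  rewrite normrM indicE; case: (w \in A); rewrite ?normr1 ?mul1r ?normr0 ?mul0r//.
  exact: clamp_norm.
have gcl (n : nat) : gmeas (fun w => clamp n%:R (W w)).
  move=> k; have [kn|kn] := ltP k (- n%:R).
    rewrite (_ : [set w | _] = setT)//; apply/seteqP; split => w //= _.
    by apply: (lt_le_trans kn); rewrite /clamp le_max lexx.
  have [nk|nk] := leP n%:R k.
    rewrite (_ : [set w | _] = ~` setT); first exact: GC.
    rewrite setCT; apply/seteqP; split => w //=; rewrite ltNge => /negP; apply.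
    by rewrite (le_trans _ nk)// (le_trans (ler_norm _))// clamp_norm.
  rewrite (_ : [set w | _] = [set w | k < W w])//.
  by apply/seteqP; split => w /=; rewrite /clamp lt_max lt_min nk/= ltNge kn.
have GU B C : G B -> G C -> G (B `|` C).
  by move=> GB GC'; rewrite -[B `|` C]setCK setCU; apply: GC; apply: GI; exact: GC.
have gV n : gmeas (V n).
  move=> k; have [k0|k0] := ltP k 0.
    rewrite (_ : [set w | _] = (A `&` [set w | k < clamp n%:R (W w)]) `|` ~` A).
      by apply: GU; [exact: (GI GA (gcl n k))|exact: GC].
    apply/seteqP; split => w /=; rewrite /V indicE.
      by case: (boolP (w \in A)); rewrite ?mul1r ?inE ?notin_setE; [left|right].
    case: (boolP (w \in A)); rewrite ?mul1r ?mul0r// inE => wA.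
    by case=> [[]|].
  rewrite (_ : [set w | _] = A `&` [set w | k < clamp n%:R (W w)]); first exact: (GI GA (gcl n k)).
  apply/seteqP; split => w /=; rewrite /V indicE.
    case: (boolP (w \in A)); rewrite ?mul1r ?mul0r ?inE// => _.
    by rewrite ltNge k0.
  by move=> [wA]; rewrite mem_set// mul1r.
have cv f : L1 P f -> L1 P (fun w => W w * f w) ->
    Ex P (fun w => V n w * f w) @[n --> \oo] --> Ex P (fun w => \1_A w * (W w * f w)).
  move=> iF iWf; apply: (@Ex_dct _ _ _ P _ _ (fun w => `|W w * f w|) _ _ _ (L1_norm iWf)).2.
  - by move=> n; apply: measurable_funM => //; exact: L1_meas iF.
  - move=> w; rewrite mulrA; apply: cvgMr_tmp; apply: cvgMl_tmp; exact: cvg_clamp.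
  - move=> n w; rewrite !normrM ler_wpM2r// indicE.
    by case: (w \in A); rewrite ?normr1 ?mul1r ?normr0 ?mul0r// clamp_le.
apply: (@cvg_unique _ (@Rhausdorff R) _ _ _ _ (cv _ ig iWg)).
rewrite (_ : (fun n => _) = (fun n => Ex P (fun w => V n w * g' w))); first exact: cv.
by apply/funext => n; exact: (ceq_bounded (gV n) (V_le n) (mV n) hg).
Qed.

End conditional.

Lemma ceq_sub d (T : measurableType d) (R : realType) (P : probability T R)
    (G H : set_system T) (g g' : T -> R) : G `<=` H -> ceq P H g g' -> ceq P G g g'.
Proof. by move=> GH [? ? h]; split => // A /GH; exact: h. Qed.

(** * The process *)

(** Measurability of a parametrised integral, with no integrability required. *)
Lemma meas_Ex_param d1 d2 (T1 : measurableType d1) (T2 : measurableType d2) (R : realType)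
    (m2 : {sigma_finite_measure set T2 -> \bar R}) (f : T1 * T2 -> R) :
  measurable_fun setT f -> measurable_fun setT (fun x => Ex m2 (fun y => f (x, y))).
Proof.
move=> mf; have mF : measurable_fun setT (EFin \o f) by exact/measurable_EFinP.
apply: measurableT_comp => //.
rewrite [X in measurable_fun _ X](_ : _ =
    (fubini_F m2 (EFin \o f)^\+ \- fubini_F m2 (EFin \o f)^\-)%E); last first.
  apply/funext => x; rewrite /fubini_F [LHS]integralE.
  congr (_ - _)%E; apply: eq_integral => y _.
    by rewrite !funeposE.
  by rewrite !funenegE.
apply: emeasurable_funB.
- by apply: measurable_fun_fubini_tonelli_F => //; exact: measurable_funepos.
- by apply: measurable_fun_fubini_tonelli_F => //; exact: measurable_funeneg.
Qed.

Section process.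
Context {R : realType} {E : polishMetricType R}.
Context {d : measure_display} {Omega : measurableType d}.
Variables (P : probability Omega R) (Pt : R -> R.-pker (borel E) ~> (borel E)).
Variables (mu0 : probability (borel E) R) (X : R -> {RV P >-> borel E}).
Hypothesis XM : markov_process X Pt mu0.
Local Notation TR := (measurableTypeR R).
Local Notation Pf t f := (kernel_op (Pt t) f).
Implicit Types (a s t : R) (f g : borel E -> R).

(** The process, frozen at its initial value for negative times, so that it is
    jointly measurable on the whole line. *)
Definition proc s : Omega -> borel E := X (pos_time s).

Lemma meas_proc s : measurable_fun setT (proc s).
Proof. exact: measurable_funPT. Qed.

Lemma meas_proc2 : measurable_fun setT (fun z : TR * Omega => proc z.1 z.2).
Proof.
have [mX _ _] := XM.
have mD : measurable (`[0%R, +oo[ `*` [set: Omega] : set (TR * Omega)).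
  exact: measurableX.
have mp : measurable_fun setT (fun z : TR * Omega => (pos_time z.1 : TR, z.2)).
  apply/measurable_fun_pairP; split; last exact: measurable_snd.
  exact: (measurableT_comp (@meas_pos_time R) measurable_fst).
apply: (measurable_comp mD _ mX mp).
by move=> _ [z _ <-]; split => //=; rewrite in_itv/= andbT pos_time_ge0.
Qed.

Definition past a : set_system Omega := natural_filtration X a.

Definition pastT a := g_sigma_algebraType
  (\bigcup_(s in `[0%R, a]) preimage_set_system setT (X s) measurable).

Lemma past_measurable a A : past a A -> measurable A.
Proof.
move: A; apply: smallest_sub; first exact: sigma_algebra_measurable.
move=> _ [s _ [B mB <-]]; exact: (@measurable_funPT _ _ _ _ (X s) measurableT _ mB).
Qed.

Lemma past_le a b : a <= b -> past a `<=` past b.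
Proof.
move=> ab; apply: sub_sigma_algebra2 => A [s]; rewrite /= in_itv/= => /andP[s0 sa] h.
by exists s => //=; rewrite in_itv/= s0 (le_trans sa).
Qed.

Lemma past_setT a : past a setT.
Proof. exact: (@measurableT _ (pastT a)). Qed.

Lemma past_setI a A B : past a A -> past a B -> past a (A `&` B).
Proof. exact: (@measurableI _ (pastT a)). Qed.

Lemma past_setC a A : past a A -> past a (~` A).
Proof. exact: (@measurableC _ (pastT a)). Qed.

Lemma meas_past_proc a s : s <= a -> 0 <= a -> measurable_fun setT (proc s : pastT a -> borel E).
Proof.
move=> sa a0 _ B mB; apply: sub_sigma_algebra; exists (pos_time s).
  by rewrite /= in_itv/= pos_time_ge0 ge_max a0 sa.
by exists B.
Qed.

Lemma gmeas_past a (W : Omega -> R) : measurable_fun setT (W : pastT a -> R) -> gmeas (past a) W.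
Proof.
move=> mW k; have := mW measurableT `]k, +oo[%classic (measurable_itv _).
by rewrite setTI; congr (past a _); apply/seteqP; split => w /=; rewrite in_itv/= andbT.
Qed.

Lemma past_meas_fun a d' (T' : measurableType d') (W : Omega -> T') :
  measurable_fun setT (W : pastT a -> T') -> measurable_fun setT W.
Proof. by move=> mW _ B mB; exact: (past_measurable (mW measurableT B mB)). Qed.

(** The Markov property, for functions of the position: both sides define, for
    an event A of the past, the same measure on the state space. *)
Lemma ceq_markov a t f : 0 <= a -> 0 <= t -> measurable_fun setT f ->
  (forall x, L1 (Pt t x) f) -> L1 P (fun w => f (proc (a + t) w)) ->
  ceq P (past a) (fun w => f (proc (a + t) w)) (fun w => Pf t f (proc a w)).
Proof.
move=> a0 t0 mf kf iF; have [_ _ hM] := XM.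
have at0 := addr_ge0 a0 t0; have mY := meas_proc (a + t).
pose k := kprecomp_pker (Pt t) (meas_proc a).
have base (B : set Omega) (mB : measurable B) : past a B ->
    L1 (mrestr P mB) (fun w => Pf t f (proc a w)) /\
    Ex (mrestr P mB) (fun w => f (proc (a + t) w)) = Ex (mrestr P mB) (fun w => Pf t f (proc a w)).
  move=> pB.
  pose nu' : {measure set (borel E) -> \bar R} := pushforward (mrestr P mB) (proc (a + t)).
  have nuE C : measurable C -> nu' mY C = (\int[mrestr P mB]_w k w C)%E.
    move=> mC; rewrite ge0_integral_mrestr//; last exact: (measurable_kernel k).
    have [_ /(_ B pB) hB] := hM a t a0 t0 C mC.
    have -> : nu' mY C = P (B `&` X (a + t) @^-1` C).
      rewrite [B `&` _]setIC -[in RHS](pos_timeE at0); reflexivity.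
    rewrite -hB.
    by apply: eq_integral => w _; rewrite /k /kprecomp_pker /kprecomp/= /proc pos_timeE.
  have iB := L1_mrestr mB iF.
  have inu : L1 (nu' mY) f by apply/(L1_pushforward _ mY mf).
  split; first exact: (L1_kernel_Ex (k := k) nuE mf (fun w => kf (proc a w)) inu).
  rewrite -(Ex_mixture (k := k) nuE mf (fun w => kf (proc a w)) inu).
  exact/esym/(Ex_pushforward mY mf).
have iG : L1 P (fun w => Pf t f (proc a w)).
  have [h _] := base setT measurableT (@past_setT a).
  move: h => /integrableP[mh h]; apply/integrableP; split => //.
  move: h; congr (_ < _)%E; apply: eq_measure_integral => A mA _.
  by rewrite /= /mrestr setIT.
split => // A pA; have mA := past_measurable pA.
have [_] := base A mA pA.
by rewrite (Ex_mrestr mA iF) (Ex_mrestr mA iG).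
Qed.

Lemma law_proc0 f : measurable_fun setT f -> L1 mu0 f ->
  L1 P (fun w => f (proc 0 w)) /\ Ex P (fun w => f (proc 0 w)) = Ex mu0 f.
Proof.
move=> mf iF; have [_ h0 _] := XM; have mY := meas_proc 0.
pose nu' : {measure set (borel E) -> \bar R} := pushforward P (proc 0).
have nuE A : measurable A -> mu0 A = nu' mY A.
  move=> mA; rewrite -[LHS](h0 A mA) /nu' /= /proc pos_timeE//.
have inu : L1 (nu' mY) f.
  move: iF => /integrableP[mF h]; apply/integrableP; split => //.
  move: h; congr (_ < _)%E; apply: eq_measure_integral => A mA _; exact: nuE.
have iP : L1 P (fun w => f (proc 0 w)) by apply/(L1_pushforward P mY mf).
split=> //; rewrite -(Ex_pushforward mY mf iP).
by congr fine; apply: eq_measure_integral => A mA _; exact/esym/nuE.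
Qed.

(** One-dimensional laws of the process are the images of the initial law. *)
Lemma law_proc t f : 0 <= t -> measurable_fun setT f -> (forall x, L1 (Pt t x) f) ->
  L1 mu0 (fun x => Ex (Pt t x) (fun y => `|f y|)) -> L1 P (fun w => f (proc t w)).
Proof.
move=> t0 mf kf i0; have [_ h0 hM] := XM; have mY := meas_proc t.
pose k := kprecomp_pker (Pt t) (meas_proc 0).
pose nu' : {measure set (borel E) -> \bar R} := pushforward P (proc t).
have nuE C : measurable C -> nu' mY C = (\int[P]_w k w C)%E.
  move=> mC; have [_ /(_ setT (@past_setT 0)) hB] := hM 0 t (lexx 0) t0 C mC.
  have -> : nu' mY C = P (setT `&` X (0 + t) @^-1` C).
    by rewrite setTI add0r -[in RHS](pos_timeE t0).
  rewrite -hB.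
  by apply: eq_integral => w _; rewrite /k /kprecomp_pker /kprecomp/= /proc pos_timeE.
apply/(L1_pushforward P mY mf); apply: (L1_mixture (k := k) nuE mf) => [w|]; first exact: kf.
have mk : measurable_fun setT (fun x => Ex (Pt t x) (fun y => `|f y|)).
  by apply: meas_kernel_Ex => [|x]; [exact: measurableT_comp|exact: L1_norm].
by have [] := law_proc0 mk i0.
Qed.

End process.

(** * Time integrals along the process *)

Section random_time_integrals.
Context {R : realType} {d : measure_display} {Omega : measurableType d}.
Variable P : probability Omega R.
Local Notation TR := (measurableTypeR R).
Implicit Types (a b : R) (F : Omega * TR -> R) (W : Omega -> R).

Definition tint a b F (w : Omega) : R := Ex (tm a b) (fun s => F (w, s)).

(** Random fields bounded in mean uniformly in time: all their time integrals
    are integrable. *)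
Definition bfield F := measurable_fun setT F /\
  exists C, forall s, L1 P (fun w => F (w, s)) /\ Ex P (fun w => `|F (w, s)|) <= C.

Lemma bfield_prod a b F : bfield F -> L1 (P \x tm a b)%E F.
Proof.
move=> [mF [C h]]; apply: (@L1_prod _ _ _ _ _ P (tm a b) F C mF) => s.
- exact: (h s).1.
- exact: (h s).2.
Qed.

Lemma L1_tint a b F : bfield F -> L1 P (tint a b F).
Proof. by move=> /(bfield_prod a b) h; exact: (L1_Ex1 h). Qed.

Lemma tint_path a b F : bfield F -> {ae P, forall w, L1 (tm a b) (fun s => F (w, s))}.
Proof. by move=> /(bfield_prod a b) h; exact: (L1_fubini1 h). Qed.

Lemma L1_mean a b F : bfield F -> L1 (tm a b) (fun s => Ex P (fun w => F (w, s))).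
Proof. by move=> /(bfield_prod a b) h; exact: (L1_Ex2 h). Qed.

Lemma Ex_tint a b F : bfield F ->
  Ex P (tint a b F) = Ex (tm a b) (fun s => Ex P (fun w => F (w, s))).
Proof. by move=> /(bfield_prod a b) h; exact: (Ex_fubini h). Qed.

Lemma bfield_mul W F M : measurable_fun setT W -> (forall w, `|W w| <= M) -> bfield F ->
  bfield (fun z => W z.1 * F z).
Proof.
move=> mW WM [mF [C h]]; split.
  apply: measurable_funM => //; exact: (measurableT_comp mW measurable_fst).
exists (`|M| * C) => s; have [i1 b1] := h s; have iW := L1_mulbounded mW WM i1.
split => //=; apply: le_trans (_ : `|M| * Ex P (fun w => `|F (w, s)|) <= _); last by rewrite ler_wpM2l.
rewrite -(ExZ _ (L1_norm i1)); apply: Ex_le; [exact: L1_norm|exact: L1Z (L1_norm i1)|move=> w].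
by rewrite normrM ler_wpM2r// (le_trans (WM w))// ler_norm.
Qed.

Lemma bfieldD F G : bfield F -> bfield G -> bfield (fun z => F z + G z).
Proof.
move=> [mF [C h]] [mG [C' h']]; split; first exact: measurable_funD.
exists (C + C') => s; have [i1 b1] := h s; have [i2 b2] := h' s.
split; first exact: (L1D i1 i2).
apply: le_trans (lerD b1 b2); rewrite -(ExD (L1_norm i1) (L1_norm i2)).
apply: Ex_le; [exact: (L1_norm (L1D i1 i2))|exact: (L1D (L1_norm i1) (L1_norm i2))|move=> w].
exact: ler_normD.
Qed.

Lemma bfield_dom F G : measurable_fun setT F -> (forall z, `|F z| <= G z) -> bfield G -> bfield F.
Proof.
move=> mF FG [mG [C h]]; split => //; exists C => s; have [i1 b1] := h s.
have mFs : measurable_fun setT (fun w => F (w, s)) by exact: (measurable_fun_pair1 (f := F) s mF).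
have iF : L1 P (fun w => F (w, s)) := L1_dom mFs (fun w => FG (w, s)) i1.
split => //; apply: le_trans b1; apply: Ex_le; [exact: L1_norm|exact: L1_norm|move=> w].
by rewrite (le_trans (FG _))// ler_norm.
Qed.

Lemma ceq_tint (G : set_system Omega) a b F F' : (forall A, G A -> measurable A) ->
  bfield F -> bfield F' ->
  (forall s, a <= s <= b -> ceq P G (fun w => F (w, s)) (fun w => F' (w, s))) ->
  ceq P G (tint a b F) (tint a b F').
Proof.
move=> Gm hF hF' h; split; [exact: L1_tint|exact: L1_tint|move=> A GA].
have mA := Gm _ GA; have m1 : measurable_fun setT (\1_A : Omega -> R) by [].
have A1 w : `|\1_A w : R| <= 1.
  by rewrite indicE; case: (w \in A); rewrite ?normr1 ?normr0.
have H1 := bfield_mul m1 A1 hF; have H1' := bfield_mul m1 A1 hF'.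
have e K : bfield K -> Ex P (fun w => \1_A w * tint a b K w) =
    Ex P (tint a b (fun z => \1_A z.1 * K z)).
  move=> hK; have hAK := bfield_mul m1 A1 hK; apply: Ex_ae_eq.
  - by apply: measurable_funM => //; exact: (L1_meas (L1_tint a b hK)).
  - exact: (L1_meas (L1_tint a b hAK)).
  - apply: filterS (tint_path a b hK) => w iw.
    exact: (esym (@ExZ _ _ _ (tm a b) (\1_A w) _ iw)).
rewrite (e _ hF) (e _ hF') (Ex_tint _ _ H1) (Ex_tint _ _ H1'); apply: Ex_tm_eq.
- exact: (L1_meas (L1_mean a b H1)).
- exact: (L1_meas (L1_mean a b H1')).
- by move=> s /h[_ _ hs]; exact: hs.
Qed.

End random_time_integrals.

Section ergodic_process.
Context {R : realType} {E : polishMetricType R}.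
Context {d : measure_display} {Omega : measurableType d}.
Variables (P : probability Omega R) (Pt : R -> R.-pker (borel E) ~> (borel E)).
Variables (mu0 : probability (borel E) R) (X : R -> {RV P >-> borel E}).
Hypothesis XM : markov_process X Pt mu0.
Hypothesis mu0_P1 : finite_first_moment mu0.
Hypothesis sg : transition_semigroup Pt.
Hypothesis h0 : H0 Pt.
Variables (c gam : R).
Hypotheses (c0 : 0 < c) (gam0 : 0 < gam).
Hypothesis P1_stable : forall (t : R) (mu : probability (borel E) R), 0 <= t ->
  finite_first_moment mu -> finite_first_moment (kernel_push mu (Pt t)).
Hypothesis contr : forall (t : R) (mu nu : probability (borel E) R), 0 <= t ->
  finite_first_moment mu -> finite_first_moment nu ->
  (wasserstein (kernel_push mu (Pt t)) (kernel_push nu (Pt t)) <=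
   (c * expR (- gam * t))%:E * wasserstein mu nu)%E.
Variable mu : probability (borel E) R.
Hypothesis mu_inv : invariant_law Pt mu.
Hypothesis mu_P1 : finite_first_moment mu.
Variable o : E.
Local Notation TR := (measurableTypeR R).
Local Notation Pf t f := (kernel_op (Pt t) f).
Local Notation kap := (kappa c gam).
Local Notation V := (weight mu o).
Local Notation Y := (proc X).
Local Notation past := (past X).
Implicit Types (a b s t : R) (f : E -> R).

Lemma weight_ge1 : forall x, 0 <= V x. Proof. exact: weight_ge0. Qed.

Lemma lip_bound f L x : 0 <= L -> lip L f -> `|f x| <= `|f o| + L * V x.
Proof.
move=> L0 hf; apply: le_trans (lip_growth o x hf) _.
by rewrite lerD2l ler_wpM2l// lerDl Ex_ge0// => y; exact: dist_ge0.
Qed.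

Lemma proc_pos s : Y (pos_time s) = Y s.
Proof. by rewrite /proc (pos_timeE (pos_time_ge0 s)). Qed.

Lemma proc_L1 s f L : lip L f -> L1 P (fun w => f (Y s w)).
Proof.
move=> /(lip_le (ler_norm L)) hf; rewrite -proc_pos; have s0 := pos_time_ge0 s.
apply: (law_proc XM s0 (lip_meas hf)) => [x|].
  exact: (L1_pt P1_stable x s0 hf).
have hN := lip_Pf c0 P1_stable contr s0 (normr_ge0 L) (lip_norm hf).
exact: (L1_lip (o := o) ((finite_first_momentP mu0 o).1 mu0_P1) hN).
Qed.

Lemma markov_lip a t f L : 0 <= a -> 0 <= t -> lip L f ->
  ceq P (past a) (fun w => f (Y (a + t) w)) (fun w => Pf t f (Y a w)).
Proof.
move=> a0 t0 hf; apply: (ceq_markov XM a0 t0 (lip_meas hf)).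
  by move=> x; exact: (L1_pt P1_stable x t0 hf).
exact: (proc_L1 _ hf).
Qed.

Definition mean_weight : R := c * Ex P (fun w => V (Y 0 w)) + Ex mu V.

Lemma mean_weight_ge0 : 0 <= mean_weight.
Proof.
apply: addr_ge0; last by apply: Ex_ge0 => x; exact: weight_ge0.
by apply: mulr_ge0; [exact: ltW|apply: Ex_ge0 => w; exact: weight_ge0].
Qed.

Lemma Ex_weight s : Ex P (fun w => V (Y s w)) <= mean_weight.
Proof.
rewrite -proc_pos; have s0 := pos_time_ge0 s; rewrite -[pos_time s]add0r.
have hV := lip_weight mu o; have h := markov_lip (lexx 0) s0 hV.
rewrite (ceq_Ex (@past_setT _ _ _ _ P X 0) h); have [_ iP _] := h.
have iV : L1 P (fun w => V (Y 0 w)) := proc_L1 0 hV.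
have -> : mean_weight = Ex P (fun w => Ex mu V + c * V (Y 0 w)).
  by rewrite (ExD (L1_cst _ _) (L1Z _ iV)) Ex_cst (ExZ _ iV) addrC.
apply: Ex_le => //; first by apply: L1_addcst; exact: L1Z.
move=> w; have := Pf_ergodic c0 P1_stable contr mu_inv mu_P1 (Y 0 w) o s0 ler01 hV.
rewrite mulr1 => /(le_trans (ler_norm _)); rewrite lerBlDl => /le_trans; apply.
rewrite lerD2l; apply: ler_wpM2r; first exact: weight_ge0.
have := kappa_homo c0 gam0 s0; rewrite /kappa mulr0 expR0 mulr1; exact.
Qed.

Definition pfield f : Omega * TR -> R := fun z => f (Y z.2 z.1).

Lemma meas_pfield f L : lip L f -> measurable_fun setT (pfield f).
Proof.
move=> hf; apply: (measurableT_comp (f := f : borel E -> R)); first exact: lip_meas hf.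
have ms : measurable_fun setT (fun z : Omega * TR => (z.2, z.1)).
  by apply/measurable_fun_pairP; split; [exact: measurable_snd|exact: measurable_fst].
exact: (measurableT_comp (meas_proc2 XM) ms).
Qed.

Lemma bfield_proc f L : lip L f -> bfield P (pfield f).
Proof.
move=> hf; split; first exact: meas_pfield hf.
have hfL := lip_le (ler_norm L) hf.
exists (`|f o| + `|L| * mean_weight) => s; have iF := proc_L1 s hf; split => //.
have iV : L1 P (fun w => V (Y s w)) := proc_L1 s (lip_weight mu o).
apply: le_trans (_ : Ex P (fun w => `|f o| + `|L| * V (Y s w)) <= _).
  apply: Ex_le; [exact: L1_norm|by apply: L1_addcst; exact: L1Z|move=> w].
  exact: lip_bound.
by rewrite (ExD (L1_cst _ _) (L1Z _ iV)) Ex_cst (ExZ _ iV) lerD2l ler_wpM2l// Ex_weight.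
Qed.

(** The additive functional of f over [a, b]. *)
Definition Sf a b f : Omega -> R := tint a b (pfield f).

Variables (g : E -> R) (L : R).
Hypotheses (L0 : 0 <= L) (hg : lip L g) (g0 : Ex mu (g : borel E -> R) = 0).

Local Notation chi := (chi Pt g).
Local Notation C := (chi_lipc c gam L).

Lemma lip_chi' : lip C chi.
Proof. exact: (lip_chi sg h0 c0 gam0 P1_stable contr mu_inv mu_P1 o L0 hg g0). Qed.

(** The process chi(Y_b) + int_0^b g(Y_r) dr is a martingale. *)
Lemma ceq_increment s b : 0 <= s -> s <= b ->
  ceq P (past s) (Sf s b g) (fun w => chi (Y s w) - chi (Y b w)).
Proof.
move=> s0 sb; have Pm := @past_measurable _ _ _ _ P X s.
have bs0 : 0 <= b - s by rewrite subr_ge0.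
have hchi := lip_chi'.
have chi2 : ceq P (past s) (fun w => chi (Y b w)) (fun w => Pf (b - s) chi (Y s w)).
  by have := markov_lip s0 bs0 hchi; rewrite addrC subrK.
pose F (z : Omega * TR) := Pf (pos_time (z.2 - s)) g (Y s z.1).
have mPg := meas_Pfg sg h0 P1_stable hg.
have mF : measurable_fun setT F.
  have mz : measurable_fun setT (fun z : Omega * TR => (z.2 - s : TR, Y s z.1)).
    apply/measurable_fun_pairP; split.
      exact: (measurable_funB measurable_snd (measurable_cst s)).
    exact: (measurableT_comp (meas_proc X s) measurable_fst).
  have h := measurableT_comp mPg mz; exact: h.
have iV : L1 P (fun w => V (Y s w)) := proc_L1 s (lip_weight mu o).
have Fb z : `|F z| <= c * L * V (Y s z.1).
  apply: le_trans (Pf_decay c0 P1_stable contr mu_inv mu_P1 o L0 hg g0 _ (pos_time_ge0 _)) _.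
  apply: ler_wpM2r; first exact: weight_ge0.
  apply: ler_wpM2r => //; apply: le_trans (kappa_homo c0 gam0 (pos_time_ge0 _)) _.
  by rewrite /kappa mulr0 expR0 mulr1.
have bF : bfield P F.
  apply: (bfield_dom mF Fb); split.
    apply: measurable_funM => //; apply: (measurableT_comp (f := V)).
      exact: lip_meas (lip_weight mu o).
    exact: (measurableT_comp (meas_proc X s) measurable_fst).
  exists (c * L * mean_weight) => r /=; split; first exact: L1Z.
  have cL0 : 0 <= c * L by apply: mulr_ge0 => //; exact: ltW.
  have -> : Ex P (fun w => `|c * L * V (Y s w)|) = Ex P (fun w => c * L * V (Y s w)).
    by apply: eq_Ex => w; rewrite ger0_norm// mulr_ge0 ?weight_ge0.
  by rewrite (ExZ _ iV) ler_wpM2l ?Ex_weight.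
have cF := ceq_tint (a := s) (b := b) Pm (bfield_proc hg) bF.
apply: ceq_trans (cF _) _ => [r /andP[sr rb]|].
  have rs0 : 0 <= r - s by rewrite subr_ge0.
  by have := markov_lip s0 rs0 hg; rewrite addrC subrK /F /= pos_timeE.
have i1 : L1 P (fun w => chi (Y s w)) := proc_L1 s hchi.
have hh := ceqB Pm (ceq_refl (past s) i1) (ceq_sym chi2).
apply: (eq_ceq _ _ hh) => // w; rewrite (chi_poisson sg h0 c0 gam0 P1_stable contr mu_inv mu_P1 o L0 hg g0)//.
have mFw : measurable_fun setT (fun r => F (w, r)) by exact: (measurable_fun_pair2 (f := F) w mF).
have iFw : L1 (tm (0 + s) (b - s + s)) (fun r => F (w, r)).
  have Fw r : `|F (w, r)| <= c * L * V (Y s w) by exact: (Fb (w, r)).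
  exact: (L1_bounded (tm (0 + s) (b - s + s)) mFw Fw).
have := Ex_tm_shift mFw iFw; rewrite add0r subrK /tint => ->.
by apply: eq_Ex => r; rewrite /F /= addrK.
Qed.

End ergodic_process.

(** * Squares of time integrals *)

Section ae_domination.
Context d (T : measurableType d) (R : realType) (mu : {measure set T -> \bar R}).
Implicit Types f g : T -> R.

Lemma L1_dom_ae f g : measurable_fun setT f -> {ae mu, forall x, `|f x| <= g x} ->
  L1 mu g -> L1 mu f.
Proof.
move=> mf fg ig; apply/integrableP; split; first exact/measurable_EFinP.
have /integrableP[_] := L1_norm ig; apply: le_lt_trans.
have mg := L1_meas ig.
apply: ae_ge0_le_integral => //.
- by apply: measurableT_comp => //; exact/measurable_EFinP.
- by apply: measurableT_comp => //; apply/measurable_EFinP; exact: measurableT_comp.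
- apply: filterS fg => x fgx _ /=.
  by rewrite lee_fin normr_id (le_trans fgx)// ler_norm.
Qed.

Lemma Ex_le_ae f g : L1 mu f -> L1 mu g -> {ae mu, forall x, f x <= g x} -> Ex mu f <= Ex mu g.
Proof.
move=> iF ig fg; have [mf mg] := (L1_meas iF, L1_meas ig).
have mh : measurable_fun setT (fun x => Num.max (f x) (g x)) by exact: measurable_maxr.
have ih : L1 mu (fun x => Num.max (f x) (g x)).
  apply: (L1_dom mh _ (L1D (L1_norm iF) (L1_norm ig))) => x.
  by case: (leP (f x) (g x)) => _; rewrite ?lerDl ?lerDr.
rewrite (Ex_ae_eq mg mh); last by apply: filterS fg => x /= h; rewrite max_r.
by apply: Ex_le => // x; rewrite le_max lexx.
Qed.

Lemma tail_cvg f : L1 mu f ->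
  Ex mu (fun x => Num.max 0 (`|f x| - n%:R)) @[n --> \oo] --> (0 : R).
Proof.
move=> iF; have mf := L1_meas iF.
have mn (n : nat) : measurable_fun setT (fun x => Num.max 0 (`|f x| - n%:R)).
  by apply: measurable_maxr => //; apply: measurable_funB => //; exact: measurableT_comp.
have cv x : (fun n : nat => Num.max 0 (`|f x| - n%:R)) @ \oo --> (0 : R).
  apply: cvg_near_cst; exists (Num.truncn `|f x|).+1 => // n /= hn.
  by apply/max_idPl; rewrite subr_le0 ltW// (lt_le_trans (truncnS_gt _))// ler_nat.
have bd (k : nat) (x : T) : `|Num.max 0 (`|f x| - k%:R)| <= `|f x|.
  by case: (leP 0 (`|f x| - k%:R)) => h; rewrite ?normr0// ger0_norm// gerBl.
by have [_] := Ex_dct mn cv bd (L1_norm iF); rewrite Ex0.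
Qed.

Lemma tail_small f e : L1 mu f -> 0 < e ->
  exists2 K, 0 <= K & Ex mu (fun x => Num.max 0 (`|f x| - K)) <= e.
Proof.
move=> /tail_cvg /cvgr0Pnorm_le h /h[N _ hN].
by exists N%:R => //; rewrite (le_trans (ler_norm _))//; exact: hN N (leqnn N).
Qed.

End ae_domination.

Lemma L1_tensor d1 d2 (T1 : measurableType d1) (T2 : measurableType d2) (R : realType)
    (m1 : {sigma_finite_measure set T1 -> \bar R}) (m2 : {sigma_finite_measure set T2 -> \bar R})
    (f : T1 -> R) (g : T2 -> R) :
  L1 m1 f -> L1 m2 g -> L1 (m1 \x m2)%E (fun z => f z.1 * g z.2).
Proof.
move=> iF ig; apply/(integrable21ltyP _ _).
  apply/measurable_EFinP; apply: measurable_funM.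
    exact: (measurableT_comp (L1_meas iF) measurable_fst).
  exact: (measurableT_comp (L1_meas ig) measurable_snd).
pose C := Ex m1 (fun x => `|f x|).
have intE y : (\int[m1]_x `|(EFin \o (fun z => f z.1 * g z.2)%R) (x, y)| = (C * `|g y|)%:E)%E.
  rewrite mulrC -(ExZ _ (L1_norm iF)) -(ExE (L1Z _ (L1_norm iF))).
  by apply: eq_integral => x _ /=; rewrite normrM mulrC.
under eq_integral do rewrite intE.
by rewrite (ExE (L1Z _ (L1_norm ig))) ltry.
Qed.

Section squares.
Context {R : realType}.
Local Notation TR := (measurableTypeR R).
Implicit Types (a b s r : R) (f : TR -> R).

Definition after f : TR * TR -> R := fun z => if z.1 <= z.2 then f z.2 else 0.

Lemma meas_after f : measurable_fun setT f -> measurable_fun setT (after f).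
Proof.
move=> mf; apply: measurable_fun_ifT => //.
- by apply: measurable_fun_ler; [exact: measurable_fst|exact: measurable_snd].
- exact: (measurableT_comp mf measurable_snd).
Qed.

Lemma after_le f z : `|after f z| <= `|f z.2|.
Proof. by rewrite /after; case: ifP => // _; rewrite normr0. Qed.

Lemma Ex_after a b s f : measurable_fun setT f -> a <= s ->
  Ex (tm a b) (fun r => after f (s, r)) = Ex (tm s b) f.
Proof.
move=> mf as_; rewrite !Ex_tmE//; last exact: (measurable_fun_pair2 (f := after f) s (meas_after mf)).
rewrite Rintegral_mkcond [RHS]Rintegral_mkcond; apply: eq_Ex => r.
rewrite !patchE /after/=; have [|h] := boolP (r \in `[s, b]%classic).
  rewrite inE/= in_itv/= => /andP[sr rb].
  by rewrite mem_set/= ?sr// in_itv/= rb (le_trans as_ sr).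
case: ifP => //; rewrite inE/= in_itv/= => /andP[ar rb]; case: ifP => // sr.
by move: h; rewrite mem_set//= in_itv/= sr.
Qed.

(** The square is twice the integral over the pairs (s, r) with s <= r. *)
Lemma sq_path a b f : L1 (tm a b) f ->
  Ex (tm a b) f ^+ 2 = 2 * Ex (tm a b) (fun s => f s * Ex (tm a b) (fun r => after f (s, r))).
Proof.
move=> iF; have mf := L1_meas iF; have ma := meas_after mf.
pose K (z : TR * TR) := f z.1 * after f z.
pose K' (z : TR * TR) := f z.1 * (f z.2 - after f z).
have m1 : measurable_fun setT (fun z : TR * TR => f z.1) := measurableT_comp mf measurable_fst.
have m2 : measurable_fun setT (fun z : TR * TR => f z.2) := measurableT_comp mf measurable_snd.
have iff : L1 (tm a b \x tm a b)%E (fun z => `|f z.1| * `|f z.2|).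
  exact: L1_tensor (L1_norm iF) (L1_norm iF).
have iK' : L1 (tm a b \x tm a b)%E K'.
  apply: (@L1_dom _ _ _ (tm a b \x tm a b)%E _ (fun z => `|f z.1| * `|f z.2|)) => [|z|//].
    by apply: measurable_funM => //; exact: measurable_funB.
  rewrite normrM ler_wpM2l// /after; case: ifP => _; rewrite ?subrr ?normr0// subr0//.
have mas s : measurable_fun setT (fun r => after f (s, r)).
  exact: (measurable_fun_pair2 (f := after f) s ma).
have ias s : L1 (tm a b) (fun r => after f (s, r)).
  apply: (@L1_dom _ _ _ (tm a b) _ (fun r => `|f r|) (mas s)) => [r|]; last exact: L1_norm.
  exact: after_le.
have iK : L1 (tm a b \x tm a b)%E K.
  apply: (@L1_dom _ _ _ (tm a b \x tm a b)%E _ (fun z => `|f z.1| * `|f z.2|)) => [|z|//]; first exact: measurable_funM.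
  by rewrite normrM ler_wpM2l// after_le.
have EK : Ex (tm a b) (fun s => f s * Ex (tm a b) (fun r => after f (s, r))) =
    Ex (tm a b) (fun s => Ex (tm a b) (fun r => K (s, r))).
  by apply: eq_Ex => s; rewrite /K /= (ExZ _ (ias s)).
have EK' : Ex (tm a b) (fun s => Ex (tm a b) (fun r => K' (s, r))) =
    Ex (tm a b) (fun s => Ex (tm a b) (fun r => K (s, r))).
  rewrite (Ex_fubini iK') -EK; apply: eq_Ex => r; rewrite -(ExZ _ (ias r)).
  apply: Ex_ae_eq.
  - exact: (measurable_fun_pair1 (f := K') r (L1_meas iK')).
  - exact: (measurable_funM (measurable_cst _) (mas r)).
  - exists ([set r] : set TR); split.
      exact: (@measurable_set1 R r).
      by apply/eqP; rewrite -measure_le0 -(lebesgue_measure_set1 r); exact: measureIl.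
    move=> s /=; apply: contra_notP => /eqP sr; rewrite /K' /after/=.
    by case: (ltgtP s r) sr => // _ _; rewrite ?subrr ?subr0 ?mulr0//; exact: mulrC.
rewrite EK mulr2n mulrDl mul1r -[X in _ = X + _]EK'.
rewrite -(ExD (L1_Ex1 iK') (L1_Ex1 iK)) expr2 -(ExZ _ iF).
apply: eq_Ex => s; rewrite mulrC -(ExZ _ iF).
rewrite -(ExD (L1Z (f s) (L1B iF (ias s))) (L1Z (f s) (ias s))).
by apply: eq_Ex => r; rewrite /K /=; ring.
Qed.

Lemma sq_Ex_le a b f : a <= b -> L1 (tm a b) f -> L1 (tm a b) (fun s => f s ^+ 2) ->
  Ex (tm a b) f ^+ 2 <= (b - a) * Ex (tm a b) (fun s => f s ^+ 2).
Proof.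
move=> ab iF i2; have := ab; rewrite le_eqVlt => /predU1P[eab|ab'].
  have z h : measurable_fun setT h -> Ex (tm a b) h = 0.
    move=> mh; rewrite Ex_tmE// eab set_itv1 Rintegral_set1//.
  by rewrite (z _ (L1_meas iF)) eab subrr mul0r expr2 mul0r.
set I1 := Ex (tm a b) f; set I2 := Ex _ _.
have h0 : 0 < b - a by rewrite subr_gt0.
have : Ex (tm a b) (fun s => 2 * I1 * f s - (b - a)^-1 * I1 ^+ 2) <= Ex (tm a b) (fun s => (b - a) * f s ^+ 2).
  apply: Ex_le; [exact: (L1B (L1Z _ iF) (L1_cst _ _))|exact: L1Z|move=> s].
  rewrite -subr_ge0 (_ : _ - _ = (b - a)^-1 * ((b - a) * f s - I1) ^+ 2).
    by rewrite mulr_ge0 ?sqr_ge0// invr_ge0 ltW.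
  by field; rewrite gt_eqF.
rewrite (ExB (L1Z _ iF) (L1_cst _ _)) (ExZ _ iF) (ExZ _ i2) (Ex_tm_cst _ ab) -/I1 -/I2.
have -> : (b - a)^-1 * I1 ^+ 2 * (b - a) = I1 ^+ 2 by field; rewrite gt_eqF.
by rewrite (_ : 2 * I1 * I1 = 2 * I1 ^+ 2); [lra|ring].
Qed.

End squares.

Section mean_squares.
Context {R : realType} {d : measure_display} {Omega : measurableType d}.
Variable P : probability Omega R.
Local Notation TR := (measurableTypeR R).
Variables (a b : R) (F : Omega * TR -> R).
Hypotheses (ab : a <= b) (hF : bfield P F) (hF2 : bfield P (fun z => F z ^+ 2)).

Let path2 : {ae P, forall w, L1 (tm a b) (fun s => F (w, s)) /\ L1 (tm a b) (fun s => F (w, s) ^+ 2)}.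
Proof. by apply: filterS2 (tint_path a b hF) (tint_path a b hF2) => w. Qed.

(** Total variation of the time integral, the common bound for all the
    integrals over subintervals. *)
Let B w := Ex (tm a b) (fun s => `|F (w, s)|).

Let mB : measurable_fun setT B.
Proof.
apply: (meas_Ex_param (f := fun z : Omega * TR => `|F z|) (tm a b)).
by apply: measurableT_comp => //; exact: hF.1.
Qed.

Let B2 : {ae P, forall w, `|B w ^+ 2| <= (b - a) * tint a b (fun z => F z ^+ 2) w}.
Proof.
apply: filterS path2 => w [i1 i2].
rewrite ger0_norm ?sqr_ge0//.
have e : (fun s : TR => `|F (w, s)| ^+ 2) = (fun s => F (w, s) ^+ 2).
  by apply/funext => s; rewrite real_normK// num_real.
have i3 : L1 (tm a b) (fun s : TR => `|F (w, s)| ^+ 2) by rewrite e.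
by have := sq_Ex_le ab (L1_norm i1) i3; rewrite e.
Qed.

Let iB2 : L1 P (fun w => B w ^+ 2).
Proof.
apply: (L1_dom_ae _ B2); first exact: measurable_funX.
by apply: L1Z; exact: L1_tint.
Qed.

Let EB2 C2 : (forall s, Ex P (fun w => F (w, s) ^+ 2) <= C2) ->
  Ex P (fun w => B w ^+ 2) <= (b - a) ^+ 2 * C2.
Proof.
move=> hC; have iT := L1_tint a b hF2.
apply: (@le_trans _ _ (Ex P (fun w => (b - a) * tint a b (fun z => F z ^+ 2) w))).
  by apply: Ex_le_ae => //; [exact: L1Z|apply: filterS B2 => w; apply: le_trans; exact: ler_norm].
rewrite (ExZ _ iT) (Ex_tint _ _ hF2) expr2 -mulrA ler_wpM2l ?subr_ge0//.
have := Ex_tm_bound (f := fun s => Ex P (fun w => F (w, s) ^+ 2)) (M := C2) ab.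
rewrite [X in _ -> _ -> _ <= X]mulrC => h; apply: (le_trans (ler_norm _)); apply: h.
  exact: (L1_meas (L1_mean a b hF2)).
by move=> s _; rewrite ger0_norm// Ex_ge0// => w; exact: sqr_ge0.
Qed.

Lemma tint_B : {ae P, forall w, `|tint a b F w| <= B w}.
Proof. by apply: filterS path2 => w [i1 _]; exact: Ex_normr. Qed.

Let tint2_le : {ae P, forall w, `|tint a b F w ^+ 2| <= B w ^+ 2}.
Proof.
apply: filterS tint_B => w h; rewrite normrX ler_pXn2r// nnegrE.
by rewrite Ex_ge0.
Qed.

Lemma L1_sq_tint : L1 P (fun w => tint a b F w ^+ 2).
Proof.
apply: (L1_dom_ae _ tint2_le iB2).
by apply: measurable_funX; exact: (L1_meas (L1_tint a b hF)).
Qed.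

Lemma Ex_sq_tint C2 : (forall s, Ex P (fun w => F (w, s) ^+ 2) <= C2) ->
  Ex P (fun w => tint a b F w ^+ 2) <= (b - a) ^+ 2 * C2.
Proof.
move=> /EB2; apply: le_trans; apply: Ex_le_ae => //; first exact: L1_sq_tint.
by apply: filterS tint2_le => w; apply: le_trans; exact: ler_norm.
Qed.

Variable k : Omega -> R.
Hypotheses (mk : measurable_fun setT k) (ik : L1 P (fun w => k w ^+ 2)).

(** The integral of F from s to the right end, as a jointly measurable field. *)
Definition tail_tint (z : Omega * TR) : R :=
  Ex (tm a b) (fun r => after (fun q => F (z.1, q)) (z.2, r)).

Lemma tail_tintE w s : a <= s -> tail_tint (w, s) = tint s b F w.
Proof. by move=> as_; apply: Ex_after => //; exact: (measurable_fun_pair2 (f := F) w hF.1). Qed.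

Lemma meas_tail : measurable_fun setT tail_tint.
Proof.
apply: (meas_Ex_param (f := fun z : (Omega * TR) * TR => if z.1.2 <= z.2 then F (z.1.1, z.2) else 0) (tm a b)).
have m1 : measurable_fun setT (fun z : (Omega * TR) * TR => z.1.2 : R).
  exact: (measurableT_comp measurable_snd measurable_fst).
have m2 : measurable_fun setT (fun z : (Omega * TR) * TR => (z.1.1, z.2)).
  apply/measurable_fun_pairP; split; last exact: measurable_snd.
  exact: (measurableT_comp measurable_fst measurable_fst).
apply: measurable_fun_ifT => //.
- by apply: measurable_fun_ler => //; exact: measurable_snd.
- exact: (measurableT_comp hF.1 m2).
Qed.

Let tail_B : {ae P, forall w, forall s, `|tail_tint (w, s)| <= B w}.
Proof.
apply: filterS path2 => w [i1 _] s.
have mw := L1_meas i1.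
apply: (@Ex_dom _ _ _ (tm a b) _ (fun r => `|F (w, r)|)); last exact: L1_norm.
  exact: (measurable_fun_pair2 (f := after (fun q => F (w, q))) s (meas_after mw)).
by move=> r; exact: after_le.
Qed.

Definition sq_field (z : Omega * TR) : R := F z * (tail_tint z + k z.1).

Lemma bfield_sq_field : bfield P sq_field.
Proof.
have mk1 : measurable_fun setT (fun z : Omega * TR => k z.1) := measurableT_comp mk measurable_fst.
split; first by apply: measurable_funM; [exact: hF.1|apply: measurable_funD => //; exact: meas_tail].
have [_ [C2 hC2]] := hF2.
exists (C2 + (Ex P (fun w => B w ^+ 2) + Ex P (fun w => k w ^+ 2))) => s.
have [i2 b2] := hC2 s.
have iG : L1 P (fun w => F (w, s) ^+ 2 + (B w ^+ 2 + k w ^+ 2)) by exact: (L1D i2 (L1D iB2 ik)).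
have H : {ae P, forall w, `|sq_field (w, s)| <= F (w, s) ^+ 2 + (B w ^+ 2 + k w ^+ 2)}.
  apply: filterS tail_B => w /(_ s) hb; rewrite /sq_field /=.
  have B0 : 0 <= B w by exact: le_trans hb.
  have ht : tail_tint (w, s) ^+ 2 <= B w ^+ 2.
    by rewrite -(real_normK (num_real (tail_tint (w, s)))) ler_pXn2r// nnegrE.
  move: (tail_tint _) (F _) (B w) (k w) ht => x y z u ht.
  have y2 := sqr_ge0 (y - (x + u)); have y3 := sqr_ge0 (y + (x + u)); have xu := sqr_ge0 (x - u).
  by rewrite ler_norml; apply/andP; split; nra.
have ms : measurable_fun setT (fun w => sq_field (w, s)).
  apply: measurable_funM; first exact: (measurable_fun_pair1 (f := F) s hF.1).
  by apply: measurable_funD => //; exact: (measurable_fun_pair1 (f := tail_tint) s meas_tail).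
have iS := L1_dom_ae ms H iG; split => //.
apply: (@le_trans _ _ (Ex P (fun w => F (w, s) ^+ 2 + (B w ^+ 2 + k w ^+ 2)))).
  by apply: Ex_le_ae => //; exact: L1_norm.
rewrite (ExD i2 (L1D iB2 ik)) (ExD iB2 ik) lerD2r.
by apply: le_trans b2; apply: Ex_le => //; [exact: L1_norm|move=> w; exact: ler_norm].
Qed.

Lemma sq_tintE : {ae P, forall w,
  tint a b F w ^+ 2 + 2 * k w * tint a b F w = 2 * tint a b sq_field w}.
Proof.
apply: filterS3 path2 tail_B (tint_path a b bfield_sq_field) => w [i1 _] hb isq.
have ik' : L1 (tm a b) (fun s => k w * F (w, s)) by exact: L1Z.
have e : tint a b F w ^+ 2 = 2 * Ex (tm a b) (fun s => F (w, s) * tail_tint (w, s)).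
  exact: sq_path.
have iFT : L1 (tm a b) (fun s => F (w, s) * tail_tint (w, s)).
  by apply: (eq_L1 _ (L1B isq ik')) => s; rewrite /sq_field /=; ring.
rewrite e -mulrA -mulrDr; congr (_ * _); rewrite [k w * _](_ : _ = Ex (tm a b) (fun s => k w * F (w, s))).
  by rewrite -(ExD iFT ik'); apply: eq_Ex => s; rewrite /sq_field /=; ring.
by rewrite (ExZ _ i1).
Qed.

Lemma Ex_sq_tintE (W : Omega -> R) (M : R) : measurable_fun setT W -> (forall w, `|W w| <= M) ->
  Ex P (fun w => W w * (tint a b F w ^+ 2 + 2 * k w * tint a b F w)) =
  2 * Ex (tm a b) (fun s => Ex P (fun w => W w * sq_field (w, s))).
Proof.
move=> mW WM; have hS := bfield_sq_field; have hWS := bfield_mul mW WM hS.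
have mt := L1_meas (L1_tint a b hF).
rewrite -(Ex_tint a b hWS) -(ExZ _ (L1_tint a b hWS)); apply: Ex_ae_eq.
- by apply: measurable_funM => //; apply: measurable_funD;
    [exact: measurable_funX|do 2! apply: measurable_funM => //].
- by apply: measurable_funM => //; exact: (L1_meas (L1_tint a b hWS)).
- apply: filterS2 sq_tintE (tint_path a b hS) => w -> iS.
  rewrite mulrCA; congr (2 * _); exact: (esym (@ExZ _ _ _ (tm a b) (W w) _ iS)).
Qed.

End mean_squares.

(** * The law of large numbers *)

Section law_of_large_numbers.
Context {R : realType} {E : polishMetricType R}.
Context {d : measure_display} {Omega : measurableType d}.
Variables (P : probability Omega R) (Pt : R -> R.-pker (borel E) ~> (borel E)).
Variables (mu0 : probability (borel E) R) (X : R -> {RV P >-> borel E}).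
Hypothesis XM : markov_process X Pt mu0.
Hypothesis mu0_P1 : finite_first_moment mu0.
Hypothesis sg : transition_semigroup Pt.
Hypothesis h0 : H0 Pt.
Variables (c gam : R).
Hypotheses (c0 : 0 < c) (gam0 : 0 < gam).
Hypothesis P1_stable : forall (t : R) (mu : probability (borel E) R), 0 <= t ->
  finite_first_moment mu -> finite_first_moment (kernel_push mu (Pt t)).
Hypothesis contr : forall (t : R) (mu nu : probability (borel E) R), 0 <= t ->
  finite_first_moment mu -> finite_first_moment nu ->
  (wasserstein (kernel_push mu (Pt t)) (kernel_push nu (Pt t)) <=
   (c * expR (- gam * t))%:E * wasserstein mu nu)%E.
Variable mu : probability (borel E) R.
Hypothesis mu_inv : invariant_law Pt mu.
Hypothesis mu_P1 : finite_first_moment mu.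
Variable o : E.
Local Notation TR := (measurableTypeR R).
Local Notation Pf t f := (kernel_op (Pt t) f).
Local Notation kap := (kappa c gam).
Local Notation V := (weight mu o).
Local Notation Y := (proc X).
Local Notation past := (past X).
Implicit Types (a b s t : R) (f g : E -> R).

Let bfield_proc' := bfield_proc XM mu0_P1 c0 gam0 P1_stable contr mu_inv mu_P1 o.
Let proc_L1' := proc_L1 XM mu0_P1 c0 P1_stable contr o.
Let ceq_increment' := ceq_increment XM mu0_P1 sg h0 c0 gam0 P1_stable contr mu_inv mu_P1 o.
Let lip_chi'' := lip_chi' sg h0 c0 gam0 P1_stable contr mu_inv mu_P1 o.

Lemma gmeas_proc s a f L : s <= a -> 0 <= a -> lip L f -> gmeas (past a) (fun w => f (Y s w)).
Proof.
move=> sa a0 hf; apply: gmeas_past.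
have mp := meas_past_proc (X := X) sa a0.
have h := measurableT_comp (lip_meas hf : measurable_fun setT (f : borel E -> R)) mp; exact: h.
Qed.

Lemma meas_f_proc s f L : lip L f -> measurable_fun setT (fun w => f (Y s w)).
Proof. by move=> hf; exact: (measurableT_comp (lip_meas hf) (meas_proc X s)). Qed.

Section bounded.
Variables (g : E -> R) (L K : R).
Hypotheses (L0 : 0 <= L) (hg : lip L g) (g0 : Ex mu (g : borel E -> R) = 0).
Hypothesis gK : forall x, `|g x| <= K.
Local Notation chi := (chi Pt g).

Let K0 : 0 <= K. Proof. exact: le_trans (normr_ge0 _) (gK o). Qed.

Let bfield_sq : bfield P (fun z => pfield X g z ^+ 2).
Proof.
have hg2 : lip (K * L + K * L) (fun x => g x ^+ 2) by exact: (lipM K0 K0 hg hg gK gK).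
exact: bfield_proc' hg2.
Qed.

(** By the martingale property the correlations of g(X_s) with the future
    integrals of g are bounded, so that the variance grows at most linearly. *)
Lemma sq_Sf_linear : exists C, forall T, 0 <= T ->
  L1 P (fun w => Sf X 0 T g w ^+ 2) /\ Ex P (fun w => Sf X 0 T g w ^+ 2) <= C * T.
Proof.
have hF := bfield_proc' hg.
have [_ [C hC]] := bfield_proc' (lip_chi'' L0 hg g0).
exists (2 * (K * (C + C))) => T T0; split; first exact: (L1_sq_tint T0 hF bfield_sq).
have m0 : measurable_fun setT ((fun=> 0) : Omega -> R) by exact: measurable_cst.
have i0 : L1 P (fun w : Omega => (fun=> 0 : R) w ^+ 2).
  by apply: (eq_L1 _ (L1_0 P)) => w /=; rewrite expr2 mul0r.
have m1 : measurable_fun setT ((fun=> 1) : Omega -> R) by exact: measurable_cst.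
have b1 : forall w : Omega, `|(1 : R)| <= 1 by move=> w; rewrite normr1.
have := Ex_sq_tintE T0 hF bfield_sq m0 i0 m1 b1.
rewrite (_ : Ex P _ = Ex P (fun w => Sf X 0 T g w ^+ 2)); last first.
  by apply: eq_Ex => w; rewrite mulr0 mul0r addr0 mul1r.
move=> ->; rewrite -mulrA ler_pM2l//.
have hS := bfield_mul m1 b1 (bfield_sq_field T0 hF bfield_sq m0 i0).
apply: le_trans (ler_norm _) _; rewrite -[X in _ * X]subr0.
apply: Ex_tm_bound => //; first exact: (L1_meas (L1_mean 0 T hS)).
move=> s /andP[s0 sT].
have [i1 b1'] := hC s; have [i2 b2'] := hC T.
have e : Ex P (fun w => 1 * sq_field 0 T (pfield X g) (fun=> 0) (w, s)) =
    Ex P (fun w => g (Y s w) * (chi (Y s w) - chi (Y T w))).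
  rewrite -(ceq_bounded (@past_setT _ _ _ _ P X s) (@past_measurable _ _ _ _ P X s)
    (gmeas_proc (lexx s) s0 hg) (fun w => gK (Y s w)) (meas_f_proc s hg) (ceq_increment' L0 hg g0 s0 sT)).
  by apply: eq_Ex => w; rewrite /sq_field mul1r addr0 (tail_tintE T hF w s0).
rewrite e; apply: le_trans (_ : Ex P (fun w => K * (`|chi (Y s w)| + `|chi (Y T w)|)) <= _).
  apply: Ex_dom.
  - exact: (measurable_funM (meas_f_proc s hg) (L1_meas (L1B i1 i2))).
  - move=> w; rewrite normrM; apply: ler_pM => //.
    exact: ler_normB.
  - exact: (L1Z _ (L1D (L1_norm i1) (L1_norm i2))).
rewrite (ExZ _ (L1D (L1_norm i1) (L1_norm i2))) (ExD (L1_norm i1) (L1_norm i2)).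
by rewrite ler_wpM2l// lerD.
Qed.

End bounded.

(** The mean of a time average converges to the stationary mean. *)
Lemma Ex_Sf_bound f L : 0 <= L -> lip L f -> exists C, forall T, 0 <= T ->
  Ex P (Sf X 0 T f) <= T * Ex mu (f : borel E -> R) + C.
Proof.
move=> L0 hf; set v := Ex mu _.
have hg : lip L (fun x => f x - v) by exact: lipBc.
have g0 : Ex mu ((fun x => f x - v) : borel E -> R) = 0.
  rewrite (ExB (L1_inv mu_P1 hf) (L1_cst _ _)) Ex_cst subrr//.
have [_ [C hC]] := bfield_proc' (lip_chi'' L0 hg g0).
exists (C + C) => T T0; have hF := bfield_proc' hf; have hG := bfield_proc' hg.
have -> : Ex P (Sf X 0 T f) = T * v + Ex P (Sf X 0 T (fun x => f x - v)).
  rewrite /Sf (Ex_tint 0 T hF) (Ex_tint 0 T hG).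
  have iF := L1_mean 0 T hF.
  have e s : Ex P (fun w => pfield X (fun x => f x - v) (w, s)) = Ex P (fun w => pfield X f (w, s)) - v.
    by rewrite -[v in RHS](Ex_cst P) -(ExB (proc_L1' s hf) (L1_cst _ _)).
  rewrite [X in _ + X](_ : _ = Ex (tm 0 T) (fun s => Ex P (fun w => pfield X f (w, s)) - v)).
    by rewrite (ExB iF (L1_cst _ _)) (Ex_tm_cst _ T0) subr0; ring.
  by apply: eq_Ex => s; exact: e.
rewrite lerD2l (ceq_Ex (@past_setT _ _ _ _ P X 0) (ceq_increment' L0 hg g0 (lexx 0) T0)).
have [i1 b1] := hC 0; have [i2 b2] := hC T.
rewrite (ExB i1 i2); apply: lerD.
  by apply: le_trans b1; apply: (le_trans (ler_norm _)); exact: Ex_normr i1.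
by apply: le_trans b2; apply: (le_trans (ler_norm _)); rewrite normrN; exact: Ex_normr i2.
Qed.

(** Convergence in mean: truncate, bound the variance of the bounded part, and
    control the remainder through its stationary mean. *)
Lemma wlln_L1 f L e : 0 <= L -> lip L f -> 0 < e -> exists T0, forall T, T0 <= T -> 0 < T ->
  Ex P (fun w => `|T^-1 * Sf X 0 T f w - Ex mu (f : borel E -> R)|) <= e.
Proof.
move=> L0 hf e0; set v := Ex mu _.
have e50 : 0 < e / 5 by rewrite divr_gt0.
have if_ : L1 mu (f : borel E -> R) := L1_inv mu_P1 hf.
have [K K0 hK] := tail_small if_ e50.
pose fK (x : E) : R := Num.max 0 (`|f x| - K); pose tf (x : E) := clamp K (f x).
have htf : lip L tf by exact: lip_clamp.
have hfK : lip L fK.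
  by apply: lip_pos; apply: lipBc; exact: lip_norm.
set m := Ex mu (fun x => fK x) in hK.
set vK := Ex mu (tf : borel E -> R).
have itf : L1 mu (tf : borel E -> R) := L1_inv mu_P1 htf.
have hvK : `|vK - v| <= m.
  rewrite -(ExB itf if_); apply: Ex_dom; last exact: (L1_inv mu_P1 hfK).
    exact: (L1_meas (L1B itf if_)).
  by move=> x; rewrite distrC clamp_err.
pose g x := tf x - vK.
have hg : lip L g by exact: lipBc.
have g0 : Ex mu (g : borel E -> R) = 0 by rewrite (ExB itf (L1_cst _ _)) Ex_cst subrr.
have gK x : `|g x| <= K + `|vK|.
  by rewrite (le_trans (ler_normB _ _))// lerD2r clamp_norm.
have [C hC] := sq_Sf_linear L0 hg g0 gK.
have [C' hC'] := Ex_Sf_bound L0 hfK.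
exists (Num.max ((C / (e / 5) ^+ 2)) (C' / (e / 5))) => T; rewrite ge_max => /andP[T1 T2] T0.
have [i2 b2] := hC T (ltW T0); have bK := hC' T (ltW T0).
have hF := bfield_proc' hf; have hFg := bfield_proc' hg; have hFK := bfield_proc' hfK.
have iS := L1_tint 0 T hF; have iSg := L1_tint 0 T hFg; have iSK := L1_tint 0 T hFK.
have Ti : 0 < T^-1 by rewrite invr_gt0.
pose Q w := (e / 5 + (e / 5)^-1 * T^-1 ^+ 2 * Sf X 0 T g w ^+ 2) + (T^-1 * Sf X 0 T fK w + m).
have iQ : L1 P Q.
  apply: L1D; first by apply: L1_addcst; exact: L1Z.
  by apply: (eq_L1 _ (L1_addcst m (L1Z T^-1 iSK))) => w; rewrite addrC.
have bQ : Ex P Q <= e.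
  have iq1 : L1 P (fun w => (e / 5)^-1 * T^-1 ^+ 2 * Sf X 0 T g w ^+ 2) by exact: L1Z.
  rewrite (ExD (L1_addcst _ iq1) (L1D (L1Z T^-1 iSK) (L1_cst _ _))).
  rewrite (ExD (L1_cst _ _) iq1) (ExD (L1Z T^-1 iSK) (L1_cst _ _)) !Ex_cst (ExZ _ i2) (ExZ _ iSK).
  have a1 : (e / 5)^-1 * T^-1 ^+ 2 * Ex P (fun w => Sf X 0 T g w ^+ 2) <= e / 5.
    apply: le_trans (_ : (e / 5)^-1 * T^-1 ^+ 2 * (C * T) <= _).
      by rewrite ler_wpM2l// mulr_ge0 ?sqr_ge0// invr_ge0 ltW.
    move: T1; rewrite ler_pdivrMr ?exprn_gt0// => T1.
    rewrite (_ : _ * (C * T) = C / (T * (e / 5))); last by field; rewrite !gt_eqF.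
    by rewrite ler_pdivrMr ?mulr_gt0// mulrCA -expr2.
  have a2 : T^-1 * Ex P (Sf X 0 T fK) <= m + e / 5.
    rewrite mulrC ler_pdivrMr// (le_trans bK)// mulrDl mulrC lerD2l.
    by move: T2; rewrite ler_pdivrMr// mulrC.
  by have := hK; lra.
apply: le_trans bQ; apply: Ex_le_ae => //.
  by apply: L1_norm; exact: (L1B (L1Z _ iS) (L1_cst _ _)).
apply: filterS3 (tint_path 0 T hF) (tint_path 0 T hFg) (tint_path 0 T hFK) => w if1 ig1 ik1.
rewrite [`|_|](_ : _ = `|T^-1 * Sf X 0 T g w + (T^-1 * (Sf X 0 T f w - Ex (tm 0 T) (fun s : TR => tf (Y s w))) + (vK - v))|); last first.
  have itw : L1 (tm 0 T) (fun s : TR => tf (Y s w)).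
    by apply: (eq_L1 _ (L1D ig1 (L1_cst (tm 0 T) vK))) => s; rewrite /pfield /g /= subrK.
  congr (`|_|); rewrite [Sf X 0 T g w](_ : _ = Ex (tm 0 T) (fun s : TR => tf (Y s w)) - vK * T).
    by field; rewrite gt_eqF.
  have := ExB itw (L1_cst (tm 0 T) vK); rewrite (Ex_tm_cst _ (ltW T0)) subr0; exact.
have d1 : `|Sf X 0 T f w - Ex (tm 0 T) (fun s : TR => tf (Y s w))| <= Sf X 0 T fK w.
  have itw : L1 (tm 0 T) (fun s : TR => tf (Y s w)).
    by apply: (eq_L1 _ (L1D ig1 (L1_cst (tm 0 T) vK))) => s; rewrite /pfield /g /= subrK.
  rewrite -(ExB if1 itw); apply: Ex_dom => //; first exact: (L1_meas (L1B if1 itw)).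
  by move=> s; rewrite /pfield /= clamp_err.
rewrite (le_trans (ler_normD _ _))// /Q; apply: lerD; last first.
  rewrite (le_trans (ler_normD _ _))//; apply: lerD => //.
  by rewrite normrM gtr0_norm// ler_wpM2l// ltW.
move: (Sf X 0 T g w) => y.
have -> : (e / 5)^-1 * T^-1 ^+ 2 * y ^+ 2 = (e / 5)^-1 * `|T^-1 * y| ^+ 2.
  by rewrite (real_normK (num_real (T^-1 * y))) exprMn; ring.
have := normr_ge0 (T^-1 * y); move: (`|_|) => z z0.
rewrite -subr_ge0 (_ : _ - _ = (e / 5)^-1 * ((e / 5 - z) ^+ 2 + e / 5 * z)).
  by rewrite mulr_ge0 ?invr_ge0 ?(ltW e50)// addr_ge0 ?sqr_ge0// mulr_ge0// ltW.
by field; rewrite gt_eqF.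
Qed.

End law_of_large_numbers.

(** * Functionals known up to small errors *)

Section approximation.
Context {R : realType} {E : polishMetricType R}.
Context {d : measure_display} {Omega : measurableType d}.
Variables (P : probability Omega R) (X : R -> {RV P >-> borel E}).
Local Notation TR := (measurableTypeR R).
Local Notation past := (past X).
Implicit Types (a b : R) (Z Q : Omega -> R).

(** Time integrals over [0, a] need not be measurable with respect to the
    natural filtration at time a, but they are limits in mean of such
    functionals, and this suffices for conditioning. *)
Definition approx a Z := L1 P Z /\ forall e, 0 < e -> exists Z' : Omega -> R,
  [/\ measurable_fun setT (Z' : pastT X a -> R), L1 P Z' &
      Ex P (fun w => `|Z w - Z' w|) <= e].

Lemma approx_meas a Z : measurable_fun setT (Z : pastT X a -> R) -> L1 P Z -> approx a Z.
Proof.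
move=> mZ iZ; split => // e e0; exists Z; split => //.
by rewrite (_ : (fun w => _) = fun=> 0) ?Ex0 ?ltW//; apply/funext => w; rewrite subrr normr0.
Qed.

Let L1_dist Z Z' : L1 P Z -> L1 P Z' -> L1 P (fun w => `|Z w - Z' w|).
Proof. by move=> i1 i2; apply: L1_norm; exact: L1B. Qed.

Lemma approxD a Z Q : approx a Z -> approx a Q -> approx a (fun w => Z w + Q w).
Proof.
move=> [iZ hZ] [iQ hQ]; split; first exact: L1D.
move=> e e0; have e20 : 0 < e / 2 by rewrite divr_gt0.
have [Z' [m1 i1 b1]] := hZ _ e20; have [Q' [m2 i2 b2]] := hQ _ e20.
exists (fun w => Z' w + Q' w); split; [exact: measurable_funD|exact: L1D|].
have iD := L1D (L1_dist iZ i1) (L1_dist iQ i2).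
apply: (@le_trans _ _ (Ex P (fun w => `|Z w - Z' w| + `|Q w - Q' w|))).
  apply: Ex_le => //; first exact: (L1_dist (L1D iZ iQ) (L1D i1 i2)).
  by move=> w; rewrite opprD addrACA; exact: ler_normD.
by rewrite (ExD (L1_dist iZ i1) (L1_dist iQ i2)); lra.
Qed.

Lemma approx_le a b Z : a <= b -> approx a Z -> approx b Z.
Proof.
move=> ab [iZ hZ]; split => // e /hZ[Z' [mZ i1 b1]]; exists Z'; split => //.
by move=> mT B mB; exact: (past_le ab (mZ measurableT B mB)).
Qed.

Lemma approx_lim a Z : L1 P Z ->
  (forall e, 0 < e -> exists2 Q, approx a Q & Ex P (fun w => `|Z w - Q w|) <= e) -> approx a Z.
Proof.
move=> iZ h; split => // e e0; have e20 : 0 < e / 2 by rewrite divr_gt0.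
have [Q [iQ hQ] b1] := h _ e20; have [Z' [m2 i2 b2]] := hQ _ e20.
exists Z'; split => //.
apply: (@le_trans _ _ (Ex P (fun w => `|Z w - Q w| + `|Q w - Z' w|))).
  apply: Ex_le; [exact: L1_dist|exact: (L1D (L1_dist iZ iQ) (L1_dist iQ i2))|move=> w].
  exact: ler_distD.
by rewrite (ExD (L1_dist iZ iQ) (L1_dist iQ i2)); lra.
Qed.

Lemma lipR_meas d' (T' : measurableType d') (F : R -> R) l (Z : T' -> R) :
  (forall x y, `|F x - F y| <= l * `|x - y|) -> measurable_fun setT Z ->
  measurable_fun setT (fun w => F (Z w)).
Proof.
move=> hF mZ; apply: (measurableT_comp (f := F)) => //.
apply: continuous_measurable_fun => x.
apply/(@cvgrPdist_le _ R) => e e0.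
have l10 : 0 < `|l| + 1 by rewrite ltr_pwDr.
near=> y; rewrite (le_trans (hF x y))//.
apply: le_trans (_ : (`|l| + 1) * `|x - y| <= _).
  by rewrite ler_wpM2r// (le_trans (ler_norm l))// lerDl.
rewrite mulrC -ler_pdivlMr//; near: y.
by apply: cvgr_dist_le; [exact: cvg_id|rewrite divr_gt0].
Unshelve. all: by end_near. Qed.

(** Bounded Lipschitz functions of such functionals can be taken out of the
    conditional expectation. *)
Lemma approx_ceq a Z (F : R -> R) l M Q Q' : approx a Z ->
  (forall x y, `|F x - F y| <= l * `|x - y|) -> (forall x, `|F x| <= M) ->
  ceq P (past a) Q Q' ->
  Ex P (fun w => F (Z w) * Q w) = Ex P (fun w => F (Z w) * Q' w).
Proof.
move=> [iZ hZ] Fl FM hQ; have [iQ iQ' _] := hQ.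
have M0 : 0 <= M by exact: le_trans (normr_ge0 _) (FM 0).
have l0 : 0 <= l.
  by have := Fl 1 0; rewrite subr0 normr1 mulr1; apply: le_trans; exact: normr_ge0.
have mFZ := lipR_meas Fl (L1_meas iZ).
apply/eqP; rewrite -subr_eq0 -normr_le0; apply/ler_addgt0Pr => e e0; rewrite add0r.
pose H w := `|Q w| + `|Q' w|.
have iH : L1 P H by exact: L1D (L1_norm iQ) (L1_norm iQ').
have d0 : 0 < 4 * (M + 1) by rewrite mulr_gt0// ltr_wpDl.
have e10 : 0 < e / (4 * (M + 1)) by rewrite divr_gt0.
have [K K0 hK] := tail_small iH e10.
have k0 : 0 < 2 * (l * K + 1) by rewrite mulr_gt0// ltr_wpDl// mulr_ge0.
have e20 : 0 < e / (2 * (l * K + 1)) by rewrite divr_gt0.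
have [Z' [mZ' iZ' hZ']] := hZ _ e20.
have mFZ' := lipR_meas Fl (past_meas_fun mZ').
have gF : gmeas (past a) (fun w => F (Z' w)) by apply: gmeas_past; exact: lipR_meas Fl mZ'.
have e' := ceq_bounded (@past_setT _ _ _ _ P X a) (@past_measurable _ _ _ _ P X a) gF
  (fun w => FM (Z' w)) mFZ' hQ.
have i1 := L1_mulbounded mFZ (fun w => FM (Z w)) iQ.
have i1' := L1_mulbounded mFZ (fun w => FM (Z w)) iQ'.
have i2 := L1_mulbounded mFZ' (fun w => FM (Z' w)) iQ.
have i2' := L1_mulbounded mFZ' (fun w => FM (Z' w)) iQ'.
rewrite (_ : _ - _ = Ex P (fun w => F (Z w) * Q w - F (Z' w) * Q w) - Ex P (fun w => F (Z w) * Q' w - F (Z' w) * Q' w)); last first.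
  by rewrite (ExB i1 i2) (ExB i1' i2') e'; ring.
rewrite -(ExB (L1B i1 i2) (L1B i1' i2')).
have iK : L1 P (fun w => Num.max 0 (`|H w| - K)).
  apply: (L1_dom _ _ iH) => [|w].
    apply: measurable_maxr => //; apply: measurable_funB => //.
    by apply: measurableT_comp => //; exact: L1_meas iH.
  have H0 : 0 <= H w by rewrite addr_ge0.
  by rewrite (ger0_norm H0); case: (leP 0 (H w - K)) => h; rewrite ?normr0// ger0_norm// gerBl.
have iB := L1D (L1Z (l * K) (L1_dist iZ iZ')) (L1Z (2 * M) iK).
apply: le_trans (_ : Ex P (fun w => l * K * `|Z w - Z' w| + 2 * M * Num.max 0 (`|H w| - K)) <= _).
  apply: Ex_dom; [exact: (L1_meas (L1B (L1B i1 i2) (L1B i1' i2')))|move=> w|exact: iB].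
  rewrite -!mulrBl -mulrBr normrM.
  have hQQ : `|Q w - Q' w| <= H w by exact: ler_normB.
  have H0 : 0 <= H w by rewrite addr_ge0.
  rewrite (ger0_norm H0); apply: le_trans (ler_wpM2l _ hQQ) _ => //.
  have f1 := Fl (Z w) (Z' w).
  have f2 : `|F (Z w) - F (Z' w)| <= 2 * M.
    by rewrite (le_trans (ler_normB _ _))// mulr2n mulrDl mul1r lerD.
  move: (`|F (Z w) - _|) (normr_ge0 (F (Z w) - F (Z' w))) (`|Z w - Z' w|) (normr_ge0 (Z w - Z' w)) (H w) H0 f1 f2 => x x0 z z0 h hh0 f1 f2.
  have fK : x * K <= l * K * z by rewrite (mulrAC l) ler_wpM2r.
  case: (leP 0 (h - K)) => hK'.
    by rewrite -{1}[h](subrK K) mulrDr addrC lerD// ler_wpM2r.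
  rewrite mulr0 addr0 (le_trans _ fK)// ler_wpM2l//.
  by rewrite -subr_le0 ltW.
rewrite (ExD (L1Z (l * K) (L1_dist iZ iZ')) (L1Z (2 * M) iK)) (ExZ _ (L1_dist iZ iZ')) (ExZ _ iK).
have b1 : l * K * Ex P (fun w => `|Z w - Z' w|) <= e / 2.
  apply: le_trans (ler_wpM2l _ hZ') _; first exact: mulr_ge0.
  rewrite mulrA ler_pdivrMr// (_ : e / 2 * _ = l * K * e + e); last by field.
  by rewrite lerDl ltW.
have b2 : 2 * M * Ex P (fun w => Num.max 0 (`|H w| - K)) <= e / 2.
  apply: le_trans (ler_wpM2l _ hK) _; first exact: mulr_ge0.
  rewrite mulrA ler_pdivrMr// (_ : e / 2 * _ = 2 * M * e + 2 * e); last by field.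
  by rewrite lerDl mulr_ge0// ltW.
lra.
Qed.

End approximation.

Section time_integrals_are_approximable.
Context {R : realType} {E : polishMetricType R}.
Context {d : measure_display} {Omega : measurableType d}.
Variables (P : probability Omega R) (Pt : R -> R.-pker (borel E) ~> (borel E)).
Variables (mu0 : probability (borel E) R) (X : R -> {RV P >-> borel E}).
Hypothesis XM : markov_process X Pt mu0.
Hypothesis mu0_P1 : finite_first_moment mu0.
Hypothesis sg : transition_semigroup Pt.
Hypothesis h0 : H0 Pt.
Variables (c gam : R).
Hypotheses (c0 : 0 < c) (gam0 : 0 < gam).
Hypothesis P1_stable : forall (t : R) (mu : probability (borel E) R), 0 <= t ->
  finite_first_moment mu -> finite_first_moment (kernel_push mu (Pt t)).
Hypothesis contr : forall (t : R) (mu nu : probability (borel E) R), 0 <= t ->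
  finite_first_moment mu -> finite_first_moment nu ->
  (wasserstein (kernel_push mu (Pt t)) (kernel_push nu (Pt t)) <=
   (c * expR (- gam * t))%:E * wasserstein mu nu)%E.
Variable mu : probability (borel E) R.
Hypothesis mu_inv : invariant_law Pt mu.
Hypothesis mu_P1 : finite_first_moment mu.
Variable o : E.
Local Notation TR := (measurableTypeR R).
Local Notation Pf t f := (kernel_op (Pt t) f).
Local Notation kap := (kappa c gam).
Local Notation V := (weight mu o).
Local Notation Y := (proc X).
Local Notation past := (past X).
Implicit Types (a b s t : R) (f g : E -> R).

Let bfield_proc' := bfield_proc XM mu0_P1 c0 gam0 P1_stable contr mu_inv mu_P1 o.
Let proc_L1' := proc_L1 XM mu0_P1 c0 P1_stable contr o.
Let markov_lip' := markov_lip XM mu0_P1 c0 P1_stable contr o.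

(** The Feller property makes bounded functions of the process right continuous
    in mean square, hence in mean. *)
Lemma right_L1_cvg f L K s (u : nat -> R) : 0 <= s -> lip L f -> (forall x, `|f x| <= K) ->
  (forall n, s < u n) -> u n @[n --> \oo] --> s ->
  Ex P (fun w => `|f (Y (u n) w) - f (Y s w)|) @[n --> \oo] --> (0 : R).
Proof.
move=> s0 hf fK su cu.
have K0 : 0 <= K by exact: le_trans (normr_ge0 _) (fK o).
have bf : bounded_continuous f by exact: lip_bc hf fK.
have hf2 : lip (K * L + K * L) (fun x => f x * f x) by exact: (lipM K0 K0 hf hf fK fK).
have f2K x : `|f x * f x| <= K * K by rewrite normrM ler_pM.
have bf2 : bounded_continuous (fun x => f x * f x) by exact: lip_bc hf2 f2K.
have us0 n : 0 <= u n - s by rewrite subr_ge0 ltW.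
have cu0 : u n - s @[n --> \oo] --> (0 : R).
  by rewrite -(subrr s); apply: cvgB => //; exact: cvg_cst.
have P0 h x : bounded_continuous h -> Pf (u n - s) h x @[n --> \oo] --> h x.
  move=> bh; have := h0.2 x _ bh => /cvg_at_rightP/(_ (fun n => u n - s)); apply.
  by split => // n; rewrite subr_gt0.
pose G n w := Pf (u n - s) (fun x => f x * f x) (Y s w) - 2 * (f (Y s w) * Pf (u n - s) f (Y s w)) + f (Y s w) * f (Y s w).
have Pb n h x M : (forall y, `|h y| <= M) -> measurable_fun setT (h : borel E -> R) -> `|Pf (u n - s) h x| <= M.
  move=> hM mh; rewrite /kernel_op -[M](Ex_cst (pk (Pt (u n - s)) x)).
  by apply: (Ex_dom mh hM); exact: (L1_cst (pk (Pt (u n - s)) x)).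
have mPf n h : bounded_continuous h -> measurable_fun setT (fun w => Pf (u n - s) h (Y s w)).
  move=> bh; apply: (measurableT_comp (f := Pf (u n - s) h)); last exact: meas_proc.
  by apply: bc_meas; exact: h0.1.
have mf : measurable_fun setT (fun w => f (Y s w)) := meas_f_proc X s hf.
have mG n : measurable_fun setT (G n).
  apply: measurable_funD; last exact: measurable_funM.
  apply: measurable_funB; first exact: mPf.
  by apply: measurable_funM => //; apply: measurable_funM => //; exact: mPf.
have cG w : G n w @[n --> \oo] --> 0 * (0 : R).
  rewrite (_ : 0 * 0 = f (Y s w) * f (Y s w) - 2 * (f (Y s w) * f (Y s w)) + f (Y s w) * f (Y s w)); last by ring.
  apply: cvgD; last exact: cvg_cst; apply: cvgB; first exact: (P0 (fun x => f x * f x) (Y s w) bf2).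
  by apply: cvgMl_tmp; apply: cvgMl_tmp; exact: P0.
have bG n w : `|G n w| <= 4 * (K * K).
  have h1 := Pb n _ (Y s w) _ f2K (bc_meas bf2); have h2 := Pb n _ (Y s w) _ fK (bc_meas bf).
  have h3 := f2K (Y s w).
  have h4 : `|f (Y s w) * Pf (u n - s) f (Y s w)| <= K * K by rewrite normrM ler_pM.
  rewrite (le_trans (ler_normD _ _))// (_ : 4 * (K * K) = K * K + 2 * (K * K) + K * K); last by ring.
  apply: lerD => //; rewrite (le_trans (ler_normB _ _))//; apply: lerD => //.
  by rewrite normrM ger0_norm// ler_pM2l.
have [_] := Ex_dct mG cG bG (L1_cst P (4 * (K * K))); rewrite (Ex_cst P) mulr0.
have EG n : Ex P (G n) = Ex P (fun w => `|f (Y (u n) w) - f (Y s w)| ^+ 2).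
  have mu_ : measurable_fun setT (fun w => f (Y (u n) w)) := meas_f_proc X (u n) hf.
  have iA : L1 P (fun w => f (Y (u n) w) * f (Y (u n) w)).
    by apply: (L1_bounded _ (measurable_funM mu_ mu_)) => w; exact: f2K.
  have iB : L1 P (fun w => f (Y s w) * f (Y (u n) w)).
    by apply: (L1_mulbounded mf (fun w => fK _)); exact: proc_L1' hf.
  have iC : L1 P (fun w => f (Y s w) * f (Y s w)).
    by apply: (L1_mulbounded mf (fun w => fK _)); exact: proc_L1' hf.
  have c1 := markov_lip' s0 (us0 n) hf2; have c2 := markov_lip' s0 (us0 n) hf.
  rewrite (addrC s) subrK in c1 c2.
  have iB' : L1 P (fun w => f (Y s w) * Pf (u n - s) f (Y s w)).
    by apply: (L1_mulbounded mf (fun w => fK _)); case: c2.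
  have iA' : L1 P (fun w => Pf (u n - s) (fun x => f x * f x) (Y s w)) by case: c1.
  rewrite (ExD (L1B iA' (L1Z 2 iB')) iC) (ExB iA' (L1Z 2 iB')) (ExZ _ iB').
  rewrite -(ceq_Ex (@past_setT _ _ _ _ P X s) c1).
  rewrite -(ceq_bounded (@past_setT _ _ _ _ P X s) (@past_measurable _ _ _ _ P X s)
    (gmeas_proc (lexx s) s0 hf) (fun w => fK (Y s w)) mf c2).
  rewrite -(ExZ _ iB) -(ExB iA (L1Z 2 iB)) -(ExD (L1B iA (L1Z 2 iB)) iC).
  by apply: eq_Ex => w; rewrite real_normK ?num_real//; ring.
rewrite (funext EG) => c2.
apply/cvgr0Pnorm_le => e e0.
have e40 : 0 < e / 2 by rewrite divr_gt0.
have e50 : 0 < e / 2 * (e / 2) by rewrite mulr_gt0.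
move/cvgr0Pnorm_le : c2 => /(_ _ e50)[N _ hN]; exists N => // n /hN /=.
set q := Ex P _; move=> hq; rewrite ger0_norm; last by apply: Ex_ge0 => w.
have iD : L1 P (fun w => `|f (Y (u n) w) - f (Y s w)|).
  by apply: L1_norm; apply: L1B; exact: proc_L1' hf.
have iD2 : L1 P (fun w => `|f (Y (u n) w) - f (Y s w)| ^+ 2).
  have hb w : `| `|f (Y (u n) w) - f (Y s w)| ^+ 2| <= (K + K) ^+ 2.
    rewrite normrX normr_id ler_pXn2r ?nnegrE ?addr_ge0//.
    by rewrite (le_trans (ler_normB _ _))// lerD.
  by apply: (L1_bounded P _ hb); apply: measurable_funX; exact: L1_meas iD.
apply: le_trans (_ : Ex P (fun w => e / 2 + (e / 2)^-1 * `|f (Y (u n) w) - f (Y s w)| ^+ 2) <= _).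
  apply: Ex_le => //; first by apply: L1_addcst; exact: L1Z.
  move=> w; move: (`|_ - _|) (normr_ge0 (f (Y (u n) w) - f (Y s w))) => z z0.
  rewrite -subr_ge0 (_ : _ - _ = (e / 2)^-1 * ((e / 2 - z) ^+ 2 + e / 2 * z)).
    by rewrite mulr_ge0 ?invr_ge0 ?(ltW e40)// addr_ge0 ?sqr_ge0// mulr_ge0// ltW.
  by field; rewrite gt_eqF.
rewrite (ExD (L1_cst _ _) (L1Z _ iD2)) (Ex_cst P) (ExZ _ iD2) -/q.
have : (e / 2)^-1 * q <= e / 2.
  by rewrite mulrC ler_pdivrMr// (le_trans (ler_norm q)).
lra.
Qed.

Let approx_Sf_bounded f L K a : 0 <= a -> lip L f -> (forall x, `|f x| <= K) ->
  approx X a (Sf X 0 a f).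
Proof.
move=> a0 hf fK; have hF := bfield_proc' hf.
have iS : L1 P (Sf X 0 a f) by exact: L1_tint.
have K0 : 0 <= K by exact: le_trans (normr_ge0 _) (fK o).
pose F n (z : Omega * TR) := f (Y (Num.min a (grid n z.2)) z.1).
pose S n : Omega -> R := tint 0 a (F n).
have mpast n : measurable_fun setT (fun z : pastT X a * TR => F n z).
  have ms : measurable_fun setT (fun z : pastT X a * TR => (z.2, z.1)).
    by apply/measurable_fun_pairP; split; [exact: measurable_snd|exact: measurable_fst].
  have h := @meas_step R _ _ (pastT X a) R (tick n) (fun k w => f (Y (Num.min a (k.+1%:R / n.+1%:R)) w)) (meas_tick n).
  have {}h := measurableT_comp (h _) ms; apply: h => k.
  have mp : measurable_fun setT (proc X (Num.min a (k.+1%:R / n.+1%:R)) : pastT X a -> borel E).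
    by apply: meas_past_proc => //; rewrite ge_min lexx.
  by have h' := measurableT_comp (lip_meas hf : measurable_fun setT (f : borel E -> R)) mp; exact: h'.
have mF n : measurable_fun setT (F n).
  have ms : measurable_fun setT (fun z : Omega * TR => (z.2, z.1)).
    by apply/measurable_fun_pairP; split; [exact: measurable_snd|exact: measurable_fst].
  have h := @meas_step R _ _ Omega R (tick n) (fun k w => f (Y (Num.min a (k.+1%:R / n.+1%:R)) w)) (meas_tick n).
  by have {}h := measurableT_comp (h _) ms; apply: h => k; exact: meas_f_proc hf.
have bF n : bfield P (F n).
  split => //; exists K => s.
  have i1 : L1 P (fun w => F n (w, s)) := proc_L1' (Num.min a (grid n s)) hf.
  split => //; rewrite -[K](Ex_cst P); apply: Ex_le; [exact: (L1_norm i1)|exact: (L1_cst P)|by move=> w; exact: fK].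
have iSn n : L1 P (S n) by exact: L1_tint.
apply: approx_lim => // e e0.
pose D n (z : Omega * TR) := `|pfield X f z - F n z|.
have mD n : measurable_fun setT (D n).
  by apply: measurableT_comp => //; apply: measurable_funB => //; exact: hF.1.
have bD n : bfield P (D n).
  apply: (bfield_dom (mD n) (G := fun z => K + K)) => [z|].
    by rewrite /D normr_id (le_trans (ler_normB _ _))//; apply: lerD; exact: fK.
  split; first exact: measurable_cst.
  by exists `|K + K| => s; split; [exact: (L1_cst P)|rewrite (Ex_cst P)].
have mI n : measurable_fun setT (fun s : TR => if 0 <= s <= a then Ex P (fun w => D n (w, s)) else 0).
  apply: measurable_fun_ifT => //; last exact: (L1_meas (L1_mean 0 a (bD n))).
  by apply: measurable_and; exact: measurable_fun_ler.
have cv : Ex (tm 0 a) (fun s => if 0 <= s <= a then Ex P (fun w => D n (w, s)) else 0) @[n --> \oo] --> Ex (tm 0 a) (fun=> 0).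
  apply: (@Ex_dct _ _ _ (tm 0 a) _ _ (fun=> K + K) _ _ _ _).2.
  - exact: mI.
  - move=> s; have [/andP[s0 sa]|_] := boolP (0 <= s <= a); last exact: cvg_cst.
    move: sa; rewrite le_eqVlt => /predU1P[->|sa].
      rewrite (_ : (fun n => _) = fun=> 0); first exact: cvg_cst.
      apply/funext => n; rewrite (_ : (fun w => _) = fun=> 0) ?Ex0//.
      apply/funext => w; rewrite /D /F /pfield /= min_l ?subrr ?normr0//.
      by rewrite ltW// (le_lt_trans _ (grid_gt n a))// /pos_time le_max lexx orbT.
    have := right_L1_cvg s0 hf fK (u := fun n => grid n s).
    have sg' n : s < grid n s by rewrite (le_lt_trans _ (grid_gt n s))// /pos_time le_max lexx orbT.
    have gc : grid n s @[n --> \oo] --> s by rewrite -[X in _ --> X](pos_timeE s0); exact: (@grid_cvg R s).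
    move=> /(_ sg' gc); apply: cvg_trans; apply: near_eq_cvg.
    have := gc; move=> /cvgr_lt/(_ a sa)[N _ hN]; exists N => // n /hN /= hn.
    by apply: eq_Ex => w; rewrite /D /F /pfield /= distrC min_r// ltW.
  - move=> n s; have [_|_] := boolP (0 <= s <= a); last by rewrite normr0 addr_ge0.
    have [i1 _] := (bD n).2.
    rewrite -[K + K](Ex_cst P); apply: Ex_dom => [||]; last exact: (L1_cst P).
      exact: (measurable_fun_pair1 (f := D n) s (mD n)).
    by move=> w; rewrite /D normr_id (le_trans (ler_normB _ _))//; apply: lerD; exact: fK.
  - exact: L1_cst.
move: cv; rewrite Ex0 => /cvgr0Pnorm_le/(_ _ e0)[N _ /(_ N (leqnn N)) hN].
exists (S N).
  apply: approx_meas => //.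
  exact: (@meas_Ex_param _ _ (pastT X a) TR R (tm 0 a) (F N) (mpast N)).
apply: le_trans (le_trans (ler_norm _) hN).
rewrite (_ : Ex (tm 0 a) _ = Ex P (tint 0 a (D N))); last first.
  rewrite (Ex_tint 0 a (bD N)); apply: Ex_tm_eq => [||s ->].
  - exact: mI.
  - exact: (L1_meas (L1_mean 0 a (bD N))).
  - by [].
apply: Ex_le_ae; [exact: L1_norm (L1B iS (iSn N))|exact: L1_tint|].
apply: filterS2 (tint_path 0 a hF) (tint_path 0 a (bF N)) => w i1 i2.
by rewrite -(ExB i1 i2); exact: Ex_normr (L1B i1 i2).
Qed.

Lemma approx_Sf f L a : 0 <= a -> lip L f -> approx X a (Sf X 0 a f).
Proof.
move=> a0 hf; have hF := bfield_proc' hf; have iS := L1_tint 0 a hF.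
apply: approx_lim => // e e0.
have hN (n : nat) : lip L (fun x => clamp n%:R (f x)) by exact: lip_clamp.
pose T (n : nat) (z : Omega * TR) := Num.max 0 (`|pfield X f z| - n%:R).
have mT n : measurable_fun setT (T n).
  apply: measurable_maxr => //; apply: measurable_funB => //.
  by apply: measurableT_comp => //; exact: hF.1.
have Tf n z : `|T n z| <= `|pfield X f z|.
  by rewrite /T; case: (leP 0 (`|pfield X f z| - n%:R)) => h; rewrite ?normr0// ger0_norm// gerBl.
have bN : bfield P (fun z => `|pfield X f z|) by exact: (bfield_proc' (lip_norm hf)).
have bT n : bfield P (T n) := bfield_dom (mT n) (Tf n) bN.
have [_ [C hC]] := bN.
have cv : Ex (tm 0 a) (fun s => Ex P (fun w => T n (w, s))) @[n --> \oo] --> Ex (tm 0 a) (fun=> 0).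
  apply: (@Ex_dct _ _ _ (tm 0 a) _ _ (fun=> C) _ _ _ _).2.
  - by move=> n; exact: (L1_meas (L1_mean 0 a (bT n))).
  - by move=> s; apply: tail_cvg; exact: (proc_L1' s hf).
  - move=> n s; have [i1 b1] := hC s; apply: le_trans b1.
    apply: Ex_dom; [exact: (measurable_fun_pair1 (f := T n) s (mT n))|by move=> w; rewrite normr_id|exact: L1_norm].
  - exact: L1_cst.
move: cv; rewrite Ex0 => /cvgr0Pnorm_le/(_ _ e0)[N _ /(_ N (leqnn N)) hN'].
exists (Sf X 0 a (fun x => clamp N%:R (f x))).
  by apply: approx_Sf_bounded (hN N) _ => // x; exact: clamp_norm.
have hG := bfield_proc' (hN N); have iSN := L1_tint 0 a hG.
apply: le_trans (le_trans (ler_norm _) hN'); rewrite -(Ex_tint 0 a (bT N)).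
apply: Ex_le_ae; [exact: L1_norm (L1B iS iSN)|exact: L1_tint|].
apply: filterS3 (tint_path 0 a hF) (tint_path 0 a hG) (tint_path 0 a (bT N)) => w i1 i2 i3.
rewrite -(ExB i1 i2); apply: Ex_dom => //; first exact: (L1_meas (L1B i1 i2)).
by move=> s; rewrite /pfield /= clamp_err.
Qed.

End time_integrals_are_approximable.

(** * The quadratic variation of the martingale *)

Section elementary.
Context {R : realType}.
Implicit Types x y : R.

Lemma sqrB_le x y : (y - x) ^+ 2 <= 2 * (y ^+ 2 + x ^+ 2).
Proof. by have := sqr_ge0 (y + x); nra. Qed.

Lemma mulrB_norm_le x y : `|x * (x - y)| <= x ^+ 2 + (x ^+ 2 + y ^+ 2).
Proof.
have h1 := sqr_ge0 (x - y); have h2 := sqr_ge0 (x + y); have h3 := sqr_ge0 x.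
by rewrite ler_norml; apply/andP; split; nra.
Qed.

Lemma collect_errors (x1 x2 x3 q h x0 M C D e : R) : `|x2| <= M * (4 * D) -> `|x3| <= M * (6 * D) ->
  `|x1 - q * h * x0| <= M * (C + e / 2 * h) ->
  `|2 * x1 + x2 - x3 - 2 * q * h * x0| <= M * (2 * C + 10 * D + e * h).
Proof.
move=> b2 b3 b1.
rewrite (_ : _ - 2 * q * h * x0 = 2 * (x1 - q * h * x0) + (x2 - x3)); last by ring.
apply: le_trans (ler_normD _ _) _.
rewrite [M * _](_ : _ = 2 * (M * (C + e / 2 * h)) + (M * (4 * D) + M * (6 * D))); last by field.
apply: lerD; first by rewrite normrM ger0_norm// ler_pM2l.
by apply: (le_trans (ler_normB _ _)); exact: lerD.
Qed.

End elementary.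

Section quadratic_variation.
Context {R : realType} {E : polishMetricType R}.
Context {d : measure_display} {Omega : measurableType d}.
Variables (P : probability Omega R) (Pt : R -> R.-pker (borel E) ~> (borel E)).
Variables (mu0 : probability (borel E) R) (X : R -> {RV P >-> borel E}).
Hypothesis XM : markov_process X Pt mu0.
Hypothesis mu0_P1 : finite_first_moment mu0.
Hypothesis sg : transition_semigroup Pt.
Hypothesis h0 : H0 Pt.
Variables (c gam : R).
Hypotheses (c0 : 0 < c) (gam0 : 0 < gam).
Hypothesis P1_stable : forall (t : R) (mu : probability (borel E) R), 0 <= t ->
  finite_first_moment mu -> finite_first_moment (kernel_push mu (Pt t)).
Hypothesis contr : forall (t : R) (mu nu : probability (borel E) R), 0 <= t ->
  finite_first_moment mu -> finite_first_moment nu ->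
  (wasserstein (kernel_push mu (Pt t)) (kernel_push nu (Pt t)) <=
   (c * expR (- gam * t))%:E * wasserstein mu nu)%E.
Variable mu : probability (borel E) R.
Hypothesis mu_inv : invariant_law Pt mu.
Hypothesis mu_P1 : finite_first_moment mu.
Variable o : E.
Local Notation TR := (measurableTypeR R).
Local Notation Pf t f := (kernel_op (Pt t) f).
Local Notation kap := (kappa c gam).
Local Notation V := (weight mu o).
Local Notation Y := (proc X).
Local Notation past := (past X).
Implicit Types (a b s t : R) (f : E -> R).

Let bfield_proc' := bfield_proc XM mu0_P1 c0 gam0 P1_stable contr mu_inv mu_P1 o.
Let proc_L1' := proc_L1 XM mu0_P1 c0 P1_stable contr o.
Let markov_lip' := markov_lip XM mu0_P1 c0 P1_stable contr o.
Let ceq_increment' := ceq_increment XM mu0_P1 sg h0 c0 gam0 P1_stable contr mu_inv mu_P1 o.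
Let lip_chi'' := lip_chi' sg h0 c0 gam0 P1_stable contr mu_inv mu_P1 o.
Let pastT_ a := @past_setT _ _ _ _ P X a.
Let pastm a := @past_measurable _ _ _ _ P X a.

(** A majorant of Lipschitz functions, up to a factor. *)
Definition growth : borel E -> R := fun x => 1 + V x.
Local Notation U := growth.

Lemma growth_ge1 x : 1 <= U x. Proof. by rewrite lerDl weight_ge0. Qed.

Lemma lip_growth1 : lip 1 U.
Proof. by move=> x y; rewrite /growth opprD addrACA subrr add0r; exact: lip_weight. Qed.

Lemma growth_lip f K : 0 <= K -> lip K f -> forall x, `|f x| <= (`|f o| + K) * U x.
Proof.
move=> K0 hf x; apply: le_trans (lip_bound mu o x K0 hf) _.
have V0 := weight_ge0 mu o x; rewrite /growth; move: (V x) V0 => v V0.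
rewrite (_ : _ * _ = `|f o| + K * v + (`|f o| * v + K)); last by ring.
by rewrite lerDl addr_ge0// mulr_ge0.
Qed.

(** Uniform integrability of the squares. *)
Hypothesis ui : forall e, 0 < e -> exists2 K, 0 <= K & forall s,
  L1 P (fun w => Num.max 0 (U (Y s w) - K) ^+ 2) /\
  Ex P (fun w => Num.max 0 (U (Y s w) - K) ^+ 2) <= e.

Lemma growth_sq : exists M2, forall s,
  L1 P (fun w => U (Y s w) ^+ 2) /\ Ex P (fun w => U (Y s w) ^+ 2) <= M2.
Proof.
have [K K0 hK] := ui ltr01; exists (2 * 1 + 2 * K ^+ 2) => s.
have [i1 b1] := hK s.
have hb w : `|U (Y s w) ^+ 2| <= 2 * Num.max 0 (U (Y s w) - K) ^+ 2 + 2 * K ^+ 2.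
  rewrite ger0_norm ?sqr_ge0//; have := growth_ge1 (Y s w); move: (U _) => u u1.
  by case: (leP 0 (u - K)) => h; [have := sqr_ge0 (u - 2 * K)|]; nra.
have mU : measurable_fun setT (fun w => U (Y s w) ^+ 2).
  by apply: measurable_funX; exact: (meas_f_proc X s lip_growth1).
have iB : L1 P (fun w => 2 * Num.max 0 (U (Y s w) - K) ^+ 2 + 2 * K ^+ 2).
  by apply: L1D; [exact: L1Z|exact: L1_cst].
split; first exact: L1_dom mU hb iB.
apply: (le_trans (ler_norm _)); apply: (le_trans (Ex_dom mU hb iB)).
by rewrite (ExD (L1Z _ i1) (L1_cst P _)) (Ex_cst P) (ExZ _ i1) lerD2r ler_pM2l.
Qed.

Lemma bfield_quad (f : borel E -> R) B : 0 <= B -> measurable_fun setT f ->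
  (forall x, `|f x| <= B * U x ^+ 2) -> bfield P (pfield X f).
Proof.
move=> B0 mf fB; have [M2 hM2] := growth_sq.
have mY := meas_pfield XM lip_growth1.
have mp : measurable_fun setT (pfield X f).
  have ms : measurable_fun setT (fun z : Omega * TR => (z.2, z.1)).
    by apply/measurable_fun_pairP; split; [exact: measurable_snd|exact: measurable_fst].
  exact: (measurableT_comp mf (measurableT_comp (meas_proc2 XM) ms)).
apply: (bfield_dom mp (G := fun z => B * pfield X U z ^+ 2)) => [z|]; first exact: fB.
split; first by apply: measurable_funM => //; exact: measurable_funX.
exists (B * M2) => s; have [i1 b1] := hM2 s; split; first exact: L1Z.
have -> : Ex P (fun w => `|B * pfield X U (w, s) ^+ 2|) = Ex P (fun w => B * U (Y s w) ^+ 2).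
  by apply: eq_Ex => w; rewrite ger0_norm// mulr_ge0 ?sqr_ge0.
by rewrite (ExZ _ i1) ler_wpM2l.
Qed.

Variables (g : E -> R) (L : R).
Hypotheses (L0 : 0 <= L) (hg : lip L g) (g0 : Ex mu (g : borel E -> R) = 0).
Local Notation potential := (@chi R E Pt).
Local Notation chi := (chi Pt g).

Let hchi := lip_chi'' L0 hg g0.

Lemma common_growth : exists2 A, 0 <= A & forall x, `|g x| <= A * U x /\ `|chi x| <= A * U x.
Proof.
have C0 : 0 <= chi_lipc c gam L by apply: chi_lipc_ge0.
exists ((`|g o| + L) + (`|chi o| + chi_lipc c gam L)); first by rewrite !addr_ge0.
move=> x; have U0 : 0 <= U x by rewrite (le_trans ler01)// growth_ge1.
split; first apply: (le_trans (growth_lip L0 hg x)).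
  by apply: ler_wpM2r => //; rewrite lerDl addr_ge0.
apply: (le_trans (growth_lip C0 hchi x)).
by apply: ler_wpM2r => //; rewrite lerDr addr_ge0.
Qed.

Definition corr : borel E -> R := fun x => g x * chi x.
Definition corr_trunc K : borel E -> R := fun x => clamp K (g x) * clamp K (chi x).

Lemma meas_corr : measurable_fun setT corr.
Proof. by apply: measurable_funM; [exact: lip_meas hg|exact: lip_meas hchi]. Qed.

Lemma bfield_corr : bfield P (pfield X corr).
Proof.
have [A A0 hA] := common_growth.
apply: (bfield_quad (B := A ^+ 2) (sqr_ge0 _) meas_corr) => x; have [h1 h2] := hA x.
by rewrite normrM -exprMn expr2 ler_pM.
Qed.

Lemma lip_corr_trunc K : 0 <= K -> exists2 L', 0 <= L' & lip L' (corr_trunc K).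
Proof.
move=> K0; have C0 : 0 <= chi_lipc c gam L by apply: chi_lipc_ge0.
have h1 : lip L (fun x => clamp K (g x)) by exact: lip_clamp.
have h2 : lip (chi_lipc c gam L) (fun x => clamp K (chi x)) by exact: lip_clamp.
exists (K * chi_lipc c gam L + K * L); first by apply: addr_ge0; exact: mulr_ge0.
by apply: (lipM K0 K0 h1 h2) => x; exact: clamp_norm.
Qed.

Lemma corr_trunc_err e : 0 < e -> exists2 K, 0 <= K &
  forall s, Ex P (fun w => `|corr (Y s w) - corr_trunc K (Y s w)|) <= e.
Proof.
move=> e0; have [A A0 hA] := common_growth.
have d0 : 0 < 4 * A ^+ 2 + 1 by rewrite ltr_wpDl// mulr_ge0 ?sqr_ge0.
have e10 : 0 < e / (4 * A ^+ 2 + 1) by rewrite divr_gt0.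
have [K K0 hK] := ui e10; exists (2 * (A * K)) => [|s]; first by rewrite !mulr_ge0.
have AK0 : 0 <= 2 * (A * K) by rewrite !mulr_ge0.
have [i1 b1] := hK s.
have iC : L1 P (fun w => corr (Y s w)) by have [_ [C /(_ s)[]]] := bfield_corr.
have [L' L'0 hL'] := lip_corr_trunc AK0.
have iT : L1 P (fun w => corr_trunc (2 * (A * K)) (Y s w)) := proc_L1' s hL'.
apply: le_trans (_ : Ex P (fun w => 4 * A ^+ 2 * Num.max 0 (U (Y s w) - K) ^+ 2) <= _); last first.
  rewrite (ExZ _ i1); have A4 : 0 <= 4 * A ^+ 2 by rewrite mulr_ge0 ?sqr_ge0.
  apply: le_trans (ler_wpM2l A4 b1) _; rewrite mulrA ler_pdivrMr// mulrC ler_pM2l//.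
  by rewrite lerDl.
apply: Ex_le; [exact: L1_norm (L1B iC iT)|exact: L1Z|move=> w].
have [h1 h2] := hA (Y s w); have U1 := growth_ge1 (Y s w).
have e1 := clamp_err (g (Y s w)) AK0; have e2 := clamp_err (chi (Y s w)) AK0.
have e3 := clamp_le (g (Y s w)) AK0.
rewrite /corr /corr_trunc; move: (clamp _ (g _)) (clamp _ (chi _)) e1 e2 e3 => x y e1 e2 e3.
move: (g _) (chi _) (U _) h1 h2 U1 e1 e2 e3 => p q u h1 h2 U1 e1 e2 e3.
have u0 : 0 <= u by exact: le_trans ler01 U1.
pose m := Num.max 0 (u - 2 * K); have m0 : 0 <= m by rewrite le_max lexx.
have mx z : `|z| <= A * u -> Num.max 0 (`|z| - 2 * (A * K)) <= A * m.
  move=> hz; rewrite ge_max mulr_ge0//=; apply: le_trans (_ : A * (u - 2 * K) <= _); first by lra.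
  by rewrite ler_wpM2l// le_max lexx orbT.
rewrite (_ : p * q - x * y = (p - x) * q + x * (q - y)); last by ring.
apply: le_trans (ler_normD _ _) _; rewrite !normrM e1 e2.
apply: le_trans (_ : A * m * (A * u) + A * u * (A * m) <= _).
  apply: lerD; apply: ler_pM => //; rewrite ?le_max ?lexx//; try exact: mx.
  exact: le_trans e3 h1.
have um : u * m <= 2 * Num.max 0 (u - K) ^+ 2.
  rewrite /m; case: (leP 0 (u - 2 * K)) => k1; last by rewrite mulr0 mulr_ge0 ?sqr_ge0.
  have k2 : 0 <= u - K by lra.
  rewrite max_r// expr2 mulrA; apply: ler_pM => //; lra.
rewrite (_ : _ + _ = 2 * A ^+ 2 * (u * m)); last by ring.
rewrite (_ : 4 * A ^+ 2 * _ = 2 * A ^+ 2 * (2 * Num.max 0 (u - K) ^+ 2)); last by ring.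
by rewrite ler_wpM2l// mulr_ge0 ?sqr_ge0.
Qed.

(** The mean of corr(X_t) has a limit as t tends to infinity, namely the
    integral of corr with respect to the stationary law; it is reached through
    truncations, to which the ergodic estimate applies. *)
Lemma corr_limit : exists q : R, forall e, 0 < e -> exists2 K, 0 <= K &
  (forall s, Ex P (fun w => `|corr (Y s w) - corr_trunc K (Y s w)|) <= e) /\
  `|Ex mu (corr_trunc K) - q| <= e.
Proof.
pose u (n : nat) := Ex P (fun w => corr (Y n%:R w)).
have iC s : L1 P (fun w => corr (Y s w)) by have [_ [C /(_ s)[]]] := bfield_corr.
have close K e : 0 <= K -> 0 < e ->
    (forall s, Ex P (fun w => `|corr (Y s w) - corr_trunc K (Y s w)|) <= e) ->
    \forall n \near \oo, `|Ex mu (corr_trunc K) - u n| <= e + e.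
  move=> K0 e0 hK; have [L' L'0 hL'] := lip_corr_trunc K0.
  have iV : L1 P (fun w => V (Y 0 w)) := proc_L1' 0 (lip_weight mu o).
  have kc := kappa_nat_cvg0 c gam0 (L' * Ex P (fun w => V (Y 0 w))).
  move/cvgr0Pnorm_le : kc => /(_ e e0)[N _ hN].
  exists N => // n /hN hn; rewrite /u.
  have iT : L1 P (fun w => corr_trunc K (Y n%:R w)) := proc_L1' _ hL'.
  have cT := markov_lip' (lexx 0) (ler0n R n) hL'; rewrite add0r in cT; have [_ iP _] := cT.
  pose m := Ex mu (corr_trunc K); pose cu := Ex P (fun w => corr (Y n%:R w)).
  pose ct := Ex P (fun w => corr_trunc K (Y n%:R w)).
  suff : `|m - ct - (cu - ct)| <= e + e by rewrite opprB addrA subrK.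
  apply: le_trans (ler_normB _ _) _; apply: lerD; last first.
    apply: le_trans (hK n%:R); rewrite /cu /ct -(ExB (iC n%:R) iT).
    exact: Ex_normr (L1B (iC n%:R) iT).
  have -> : ct = Ex P (fun w => Pf n%:R (corr_trunc K) (Y 0 w)) by exact: (ceq_Ex (@pastT_ 0) cT).
  have -> : m = Ex P (fun=> m) by rewrite (Ex_cst P).
  rewrite -(ExB (L1_cst P m) iP).
  apply: le_trans (le_trans (ler_norm _) hn); rewrite mulrA -(ExZ _ iV).
  apply: Ex_dom; [exact: (L1_meas (L1B (L1_cst P m) iP))|move=> w|exact: L1Z].
  by rewrite distrC; exact: (Pf_ergodic c0 P1_stable contr mu_inv mu_P1 (Y 0 w) o (ler0n R n) L'0 hL').
have ucvg : cvgn u.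
  apply/cauchy_cvgP; apply: cauchy_exP => e e0.
  have e40 : 0 < e / 4 by rewrite divr_gt0.
  have [K K0 hK] := corr_trunc_err e40.
  exists (Ex mu (corr_trunc K)).
  have [N _ hN] := close K _ K0 e40 hK; exists N => // n /hN /= hn.
  by rewrite /ball /=; apply: (le_lt_trans hn); lra.
exists (lim (u n @[n --> \oo])) => e e0.
have e20 : 0 < e / 2 by rewrite divr_gt0.
have [K K0 hK] := corr_trunc_err e20.
exists K => //; split; first by move=> s; rewrite (le_trans (hK s))//; lra.
have cv : `|Ex mu (corr_trunc K) - u n| @[n --> \oo] --> `|Ex mu (corr_trunc K) - lim (u n @[n --> \oo])|.
  by apply: cvg_norm; apply: cvgB => //; exact: cvg_cst.
apply: (cvgr_to_le cv); rewrite [e](_ : _ = e / 2 + e / 2); last by lra.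
exact: close.
Qed.

Variable q : R.
Hypothesis hq : forall e, 0 < e -> exists2 K, 0 <= K &
  (forall s, Ex P (fun w => `|corr (Y s w) - corr_trunc K (Y s w)|) <= e) /\
  `|Ex mu (corr_trunc K) - q| <= e.

(** Admissible weights: bounded Lipschitz functions of functionals of the past. *)
Definition past_weight a (Z : Omega -> R) (F : R -> R) (l M : R) := [/\ 0 <= a, approx X a Z,
  forall x y, `|F x - F y| <= l * `|x - y| & forall x, `|F x| <= M].

Lemma past_weightP a Z F l M : past_weight a Z F l M ->
  [/\ 0 <= M, measurable_fun setT (fun w => F (Z w)),
      forall Q, L1 P Q -> L1 P (fun w => F (Z w) * Q w) &
      forall Q, L1 P Q -> `|Ex P (fun w => F (Z w) * Q w)| <= M * Ex P (fun w => `|Q w|)].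
Proof.
move=> [_ aZ Fl FM].
have M0 : 0 <= M by exact: le_trans (normr_ge0 _) (FM 0).
have mW := lipR_meas Fl (L1_meas aZ.1).
have iW Q : L1 P Q -> L1 P (fun w => F (Z w) * Q w).
  by move=> iQ; exact: (L1_mulbounded mW (fun w => FM (Z w)) iQ).
split => // Q iQ; rewrite -(ExZ _ (L1_norm iQ)).
apply: Ex_dom; [exact: L1_meas (iW Q iQ)|move=> w|exact: L1Z (L1_norm iQ)].
by rewrite normrM ler_wpM2r.
Qed.

(** Time averages of corr along the process, even weighted by an event of the
    past, are close to the limit q: the truncations are handled by their own
    martingale decomposition. *)
Lemma corr_integral e : 0 < e -> exists2 C, 0 <= C & forall a Z F l M, past_weight a Z F l M ->
  forall b, a <= b ->
  `|Ex (tm a b) (fun s => Ex P (fun w => F (Z w) * corr (Y s w))) - q * (b - a) * Ex P (fun w => F (Z w))| <=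
  M * (C + e * (b - a)).
Proof.
move=> e0; have e20 : 0 < e / 2 by rewrite divr_gt0.
have [K K0 [hK hKq]] := hq e20.
have [L' L'0 hL'] := lip_corr_trunc K0.
set m := Ex mu (corr_trunc K) in hKq.
pose h (x : E) := corr_trunc K x - m.
have hh : lip L' h by exact: lipBc.
have mh0 : Ex mu (h : borel E -> R) = 0.
  by rewrite (ExB (L1_inv mu_P1 hL') (L1_cst mu m)) (Ex_cst mu) subrr.
have [_ [C hC]] := bfield_proc' (lip_chi'' L'0 hh mh0).
have C0 : 0 <= C by have [_] := hC 0; apply: le_trans; apply: Ex_ge0 => w.
exists (C + C) => [|a Z F l M hW b ab]; first by rewrite addr_ge0.
have [a0 aZ Fl FM] := hW; have [M0 mW iW EW] := past_weightP hW.
have WM w : `|F (Z w)| <= M by exact: FM.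
have bC := bfield_mul mW WM bfield_corr; have bT := bfield_proc' hL'.
have bH := bfield_proc' hh; have bWH := bfield_mul mW WM bH.
have iC s : L1 P (fun w => corr (Y s w)) by have [_ [D /(_ s)[]]] := bfield_corr.
have iT s : L1 P (fun w => corr_trunc K (Y s w)) := proc_L1' s hL'.
have iH s : L1 P (fun w => h (Y s w)) := proc_L1' s hh.
have iWcst : L1 P (fun w => F (Z w)) by exact: (L1_bounded P mW WM).
have chi_h : ceq P (past a) (Sf X a b h) (fun w => potential h (Y a w) - potential h (Y b w)).
  have hx := ceq_increment' L'0 hh mh0 a0 ab. exact: hx.
have eH : Ex (tm a b) (fun s => Ex P (fun w => F (Z w) * h (Y s w))) =
    Ex P (fun w => F (Z w) * (potential h (Y a w) - potential h (Y b w))).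
  rewrite -(approx_ceq aZ Fl FM chi_h) -(Ex_tint a b bWH); have [iS _ _] := chi_h.
  apply: Ex_ae_eq; [exact: (L1_meas (L1_tint a b bWH))|exact: (L1_meas (iW _ iS))|].
  by apply: filterS (tint_path a b bH) => w iw; exact: (@ExZ _ _ _ (tm a b) (F (Z w)) _ iw).
have bH' : `|Ex (tm a b) (fun s => Ex P (fun w => F (Z w) * h (Y s w)))| <= M * (C + C).
  rewrite eH; have [i1 b1] := hC a; have [i2 b2] := hC b.
  apply: le_trans (EW _ (L1B i1 i2)) _; apply: ler_wpM2l => //.
  apply: le_trans (lerD b1 b2); rewrite -(ExD (L1_norm i1) (L1_norm i2)).
  apply: Ex_le; [exact: L1_norm (L1B i1 i2)|exact: (L1D (L1_norm i1) (L1_norm i2))|move=> w].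
  exact: ler_normB.
have LC := L1_mean a b bC; have LH := L1_mean a b bWH.
pose EW0 := Ex P (fun w => F (Z w)).
have -> : q * (b - a) * EW0 = Ex (tm a b) (fun=> q * EW0) by rewrite (Ex_tm_cst _ ab); ring.
rewrite -(ExB LC (L1_cst (tm a b) (q * EW0))).
pose r s := Ex P (fun w => F (Z w) * corr (Y s w)) - q * EW0 - Ex P (fun w => F (Z w) * h (Y s w)).
have Lr : L1 (tm a b) r by exact: (L1B (L1B LC (L1_cst (tm a b) (q * EW0))) LH).
have -> : Ex (tm a b) (fun s => Ex P (fun w => F (Z w) * corr (Y s w)) - q * EW0) =
    Ex (tm a b) r + Ex (tm a b) (fun s => Ex P (fun w => F (Z w) * h (Y s w))).
  by rewrite -(ExD Lr LH); apply: eq_Ex => s; rewrite /r subrK.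
have EW0M : `|EW0| <= M.
  have -> : M = Ex P (fun=> M) by rewrite (Ex_cst P).
  exact: (Ex_dom mW WM (L1_cst P M)).
apply: le_trans (ler_normD _ _) _; rewrite mulrDr addrC; apply: lerD => //.
rewrite mulrA; apply: (Ex_tm_bound ab (L1_meas Lr)) => s _.
have -> : r s = Ex P (fun w => F (Z w) * (corr (Y s w) - corr_trunc K (Y s w))) + (m - q) * EW0.
  have e1 : Ex P (fun w => F (Z w) * (corr (Y s w) - corr_trunc K (Y s w))) =
      Ex P (fun w => F (Z w) * corr (Y s w)) - Ex P (fun w => F (Z w) * corr_trunc K (Y s w)).
    by rewrite -(ExB (iW _ (iC s)) (iW _ (iT s))); apply: eq_Ex => w; rewrite mulrBr.
  have e2 : Ex P (fun w => F (Z w) * h (Y s w)) = Ex P (fun w => F (Z w) * corr_trunc K (Y s w)) - m * EW0.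
    by rewrite -(ExZ m iWcst) -(ExB (iW _ (iT s)) (L1Z m iWcst)); apply: eq_Ex => w; rewrite /h; ring.
  by rewrite /r e1 e2; ring.
apply: le_trans (ler_normD _ _) _; rewrite [M * e](_ : _ = M * (e / 2) + e / 2 * M); last by field.
apply: lerD; last by rewrite normrM ler_pM.
by apply: le_trans (EW _ (L1B (iC s) (iT s))) _; rewrite ler_wpM2l.
Qed.

(** Increments over [a, b] of the martingale chi(Y_t) + int_0^t g(Y_s) ds. *)
Definition mart a b (w : Omega) : R := Sf X a b g w + (chi (Y b w) - chi (Y a w)).

Lemma ceq_mart a b : 0 <= a -> a <= b -> ceq P (past a) (mart a b) (fun=> 0).
Proof.
move=> a0 ab; have h := ceq_increment' L0 hg g0 a0 ab; have [_ iD _] := h.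
have h2 := ceqB (@pastm a) h (ceq_refl (past a) iD).
apply: (eq_ceq _ _ h2) => [w|w]; last by rewrite subrr.
by rewrite /mart opprB.
Qed.

Let bfield_sq f K : 0 <= K -> lip K f -> bfield P (fun z => pfield X f z ^+ 2).
Proof.
move=> K0 hf; apply: (@bfield_quad (fun x => f x ^+ 2) ((`|f o| + K) ^+ 2) (sqr_ge0 _)).
  by apply: measurable_funX; exact: lip_meas hf.
move=> x; rewrite normrX -exprMn; have h := growth_lip K0 hf x.
by rewrite ler_pXn2r// nnegrE// (le_trans _ h).
Qed.

Let sq_proc f K : 0 <= K -> lip K f -> exists D, forall s,
  L1 P (fun w => f (Y s w) ^+ 2) /\ Ex P (fun w => f (Y s w) ^+ 2) <= D.
Proof.
move=> K0 hf; have [_ [D hD]] := bfield_sq K0 hf.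
exists D => s; have [i1 b1] := hD s; split => //.
by apply: le_trans b1; apply: (le_trans (ler_norm _)); exact: Ex_normr i1.
Qed.

Lemma L1_mul2 (f h : Omega -> R) : measurable_fun setT f -> measurable_fun setT h ->
  L1 P (fun w => f w ^+ 2) -> L1 P (fun w => h w ^+ 2) -> L1 P (fun w => f w * h w).
Proof.
move=> mf mh i1 i2; apply: (L1_dom _ _ (L1D i1 i2)) => [|w]; first exact: measurable_funM.
have := sqr_ge0 (f w + h w); have := sqr_ge0 (f w - h w); have := sqr_ge0 (f w); have := sqr_ge0 (h w).
by move=> *; rewrite ler_norml; apply/andP; split; nra.
Qed.

Let C0 : 0 <= chi_lipc c gam L. Proof. by apply: chi_lipc_ge0. Qed.

Lemma L1_sq_mart a b : 0 <= a -> a <= b -> L1 P (fun w => mart a b w ^+ 2).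
Proof.
move=> a0 ab; have [D hD] := sq_proc C0 hchi.
have [Dg hDg] := sq_proc L0 hg.
have bF2 := bfield_sq L0 hg.
have iS2 := L1_sq_tint ab (bfield_proc' hg) bF2.
have [im _ _] := ceq_mart a0 ab.
have iB := L1Z 3 (L1D iS2 (L1D (hD b).1 (hD a).1)).
apply: (L1_dom _ _ iB) => [|w]; first by apply: measurable_funX; exact: L1_meas im.
rewrite ger0_norm ?sqr_ge0// /mart /Sf; move: (tint _ _ _ _) (chi (Y b w)) (chi (Y a w)) => x y z.
have := sqr_ge0 (x - y); have := sqr_ge0 (x + z); have := sqr_ge0 (y + z); nra.
Qed.

(** The conditional variance of the increments is asymptotically 2q per unit of
    time, with an error that is negligible on long intervals. *)
Lemma sq_mart e : 0 < e -> exists2 C, 0 <= C & forall a Z F l M, past_weight a Z F l M ->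
  forall b, a <= b ->
  `|Ex P (fun w => F (Z w) * mart a b w ^+ 2) - 2 * q * (b - a) * Ex P (fun w => F (Z w))| <= M * (C + e * (b - a)).
Proof.
move=> e0; have e20 : 0 < e / 2 by rewrite divr_gt0.
have [C CC0 hC] := corr_integral e20.
have [D hD] := sq_proc C0 hchi.
have [Dg hDg] := sq_proc L0 hg.
have D0 : 0 <= D by have [_] := hD 0; apply: le_trans; apply: Ex_ge0 => w; exact: sqr_ge0.
exists (2 * C + 10 * D) => [|a Z F l M hW b ab]; first by rewrite addr_ge0// mulr_ge0.
have [a0 aZ Fl FM] := hW; have [M0 mW iW EW] := past_weightP hW.
have WM w : `|F (Z w)| <= M by exact: FM.
have bF := bfield_proc' hg.
have bF2 := bfield_sq L0 hg.
have iS2 := L1_sq_tint ab bF bF2.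
pose S := Sf X a b g; pose ya w := chi (Y a w); pose yb w := chi (Y b w).
have mS : measurable_fun setT S by exact: (L1_meas (L1_tint a b bF)).
have ma : measurable_fun setT ya := meas_f_proc X a hchi.
have mb : measurable_fun setT yb := meas_f_proc X b hchi.
have [ia2 ba2] := hD a; have [ib2 bb2] := hD b.
have iaS : L1 P (fun w => ya w * S w) := L1_mul2 ma mS ia2 iS2.
have ibS : L1 P (fun w => yb w * S w) := L1_mul2 mb mS ib2 iS2.
have iab : L1 P (fun w => ya w * (ya w - yb w)).
  by apply: (eq_L1 _ (L1B ia2 (L1_mul2 ma mb ia2 ib2))) => w; rewrite mulrBr expr2.
(* the part of the square that carries the variance *)
have T1 : Ex P (fun w => F (Z w) * (S w ^+ 2 + 2 * yb w * S w)) =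
    2 * Ex (tm a b) (fun s => Ex P (fun w => F (Z w) * corr (Y s w))).
  rewrite (Ex_sq_tintE ab bF bF2 mb ib2 mW WM); congr (2 * _).
  have bSq := bfield_sq_field ab bF bF2 mb ib2.
  apply: Ex_tm_eq.
  - exact: (L1_meas (L1_mean a b (bfield_mul mW WM bSq))).
  - exact: (L1_meas (L1_mean a b (bfield_mul mW WM bfield_corr))).
  move=> s /andP[as_ sb]; have s0 := le_trans a0 as_.
  apply: (approx_ceq (approx_le as_ aZ) Fl FM).
  have h := ceqD (@pastm s) (ceq_increment' L0 hg g0 s0 sb) (ceq_refl (past s) (proc_L1' b hchi)).
  have i1 : L1 P (fun w => sq_field a b (pfield X g) yb (w, s)) by have [_ [? /(_ s)[]]] := bSq.
  have i2 : L1 P (fun w => corr (Y s w)) by have [_ [? /(_ s)[]]] := bfield_corr.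
  have e1 w : g (Y s w) * (Sf X s b g w + chi (Y b w)) = sq_field a b (pfield X g) yb (w, s).
    by rewrite /sq_field (tail_tintE b bF w as_).
  have e2 w : g (Y s w) * (chi (Y s w) - chi (Y b w) + chi (Y b w)) = corr (Y s w).
    by rewrite subrK.
  have i1' := eq_L1 (fun w => esym (e1 w)) i1; have i2' := eq_L1 (fun w => esym (e2 w)) i2.
  have hh := ceq_mul (@pastT_ s) (@pastm s) (@past_setI _ _ _ _ P X s) (@past_setC _ _ _ _ P X s)
    (gmeas_proc (lexx s) s0 hg) (meas_f_proc X s hg) i1' i2' h.
  exact: (eq_ceq e1 e2 hh).
have T3 : Ex P (fun w => F (Z w) * (ya w * S w)) = Ex P (fun w => F (Z w) * (ya w * (ya w - yb w))).
  apply: (approx_ceq aZ Fl FM).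
  exact: (ceq_mul (@pastT_ a) (@pastm a) (@past_setI _ _ _ _ P X a) (@past_setC _ _ _ _ P X a)
    (gmeas_proc (lexx a) a0 hchi) ma iaS iab (ceq_increment' L0 hg g0 a0 ab)).
have iQ1 : L1 P (fun w => S w ^+ 2 + 2 * yb w * S w).
  by apply: (eq_L1 _ (L1D iS2 (L1Z 2 ibS))) => w; rewrite mulrA.
have eQ2 w : ya w ^+ 2 + yb w ^+ 2 - 2 * (ya w * yb w) = (yb w - ya w) ^+ 2.
  by move: (ya w) (yb w) => x y; ring.
have iQ2 := eq_L1 eQ2 (L1B (L1D ia2 ib2) (L1Z 2 (L1_mul2 ma mb ia2 ib2))).
have eD : Ex P (fun w => F (Z w) * mart a b w ^+ 2) =
    Ex P (fun w => F (Z w) * (S w ^+ 2 + 2 * yb w * S w)) + Ex P (fun w => F (Z w) * (yb w - ya w) ^+ 2)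
    - 2 * Ex P (fun w => F (Z w) * (ya w * (ya w - yb w))).
  have e3 := ExD (iW _ iQ1) (iW _ iQ2); have e4 := ExZ 2 (iW _ iaS).
  have e5 := ExB (L1D (iW _ iQ1) (iW _ iQ2)) (L1Z 2 (iW _ iaS)).
  have eE w : F (Z w) * mart a b w ^+ 2 = (F (Z w) * (S w ^+ 2 + 2 * yb w * S w) + F (Z w) * (yb w - ya w) ^+ 2)
      - 2 * (F (Z w) * (ya w * S w)).
    rewrite /mart -/(S w) -/(ya w) -/(yb w).
    by move: (F (Z w)) (S w) (ya w) (yb w) => v x y z; ring.
  rewrite (eq_Ex _ eE); apply: (etrans e5); congr (_ - _); first exact: e3.
  by rewrite -T3; exact: e4.
have b2 : `|Ex P (fun w => F (Z w) * (yb w - ya w) ^+ 2)| <= M * (4 * D).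
  apply: le_trans (EW _ iQ2) _; apply: ler_wpM2l => //.
  apply: le_trans (_ : Ex P (fun w => 2 * (yb w ^+ 2 + ya w ^+ 2)) <= _).
    apply: Ex_le; [exact: L1_norm iQ2|exact: L1Z (L1D ib2 ia2)|move=> w].
    by rewrite ger0_norm ?sqr_ge0//; exact: sqrB_le.
  rewrite (ExZ _ (L1D ib2 ia2)) (ExD ib2 ia2) (_ : 4 * D = 2 * (D + D)); last by ring.
  by rewrite ler_pM2l// lerD.
have b3 : `|2 * Ex P (fun w => F (Z w) * (ya w * (ya w - yb w)))| <= M * (6 * D).
  rewrite normrM ger0_norm//.
  apply: le_trans (ler_wpM2l _ (EW _ iab)) _ => //; rewrite mulrCA; apply: ler_wpM2l => //.
  apply: le_trans (_ : 2 * Ex P (fun w => ya w ^+ 2 + (ya w ^+ 2 + yb w ^+ 2)) <= _).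
    rewrite ler_pM2l//; apply: Ex_le; [exact: L1_norm iab|exact: (L1D ia2 (L1D ia2 ib2))|move=> w].
    exact: mulrB_norm_le.
  rewrite (ExD ia2 (L1D ia2 ib2)) (ExD ia2 ib2) (_ : 6 * D = 2 * (D + (D + D))); last by ring.
  by rewrite ler_pM2l// !lerD.
rewrite eD T1; exact: (collect_errors b2 b3 (hC _ _ _ _ _ hW b ab)).
Qed.

End quadratic_variation.

(** * The Gaussian semigroup *)

Section calculus.
Context {R : realType}.
Implicit Types (f g : R -> R) (a b t x y B : R).

Lemma drvD f g t a b : is_derive t 1 f a -> is_derive t 1 g b ->
  is_derive t 1 (fun s => f s + g s) (a + b).
Proof. by move=> hf hg; exact: (is_deriveD hf hg). Qed.

Lemma drv_cst k t : is_derive t 1 (fun=> k : R) 0.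
Proof. exact: is_derive_cst. Qed.

Lemma drv_id t : is_derive t 1 (fun s : R => s) 1.
Proof. exact: is_derive_id. Qed.

Lemma drvM f g t a b : is_derive t 1 f a -> is_derive t 1 g b ->
  is_derive t 1 (fun s => f s * g s) (f t * b + g t * a).
Proof. by move=> hf hg; exact: (is_deriveM hf hg). Qed.

Lemma drvZ k f t a : is_derive t 1 f a -> is_derive t 1 (fun s => k * f s) (k * a).
Proof. by move=> hf; exact: (is_deriveZ k hf). Qed.

Lemma drv_comp f g t a b : is_derive (g t) 1 f a -> is_derive t 1 g b ->
  is_derive t 1 (fun s => f (g s)) (a * b).
Proof. by move=> hf hg; exact: (is_derive1_comp hf hg). Qed.

Lemma mvt f df x y : x <= y -> (forall t, x <= t <= y -> is_derive t 1 f (df t)) ->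
  exists2 c, x <= c <= y & f y - f x = df c * (y - x).
Proof.
move=> xy h; have h1 t : t \in `]x, y[ -> is_derive t 1 f (df t).
  by rewrite in_itv/= => /andP[t1 t2]; apply: h; rewrite !ltW.
have hc : {within `[x, y], continuous f}.
  apply: derivable_within_continuous => t; rewrite in_itv/= => /h ht.
  exact: (@ex_derive _ _ _ _ _ _ _ ht).
by have [c] := MVT_segment xy h1 hc; rewrite in_itv/= => hcc e; exists c.
Qed.

Lemma mvt_abs f df x y : (forall t, is_derive t 1 f (df t)) ->
  exists2 c, `|c - x| <= `|y - x| & f y - f x = df c * (y - x).
Proof.
move=> h; have [xy|yx] := leP x y.
  have [c /andP[c1 c2] e] := mvt xy (fun t _ => h t); exists c => //.
  by rewrite !ger0_norm ?subr_ge0// lerD2r.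
have [c /andP[c1 c2] e] := mvt (ltW yx) (fun t _ => h t); exists c.
  by have yx' := ltW yx; rewrite !ler0_norm ?subr_le0// lerN2 lerD2r.
by rewrite -[LHS]opprB e; ring.
Qed.

Lemma lip_of_drv f df B : (forall t, is_derive t 1 f (df t)) -> (forall t, `|df t| <= B) ->
  forall x y, `|f x - f y| <= B * `|x - y|.
Proof.
move=> h hB x y; have [c _ ->] := mvt_abs y x h.
by rewrite normrM ler_wpM2r.
Qed.

(** Second order expansion with a remainder adapted to square integrable
    increments. *)
Lemma taylor2 f df ddf B x y : (forall t, is_derive t 1 f (df t)) ->
  (forall t, is_derive t 1 df (ddf t)) -> (forall t, `|ddf t| <= B) ->
  (forall s t, `|ddf s - ddf t| <= B * `|s - t|) ->
  `|f y - f x - (y - x) * df x - (y - x) ^+ 2 / 2 * ddf x| <= 2 * B * (y - x) ^+ 2 * Num.min 1 `|y - x|.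
Proof.
move=> h1 h2 hB hL.
have B0 : 0 <= B by exact: le_trans (normr_ge0 _) (hB 0).
pose G t := f t + (- f x + (- df x * (t + - x) + - ddf x / 2 * ((t + - x) * (t + - x)))).
pose dG t := df t + (0 + (- df x * (1 + 0) + - ddf x / 2 * ((t + - x) * (1 + 0) + (t + - x) * (1 + 0)))).
have hG t : is_derive t 1 G (dG t).
  have dx : is_derive t 1 (fun s => s + - x) (1 + 0) := drvD (drv_id t) (drv_cst (- x) t).
  exact: (drvD (h1 t) (drvD (drv_cst (- f x) t) (drvD (drvZ _ dx) (drvZ _ (drvM dx dx))))).
have Gx : G x = 0 by rewrite /G; field.
have [c c1 e] := mvt_abs x y hG.
have -> : f y - f x - (y - x) * df x - (y - x) ^+ 2 / 2 * ddf x = G y - G x.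
  by rewrite Gx /G; field.
have [c' c1' e'] := mvt_abs x c h2.
rewrite e (_ : dG c = (ddf c' - ddf x) * (c - x)); last first.
  by rewrite mulrBl -e' /dG; field.
rewrite -[(y - x) ^+ 2](real_normK (num_real _)) !normrM.
have d1 : `|ddf c' - ddf x| <= 2 * B * Num.min 1 `|y - x|.
  case: (leP 1 `|y - x|) => _.
    by rewrite mulr1 (le_trans (ler_normB _ _))// mulr2n mulrDl mul1r lerD.
  apply: (le_trans (hL _ _)); apply: le_trans (_ : B * `|y - x| <= _).
    by rewrite ler_wpM2l// (le_trans c1').
  by rewrite ler_wpM2r// ler_peMl// ler1n.
apply: le_trans (_ : 2 * B * Num.min 1 `|y - x| * `|y - x| * `|y - x| <= _).
  by rewrite ler_wpM2r//; apply: ler_pM.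
by rewrite le_eqVlt; apply/orP; left; apply/eqP; ring.
Qed.

Lemma taylor1 f df ddf B x y : x <= y -> (forall t, x <= t <= y -> is_derive t 1 f (df t)) ->
  (forall t, x <= t <= y -> is_derive t 1 df (ddf t)) -> (forall t, x <= t <= y -> `|ddf t| <= B) ->
  `|f y - f x - (y - x) * df x| <= B * (y - x) ^+ 2.
Proof.
move=> xy h1 h2 hB; have [c /andP[c1 c2] e] := mvt xy h1.
have sub t : x <= t <= c -> x <= t <= y.
  by move=> /andP[-> t2]/=; exact: le_trans t2 c2.
have [c' c1' e'] := mvt c1 (fun t ht => h2 t (sub t ht)).
rewrite e (_ : _ - _ = ddf c' * (c - x) * (y - x)); last by rewrite -e'; ring.
rewrite !normrM expr2 mulrA; apply: ler_pM => //.
  by apply: ler_pM => //; [exact/hB/sub|rewrite !ger0_norm ?subr_ge0// lerD2r].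
by rewrite ger0_norm// subr_ge0.
Qed.

End calculus.

Section gaussian.
Context {R : realType}.
Local Notation TR := (measurableTypeR R).
Implicit Types (x z v : R).

Definition gauss : R -> R := normal_pdf 0 1.
Local Notation k := (normal_peak (1 : R)).

Lemma gaussE z : gauss z = k * expR (- (z * z / 2)).
Proof.
rewrite /gauss normal_pdfE ?oner_neq0// /normal_fun subr0 expr1n; congr (_ * expR _).
by rewrite expr2 mulNr.
Qed.

Let k0 : 0 <= k. Proof. exact: normal_peak_ge0. Qed.

Lemma drv_gauss z : is_derive z 1 gauss (- (z * gauss z)).
Proof.
rewrite (_ : gauss = fun z => k * expR (- 2^-1 * (z * z))); last first.
  by apply/funext => y; rewrite gaussE; congr (k * expR _); field.
have h := drvZ k (drv_comp (is_derive_expR _) (drvZ (- 2^-1) (drvM (drv_id z) (drv_id z)))).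
by apply: (is_derive_eq h); field.
Qed.

Lemma expR_mul_le1 (u : R) : 0 <= u -> u * expR (- u) <= 1.
Proof.
move=> u0; rewrite expRN ler_pdivrMr ?expR_gt0// mul1r.
by rewrite (le_trans _ (expR_ge1Dx u))// lerDr.
Qed.

Lemma gauss_ge0 z : 0 <= gauss z. Proof. by rewrite gaussE mulr_ge0 ?expR_ge0. Qed.

Lemma gauss_le z : gauss z <= k.
Proof.
rewrite gaussE ler_piMr// -expR0 ler_expR oppr_le0 divr_ge0//.
by rewrite -expr2 sqr_ge0.
Qed.

Lemma gauss2_le z : z ^+ 2 * gauss z <= 2 * k.
Proof.
have u0 : 0 <= z * z / 2 by rewrite divr_ge0// -expr2 sqr_ge0.
have := expR_mul_le1 u0; rewrite gaussE; move: (expR _) => e h.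
have -> : z ^+ 2 * (k * e) = 2 * k * (z * z / 2 * e) by field.
by apply: ler_piMr => //; exact: mulr_ge0.
Qed.

Lemma gauss4_le z : z ^+ 4 * gauss z <= 16 * k.
Proof.
have u0 : 0 <= z * z / 4 by rewrite divr_ge0// -expr2 sqr_ge0.
have := expR_mul_le1 u0; rewrite gaussE.
have -> : - (z * z / 2) = - (z * z / 4) + - (z * z / 4) by field.
rewrite expRD; have := expR_ge0 (- (z * z / 4)); move: (expR _) => e e0 h.
have h2 : (z * z / 4 * e) ^+ 2 <= 1 by rewrite expr_le1// mulr_ge0.
have -> : z ^+ 4 * (k * (e * e)) = 16 * k * (z * z / 4 * e) ^+ 2 by field.
by apply: ler_piMr => //; exact: mulr_ge0.
Qed.

Let abs_poly (y g : R) : 0 <= g -> g <= k -> y ^+ 2 * g <= 2 * k -> y ^+ 4 * g <= 16 * k ->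
  `|y * g| <= 3 * k /\ `|y ^+ 3 * g| <= 18 * k.
Proof.
move=> gg0 g1 g2 g4; rewrite (normrM y g) (normrM (y ^+ 3) g) normrX (ger0_norm gg0).
rewrite -(real_normK (num_real y)) in g2.
have e4 : y ^+ 4 = `|y| ^+ 4 by rewrite -[4%N]/(2 * 2)%N !exprM real_normK// num_real.
rewrite e4 in g4; have := normr_ge0 y; move: `|y| g2 g4 => a g2 g4 a0.
split.
  have : a * g <= (1 + a ^+ 2) * g by rewrite ler_wpM2r//; have := sqr_ge0 (a - 1); nra.
  by rewrite mulrDl mul1r; lra.
have : a ^+ 3 * g <= (a ^+ 2 + a ^+ 4) * g.
  rewrite ler_wpM2r// (_ : a ^+ 2 + a ^+ 4 = a ^+ 2 * (1 + a ^+ 2)); last by ring.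
  by rewrite exprS mulrC ler_wpM2l ?sqr_ge0//; have := sqr_ge0 (a - 1); nra.
by rewrite mulrDl; lra.
Qed.

Lemma gauss1_le z : `|z * gauss z| <= 3 * k.
Proof. by have [] := abs_poly (gauss_ge0 z) (gauss_le z) (gauss2_le z) (gauss4_le z). Qed.

Lemma gauss3_le z : `|z ^+ 3 * gauss z| <= 18 * k.
Proof. by have [] := abs_poly (gauss_ge0 z) (gauss_le z) (gauss2_le z) (gauss4_le z). Qed.

(** Centered normal distribution functions. *)
Definition ncdf (s x : R) : R := fine (normal_prob 0 s `]-oo, x]).
Definition Phi : R -> R := ncdf 1.

Lemma ncdf_fin s x : normal_prob 0 s `]-oo, x] = (ncdf s x)%:E.
Proof. by rewrite /ncdf fineK//; exact: (fin_num_measure (normal_prob 0 s)). Qed.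

Lemma ncdf01 s x : 0 <= ncdf s x <= 1.
Proof.
rewrite -!lee_fin -ncdf_fin; apply/andP; split => //.
exact: (probability_le1 (normal_prob 0 s)).
Qed.

Lemma ncdf_homo s : {homo ncdf s : x y / x <= y}.
Proof.
move=> x y xy; rewrite -lee_fin -!ncdf_fin.
apply: (le_measure (normal_prob 0 s)); rewrite ?inE//.
by apply: subset_itvl; rewrite bnd_simp.
Qed.

Let idTR : TR -> R := idfun.
#[local] HB.instance Definition _ := @isMeasurableFun.Build _ _ _ _ idTR (@measurable_id _ _ setT).

Let cdf_id s x : cdf (idTR : {RV (normal_prob 0 s) >-> R}) x = (ncdf s x)%:E.
Proof. by rewrite -ncdf_fin. Qed.

Lemma ncdf_cvg0 s : ncdf s x @[x --> -oo] --> (0 : R).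
Proof.
have := @cvg_cdfNy0 _ _ _ _ (idTR : {RV (normal_prob 0 s) >-> R}).
by rewrite (funext (cdf_id s)) => /fine_cvg.
Qed.

Lemma ncdf_cvg1 s : ncdf s x @[x --> +oo] --> (1 : R).
Proof.
have := @cvg_cdfy1 _ _ _ _ (idTR : {RV (normal_prob 0 s) >-> R}).
by rewrite (funext (cdf_id s)) => /fine_cvg.
Qed.

Lemma drv_ncdf s x : s != 0 -> is_derive x 1 (ncdf s) (normal_pdf 0 s x).
Proof.
move=> s0; have xx : x < x + 1 by rewrite ltrDl.
have i1 : (@lebesgue_measure R).-integrable `]-oo, (x + 1)] (EFin \o normal_pdf 0 s).
  by apply: (integrableS measurableT) => //; exact: integrable_normal_pdf.
have [h1 h2] := continuous_FTC1 (a := -oo%O) xx i1 (ltNyr _) (continuous_normal_pdf s0 (x := x)).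
exact: (DeriveDef h1 (etrans (esym (derive1E _ _)) h2)).
Qed.

Lemma ncdf_scale s x : 0 < s -> ncdf s x = Phi (x / s).
Proof.
move=> s0; have s1 : s != 0 by rewrite gt_eqF.
pose D y := ncdf s y + - 1 * Phi (s^-1 * y).
have hD (y : R) : is_derive y 1 D 0.
  have e : (0 : R) = normal_pdf 0 s y + - 1 * (gauss (s^-1 * y) * (s^-1 * 1)).
    have ps : normal_peak s = s^-1 * k.
      have e0 : s ^+ 2 * (trigo.pi : R) *+ 2 = s ^+ 2 * ((trigo.pi : R) *+ 2) by ring.
      rewrite /normal_peak e0.
      by rewrite expr1n mul1r sqrtrM ?sqr_ge0// sqrtr_sqr gtr0_norm// invfM.
    rewrite gaussE normal_pdfE// /normal_fun subr0 ps.
    have -> : - y ^+ 2 / (s ^+ 2 *+ 2) = - (s^-1 * y * (s^-1 * y) / 2) by field.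
    by ring.
  rewrite e; have h1 := drv_ncdf (s^-1 * y) (oner_neq0 R).
  exact: (drvD (drv_ncdf y s1) (drvZ _ (drv_comp h1 (drvZ _ (drv_id y))))).
have Dc y : D x = D y by apply: is_derive_0_is_cst.
have cv : D y @[y --> -oo] --> (0 + - 1 * 0 : R).
  apply: cvgD; first exact: ncdf_cvg0.
  apply: cvgMl_tmp; apply: (@cvg_comp _ _ _ (fun y => s^-1 * y) Phi _ -oo%R); last exact: ncdf_cvg0.
  apply/cvgrNyPle => A; have := nbhs_ninfty_le (num_real (A * s)).
  by apply: filterS => y h; rewrite mulrC ler_pdivrMr.
have D0 : D x = 0.
  rewrite (_ : D = fun=> D x) in cv; last by apply/funext => y; rewrite -Dc.
  have c1 : D x @[_ --> (-oo%R : set_system R)] --> D x by exact: cvg_cst.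
  have := @cvg_unique _ (@Rhausdorff R) _ _ _ _ c1 cv.
  by move=> ->; ring.
by move: D0; rewrite /D mulN1r => /eqP; rewrite subr_eq0 => /eqP ->; rewrite mulrC.
Unshelve. all: by end_near. Qed.

End gaussian.

Section heat_flow.
Context {R : realType}.
Implicit Types (x y z v : R).
Local Notation k := (normal_peak (1 : R)).

Definition isqrt v : R := expR (- 2^-1 * ln v).

(** Convolution of the indicator of the negative half line with the centered
    normal law of variance v, a solution of the heat equation. *)
Definition heat v x : R := Phi (isqrt v * x).
Definition heat1 v x : R := isqrt v * gauss (isqrt v * x).
Definition heat2 v x : R := isqrt v ^+ 2 * - (isqrt v * x * gauss (isqrt v * x)).

Let k0 : 0 <= k. Proof. exact: normal_peak_ge0. Qed.

Lemma isqrt_gt0 v : 0 < isqrt v. Proof. exact: expR_gt0. Qed.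

Lemma isqrt2 v : 0 < v -> isqrt v ^+ 2 = v^-1.
Proof.
move=> v0; rewrite expr2 -expRD -mulrDl (_ : - 2^-1 + - 2^-1 = -1); last by field.
by rewrite mulN1r expRN lnK.
Qed.

Lemma isqrtE v : 0 < v -> isqrt v = (Num.sqrt v)^-1.
Proof.
move=> v0; have e : v = (isqrt v)^-1 ^+ 2 by rewrite exprVn isqrt2// invrK.
by rewrite [in RHS]e sqrtr_sqr gtr0_norm ?invrK// invr_gt0 isqrt_gt0.
Qed.

Let drv_isqrt v : 0 < v -> is_derive v 1 isqrt (- 2^-1 * isqrt v ^+ 3).
Proof.
move=> v0; have h := drv_comp (is_derive_expR _) (drvZ (- 2^-1) (is_derive1_ln v0)).
by apply: (is_derive_eq h); rewrite exprS isqrt2//; rewrite /isqrt; ring.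
Qed.

Let pz z := z * gauss z.
Let dpz z := z * - (z * gauss z) + gauss z * 1.
Let drv_pz z : is_derive z 1 pz (dpz z).
Proof. exact: drvM (drv_id z) (drv_gauss z). Qed.

Let dpz_le z : `|dpz z| <= 3 * k.
Proof.
have h1 := gauss2_le z; have h2 := gauss_le z; have h3 := gauss_ge0 z.
have h4 : 0 <= z ^+ 2 * gauss z by rewrite mulr_ge0// sqr_ge0.
rewrite /dpz mulr1 mulrN mulrA -expr2 ler_norml; apply/andP; split; lra.
Qed.

Let zdpz_le z : `|z * dpz z| <= 21 * k.
Proof.
rewrite (_ : z * dpz z = z * gauss z - z ^+ 3 * gauss z); last by rewrite /dpz; ring.
apply: (le_trans (ler_normB _ _)); have := gauss1_le z; have := gauss3_le z; lra.
Qed.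

Let drv_lin r x : is_derive x 1 (fun y : R => r * y) (r * 1).
Proof. exact: drvZ (drv_id x). Qed.

Lemma drv_heat v x : is_derive x 1 (heat v) (heat1 v x).
Proof.
have h := drv_comp (drv_ncdf (isqrt v * x) (oner_neq0 R)) (drv_lin (isqrt v) x).
by apply: (is_derive_eq h); rewrite mulr1 mulrC.
Qed.

Lemma drv_heat1 v x : is_derive x 1 (heat1 v) (heat2 v x).
Proof.
have h := drvZ (isqrt v) (drv_comp (drv_gauss (isqrt v * x)) (drv_lin (isqrt v) x)).
by apply: (is_derive_eq h); rewrite /heat2; ring.
Qed.

Let drv_heat2 v x : is_derive x 1 (heat2 v) (- isqrt v ^+ 3 * dpz (isqrt v * x)).
Proof.
have h := drvZ (- isqrt v ^+ 2) (drv_comp (drv_pz (isqrt v * x)) (drv_lin (isqrt v) x)).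
have e : (fun y => - isqrt v ^+ 2 * pz (isqrt v * y)) = heat2 v.
  by apply/funext => y; rewrite /heat2 /pz; ring.
by rewrite -e; apply: (is_derive_eq h); ring.
Qed.

Let drv_heat_v x v : 0 < v -> is_derive v 1 (heat ^~ x) (2^-1 * heat2 v x).
Proof.
move=> v0; have hr := drvM (drv_isqrt v0) (drv_cst x v).
have h := drv_comp (g := fun u => isqrt u * x) (drv_ncdf (isqrt v * x) (oner_neq0 R)) hr.
by apply: (is_derive_eq h); rewrite -/(gauss _) /heat2; ring.
Qed.

Let drv_heat2_v x v : 0 < v -> is_derive v 1 (fun u => 2^-1 * heat2 u x)
  (isqrt v ^+ 4 * (4^-1 * (isqrt v * x * dpz (isqrt v * x)) + 2^-1 * (isqrt v * x * gauss (isqrt v * x)))).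
Proof.
move=> v0; have dr := drv_isqrt v0; have hr := drvM dr (drv_cst x v).
have h := drvZ (- 2^-1) (drvM (drvM dr dr) (drv_comp (g := fun u => isqrt u * x) (drv_pz (isqrt v * x)) hr)).
have e : (fun u => - 2^-1 * (isqrt u * isqrt u * pz (isqrt u * x))) = (fun u => 2^-1 * heat2 u x).
  by apply/funext => u; rewrite /heat2 /pz; ring.
by rewrite -e; apply: (is_derive_eq h); rewrite /pz; field.
Qed.

(** On variances bounded below, the derivatives entering the expansions of the
    heat flow are bounded and Lipschitz. *)
Lemma heat_bounds v0 : 0 < v0 -> exists2 B, 0 <= B & forall v, v0 <= v ->
  [/\ (forall x, `|heat1 v x| <= B) /\ (forall x y, `|heat1 v x - heat1 v y| <= B * `|x - y|),
      (forall x, `|heat2 v x| <= B) /\ (forall x y, `|heat2 v x - heat2 v y| <= B * `|x - y|),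
      forall x y, `|heat v y - heat v x - (y - x) * heat1 v x - (y - x) ^+ 2 / 2 * heat2 v x|
        <= 2 * B * (y - x) ^+ 2 * Num.min 1 `|y - x| &
      forall t x, 0 <= t -> `|heat (v + t) x - heat v x - t * (2^-1 * heat2 v x)| <= B * t ^+ 2].
Proof.
move=> v00; pose r := isqrt v0; have r0 : 0 < r := isqrt_gt0 v0.
pose s := 1 + r; have s1 : 1 <= s by rewrite lerDl ltW.
have s0 : 0 <= s by exact: le_trans s1.
exists (7 * k * s ^+ 4) => [|v vv]; first by rewrite !mulr_ge0// exprn_ge0.
have rs u i : v0 <= u -> (i <= 4)%N -> 0 <= isqrt u ^+ i <= s ^+ 4.
  move=> hu hi; have ru : isqrt u <= s.
    apply: (@le_trans _ _ r); last by rewrite lerDr.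
    by rewrite ler_expR !mulNr lerN2 ler_pM2l ?invr_gt0// ler_ln// posrE (lt_le_trans v00).
  have u0 := ltW (isqrt_gt0 u); rewrite exprn_ge0//=.
  by apply: (@le_trans _ _ (s ^+ i)); [exact: lerXn2r|exact: ler_weXn2l].
have bd u i c y : v0 <= u -> (i <= 4)%N -> c <= 7 -> `|y| <= c * k -> `|isqrt u ^+ i * y| <= 7 * k * s ^+ 4.
  move=> hu hi hc hy; have /andP[a1 a2] := rs u i hu hi.
  rewrite normrM (ger0_norm a1) mulrC; apply: ler_pM => //.
  by apply: (le_trans hy); rewrite ler_wpM2r.
have b1 x : `|heat1 v x| <= 7 * k * s ^+ 4.
  apply: (bd v 1%N 1) => //; first by rewrite ler1n.
  by rewrite mul1r ger0_norm ?gauss_ge0// gauss_le.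
have b2 x : `|heat2 v x| <= 7 * k * s ^+ 4.
  by apply: (bd v 2%N 3) => //; rewrite ?ler_nat// normrN gauss1_le.
have b3 x : `|- isqrt v ^+ 3 * dpz (isqrt v * x)| <= 7 * k * s ^+ 4.
  rewrite mulNr normrN; apply: (bd v 3%N 3) => //; rewrite ?ler_nat//; exact: dpz_le.
split.
- by split => //; exact: lip_of_drv (drv_heat1 v) b2.
- by split => //; exact: lip_of_drv (drv_heat2 v) b3.
- move=> x y; apply: (taylor2 x y (drv_heat v) (drv_heat1 v) b2).
  exact: lip_of_drv (drv_heat2 v) b3.
- move=> t x t0; have vt : v <= v + t by rewrite lerDl.
  have pos u : v <= u <= v + t -> 0 < u by case/andP => u1 _; exact: lt_le_trans v00 (le_trans vv u1).
  have := @taylor1 R (heat ^~ x) (fun u => 2^-1 * heat2 u x) _ (7 * k * s ^+ 4) v (v + t) vt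
    (fun u hu => drv_heat_v x (pos u hu)) (fun u hu => drv_heat2_v x (pos u hu)).
  have -> : v + t - v = t by ring.
  apply => u /andP[u1 _]; have vu := le_trans vv u1.
  apply: (bd u 4%N 7) => //.
  have h1 := zdpz_le (isqrt u * x); have h2 := gauss1_le (isqrt u * x).
  move: (isqrt u * x * dpz _) (isqrt u * x * gauss _) h1 h2 => A C.
  move: k k0 => K K0; rewrite !ler_norml => /andP[h1 h2] /andP[h3 h4].
  by apply/andP; split; lra.
Qed.

Lemma heat01 v x : 0 <= heat v x <= 1. Proof. exact: ncdf01. Qed.

End heat_flow.

Section lindeberg.
Context {R : realType} {d : measure_display} {Omega : measurableType d}.
Variable P : probability Omega R.
Implicit Types (a b h T v : R) (F : R -> R).
Variables (Z : R -> Omega -> R) (D : R -> R -> Omega -> R) (s2 : R).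
Hypothesis s20 : 0 <= s2.
Hypothesis Z0 : forall w, Z 0 w = 0.
Hypothesis mZ : forall a, 0 <= a -> measurable_fun setT (Z a).
Hypothesis ZD : forall a b, 0 <= a -> a <= b -> {ae P, forall w, Z b w = Z a w + D a b w}.
Hypothesis iD : forall a b, 0 <= a -> a <= b -> L1 P (D a b) /\ L1 P (fun w => D a b w ^+ 2).
Hypothesis centered : forall a b F l M, 0 <= a -> a <= b ->
  (forall x y, `|F x - F y| <= l * `|x - y|) -> (forall x, `|F x| <= M) ->
  Ex P (fun w => F (Z a w) * D a b w) = 0.
Hypothesis variance : forall e, 0 < e -> exists2 C, 0 <= C & forall a b F l M, 0 <= a -> a <= b ->
  (forall x y, `|F x - F y| <= l * `|x - y|) -> (forall x, `|F x| <= M) ->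
  `|Ex P (fun w => F (Z a w) * D a b w ^+ 2) - s2 * (b - a) * Ex P (fun w => F (Z a w))| <=
  M * (C + e * (b - a)).
Hypothesis tails : forall m e, 0 < e -> exists2 K, 0 <= K & forall a b, 0 <= a -> a <= b <= a + m ->
  L1 P (fun w => Num.max 0 (`|D a b w| - K) ^+ 2) /\
  Ex P (fun w => Num.max 0 (`|D a b w| - K) ^+ 2) <= e.

Let lipR_meas' F l (f : Omega -> R) : (forall x y, `|F x - F y| <= l * `|x - y|) ->
  measurable_fun setT f -> measurable_fun setT (fun w => F (f w)).
Proof.
move=> hF mf; apply: (measurableT_comp (f := F)) => //.
apply: continuous_measurable_fun => x; apply/(@cvgrPdist_le _ R) => e e0.
have l10 : 0 < `|l| + 1 by rewrite ltr_pwDr.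
near=> y; rewrite (le_trans (hF x y))//.
apply: le_trans (_ : (`|l| + 1) * `|x - y| <= _).
  by rewrite ler_wpM2r// (le_trans (ler_norm l))// lerDl.
rewrite mulrC -ler_pdivlMr//; near: y.
by apply: cvgr_dist_le; [exact: cvg_id|rewrite divr_gt0].
Unshelve. all: by end_near. Qed.

Variables (xi v0 : R).
Hypothesis v00 : 0 < v0.

Let regroup (hy hvt hx h1 h2 y q T t : R) :
  hy - hvt - (- q^-1 * (h1 * y) + 2^-1 * T^-1 * (h2 * y ^+ 2) - 2^-1 * t * h2) =
  hy - hx - - (y / q) * h1 - T^-1 * y ^+ 2 / 2 * h2 - (hvt - hx - t * (2^-1 * h2)).
Proof. by ring. Qed.

Let A T v a := Ex P (fun w => heat v (xi - Z a w / Num.sqrt T)).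

(** The elementary remainder: for increments of square integrable size the
    factor min(1, |y|) is small outside a set controlled by the tails. *)
Let remainder (q K x : R) : 0 < q -> 0 <= K ->
  (x / q) ^+ 2 * Num.min 1 `|x / q| <= (q ^+ 2)^-1 * (2 * K / q * x ^+ 2 + 4 * Num.max 0 (`|x| - K) ^+ 2).
Proof.
move=> q0 K0; rewrite exprMn exprVn mulrAC mulrC; apply: ler_wpM2l.
  by rewrite invr_ge0 sqr_ge0.
have m0 : 0 <= Num.max 0 (`|x| - K) by rewrite le_max lexx.
have [xK|xK] := leP `|x| (2 * K).
  apply: le_trans (_ : 2 * K / q * x ^+ 2 <= _); last by rewrite lerDl mulr_ge0 ?sqr_ge0.
  rewrite mulrC ler_wpM2r ?sqr_ge0// ge_min; apply/orP; right.
  by rewrite normrM normfV (gtr0_norm q0) ler_wpM2r// invr_ge0 ltW.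
apply: le_trans (_ : 4 * Num.max 0 (`|x| - K) ^+ 2 <= _); last first.
  by rewrite lerDr mulr_ge0 ?sqr_ge0// divr_ge0 ?mulr_ge0// ltW.
apply: le_trans (_ : x ^+ 2 <= _).
  by rewrite ler_piMr ?sqr_ge0// ge_min lexx.
rewrite max_r; last by lra.
by rewrite -(real_normK (num_real x)); move: (`|x|) xK => y xK; nra.
Qed.

(** One step of the exchange of an increment of the martingale for a Gaussian
    one of variance s2 h / T. *)
Let step B C e K e2 T v a h : 0 <= B -> 0 < T -> 0 <= a -> 0 <= h -> 0 <= C -> 0 < e -> v0 <= v -> 0 <= K ->
  (forall v, v0 <= v ->
  [/\ (forall x, `|heat1 v x| <= B) /\ (forall x y, `|heat1 v x - heat1 v y| <= B * `|x - y|),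
      (forall x, `|heat2 v x| <= B) /\ (forall x y, `|heat2 v x - heat2 v y| <= B * `|x - y|),
      forall x y, `|heat v y - heat v x - (y - x) * heat1 v x - (y - x) ^+ 2 / 2 * heat2 v x|
        <= 2 * B * (y - x) ^+ 2 * Num.min 1 `|y - x| &
      forall t x, 0 <= t -> `|heat (v + t) x - heat v x - t * (2^-1 * heat2 v x)| <= B * t ^+ 2]) ->
  (forall F l M, (forall x y, `|F x - F y| <= l * `|x - y|) -> (forall x, `|F x| <= M) ->
    `|Ex P (fun w => F (Z a w) * D a (a + h) w ^+ 2) - s2 * h * Ex P (fun w => F (Z a w))| <=
    M * (C + e * h)) ->
  L1 P (fun w => Num.max 0 (`|D a (a + h) w| - K) ^+ 2) ->
  Ex P (fun w => Num.max 0 (`|D a (a + h) w| - K) ^+ 2) <= e2 ->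
  `|A T v (a + h) - A T (v + s2 * h / T) a| <=
  T^-1 * (2 * B * (2 * K / Num.sqrt T * (s2 * h + (C + e * h)) + 4 * e2)
          + B * s2 ^+ 2 * h ^+ 2 / T + B / 2 * (C + e * h)).
Proof.
move=> B0 T0 a0 hh C0 e0 vv K0 HB hV iN hN.
have ah : a <= a + h by rewrite lerDl.
have [[b1 l1] [b2 l2] ty hv] := HB v vv.
have q0 : 0 < Num.sqrt T by rewrite sqrtr_gt0.
set q := Num.sqrt T in q0 *.
have q2 : q ^+ 2 = T by rewrite sqr_sqrtr// ltW.
pose t := s2 * h / T; have t0 : 0 <= t by rewrite divr_ge0 ?mulr_ge0// ltW.
have vt : v0 <= v + t by rewrite (le_trans vv)// lerDl.
have [i1 i2] := iD a0 ah.
have qi : `|q^-1| = q^-1 by rewrite gtr0_norm ?invr_gt0.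
have sc F l : (forall x y, `|F x - F y| <= l * `|x - y|) ->
    forall x y : R, `|F (xi - x / q) - F (xi - y / q)| <= l / q * `|x - y|.
  move=> hl x y; apply: (le_trans (hl _ _)).
  have -> : xi - x / q - (xi - y / q) = (y - x) * q^-1 by ring.
  by rewrite normrM qi distrC mulrCA mulrC mulrAC.
pose F1 x := heat1 v (xi - x / q); pose F2 x := heat2 v (xi - x / q).
have l1' : forall x y, `|F1 x - F1 y| <= B / q * `|x - y| by exact: sc.
have l2' : forall x y, `|F2 x - F2 y| <= B / q * `|x - y| by exact: sc.
have mF1 := lipR_meas' l1' (mZ a0); have mF2 := lipR_meas' l2' (mZ a0).
have hl u : v0 <= u -> forall x y, `|heat u (xi - x / q) - heat u (xi - y / q)| <= B / q * `|x - y|.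
  move=> hu; have [[c1 _] _ _ _] := HB u hu; apply: sc.
  by apply: lip_of_drv c1; exact: drv_heat.
have hb u x : `|heat u x| <= 1 by have /andP[? ?] := heat01 u x; rewrite ger0_norm.
have iH u b : v0 <= u -> 0 <= b -> L1 P (fun w => heat u (xi - Z b w / q)).
  by move=> hu b0; apply: (L1_bounded P (lipR_meas' (hl u hu) (mZ b0))) => w; exact: hb.
have j1 : L1 P (fun w => F1 (Z a w) * D a (a + h) w) := L1_mulbounded mF1 (fun w => b1 _) i1.
have j2 : L1 P (fun w => F2 (Z a w) * D a (a + h) w ^+ 2) := L1_mulbounded mF2 (fun w => b2 _) i2.
have j3 : L1 P (fun w => F2 (Z a w)) := L1_bounded P mF2 (fun w => b2 _).
have iQ := L1B (L1D (L1Z (- q^-1) j1) (L1Z (2^-1 * T^-1) j2)) (L1Z (2^-1 * t) j3).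
set Q := (fun w => _ - _) in iQ.
have EQ : `|Ex P Q| <= T^-1 * (B / 2 * (C + e * h)).
  rewrite (ExB (L1D (L1Z (- q^-1) j1) (L1Z (2^-1 * T^-1) j2)) (L1Z (2^-1 * t) j3)).
  rewrite (ExD (L1Z (- q^-1) j1) (L1Z (2^-1 * T^-1) j2)) (ExZ _ j1) (ExZ _ j2) (ExZ _ j3).
  rewrite (centered a0 ah l1' (fun x => b1 _)) mulr0 add0r.
  have := hV F2 _ _ l2' (fun x => b2 _).
  move: (Ex P (fun w => F2 (Z a w) * D a (a + h) w ^+ 2)) (Ex P (fun w => F2 (Z a w))) => u1 u2 hu.
  have -> : 2^-1 * T^-1 * u1 - 2^-1 * t * u2 = 2^-1 * T^-1 * (u1 - s2 * h * u2) by rewrite /t; ring.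
  rewrite normrM ger0_norm ?mulr_ge0 ?invr_ge0 ?(ltW T0)//.
  apply: le_trans (ler_wpM2l _ hu) _; first by rewrite mulr_ge0 ?invr_ge0 ?(ltW T0).
  by rewrite le_eqVlt; apply/orP; left; apply/eqP; ring.
have ED2 : Ex P (fun w => D a (a + h) w ^+ 2) <= s2 * h + (C + e * h).
  have := hV (fun=> 1) 0 1; rewrite (Ex_cst P) => /(_ _ _)-H.
  have {}H : `|Ex P (fun w => 1 * D a (a + h) w ^+ 2) - s2 * h * 1| <= 1 * (C + e * h).
    by apply: H => [x y|x]; rewrite ?subrr ?mul0r ?normr0// normr1.
  have e1 : Ex P (fun w => 1 * D a (a + h) w ^+ 2) = Ex P (fun w => D a (a + h) w ^+ 2).
    by apply: eq_Ex => w; rewrite mul1r.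
  by move: H; rewrite e1 mulr1 mul1r => /(le_trans (ler_norm _)); rewrite lerBlDl.
pose Bd w := T^-1 * (2 * B * (2 * K / q * D a (a + h) w ^+ 2 + 4 * Num.max 0 (`|D a (a + h) w| - K) ^+ 2)) + B * t ^+ 2.
have iB0 := L1D (L1Z (2 * K / q) i2) (L1Z 4 iN).
have iBd : L1 P Bd by exact: (L1D (L1Z _ (L1Z _ iB0)) (L1_cst P _)).
have EBd : Ex P Bd <= T^-1 * (2 * B * (2 * K / q * (s2 * h + (C + e * h)) + 4 * e2)) + B * t ^+ 2.
  rewrite (ExD (L1Z _ (L1Z _ iB0)) (L1_cst P _)) (Ex_cst P) (ExZ _ (L1Z _ iB0)) (ExZ _ iB0).
  rewrite (ExD (L1Z (2 * K / q) i2) (L1Z 4 iN)) (ExZ _ i2) (ExZ _ iN) lerD2r.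
  rewrite ler_pM2l ?invr_gt0//; apply: ler_wpM2l; first by rewrite mulr_ge0.
  apply: lerD; last by rewrite ler_pM2l.
  by apply: ler_wpM2l => //; rewrite divr_ge0 ?mulr_ge0// ltW.
have iA1 := iH v (a + h) vv (addr_ge0 a0 hh); have iA2 := iH (v + t) a vt a0.
rewrite /A -/q -/t -(ExB iA1 iA2).
have iX := L1B iA1 iA2.
have main : Ex P (fun w => `|heat v (xi - Z (a + h) w / q) - heat (v + t) (xi - Z a w / q) - Q w|) <= Ex P Bd.
  apply: Ex_le_ae; [exact: L1_norm (L1B iX iQ)|exact: iBd|].
  apply: filterS (ZD a0 ah) => w ->.
  set z := Z a w; set D0 := D a (a + h) w.
  pose x := xi - z / q; pose y := xi - (z + D0) / q.
  have yx : y - x = - (D0 / q) by rewrite /x /y; ring.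
  have t1 := ty x y; have t2 := hv t x t0.
  rewrite -/x -/y (_ : heat v y - heat (v + t) x - Q w = (heat v y - heat v x - (y - x) * heat1 v x - (y - x) ^+ 2 / 2 * heat2 v x)
     - (heat (v + t) x - heat v x - t * (2^-1 * heat2 v x))); last first.
    have e3 : (y - x) ^+ 2 = T^-1 * D0 ^+ 2 by rewrite yx sqrrN exprMn exprVn q2 mulrC.
    have eQ : Q w = - q^-1 * (heat1 v x * D0) + 2^-1 * T^-1 * (heat2 v x * D0 ^+ 2) - 2^-1 * t * heat2 v x.
      by [].
    rewrite e3 yx eQ; exact: regroup.
  apply: (le_trans (ler_normB _ _)); apply: lerD => //; apply: (le_trans t1).
  rewrite yx sqrrN normrN.
  rewrite -(mulrA (2 * B) ((D0 / q) ^+ 2)).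
  apply: le_trans (_ : 2 * B * (T^-1 * (2 * K / q * D0 ^+ 2 + 4 * Num.max 0 (`|D0| - K) ^+ 2)) <= _); last first.
    by rewrite (mulrCA (2 * B)).
  by apply: ler_wpM2l; [rewrite mulr_ge0|rewrite -q2; exact: remainder].
apply: le_trans (_ : Ex P (fun w => `|heat v (xi - Z (a + h) w / q) - heat (v + t) (xi - Z a w / q) - Q w|) + `|Ex P Q| <= _).
  rewrite -[X in `|X| <= _](subrK (Ex P Q)) -(ExB iX iQ).
  by apply: (le_trans (ler_normD _ _)); rewrite lerD2r; exact: Ex_normr (L1B iX iQ).
apply: (le_trans (lerD (le_trans main EBd) EQ)).
rewrite le_eqVlt; apply/orP; left; apply/eqP; rewrite /t; field; rewrite !gt_eqF//.
Qed.

(** The smoothed distribution functions converge to the Gaussian ones: cut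
    [0, T] into blocks of a large fixed size, and exchange the increments. *)
Lemma lindeberg e : 0 < e -> exists T0, forall T, T0 <= T -> 0 < T ->
  `|A T v0 T - heat (v0 + s2) xi| <= e.
Proof.
move=> e0; have [B B0 HB] := heat_bounds v00.
have e50 : 0 < e / 5 by rewrite divr_gt0.
have B1 : 0 < B + 1 by rewrite ltr_wpDl.
have [C C0 hC] := variance (divr_gt0 e50 B1).
set ev := e / 5 / (B + 1) in hC; have ev0 : 0 < ev by rewrite divr_gt0.
pose m := Num.max 1 (B * C / (e / 5)).
have m1 : 1 <= m by rewrite le_max lexx.
have m0 : 0 < m by exact: lt_le_trans ltr01 m1.
have mB : B * C <= e / 5 * m by rewrite (mulrC (e / 5)) -ler_pdivrMr// /m le_max lexx orbT.
have e20 : 0 < e / 5 / (8 * (B + 1)) by rewrite divr_gt0// mulr_gt0.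
have [K K0 hK] := tails (2 * m) e20.
set e2 := e / 5 / (8 * (B + 1)) in hK e20.
pose c1 := 4 * B * K * (s2 + (C + ev)); pose c2 := B * s2 ^+ 2 * (2 * m).
have c10 : 0 <= c1 by rewrite !mulr_ge0// !addr_ge0// ltW.
exists (Num.max m (Num.max ((c1 / (e / 5)) ^+ 2) (c2 / (e / 5)))) => T.
rewrite ge_max => /andP[Tm]; rewrite ge_max => /andP[Tc1 Tc2] T0.
pose N := Num.truncn (T / m).
have N1 : (0 < N)%N by rewrite /N truncn_gt0 ler_pdivlMr// mul1r.
have N0 : 0 < N%:R :> R by rewrite ltr0n.
have /andP[Nl Nu] := truncn_itv (divr_ge0 (ltW T0) (ltW m0)); rewrite -/N in Nl Nu.
pose h := T / N%:R; have h0 : 0 < h by rewrite divr_gt0.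
have hm : m <= h by rewrite ler_pdivlMr// mulrC -ler_pdivlMr.
have h2m : h <= 2 * m.
  rewrite ler_pdivrMr// mulrAC; move: Nu; rewrite ltr_pdivrMr// => Nu; apply: (le_trans (ltW Nu)).
  by rewrite ler_wpM2r ?(ltW m0)// mulrC -natrM ler_nat mulnC mul2n -addnn -addn1 leq_add2l.
have NhT : N%:R * h = T by rewrite /h mulrC divfK// gt_eqF.
have hh : h <= T by rewrite -NhT ler_peMl ?ler1n// ltW.
have h1 : 1 <= h by exact: le_trans m1 hm.
pose vk (j : nat) := v0 + s2 * (1 - j%:R / N%:R).
have vkv j : (j <= N)%N -> v0 <= vk j.
  by move=> jN; rewrite lerDl mulr_ge0// subr_ge0 ler_pdivrMr// mul1r ler_nat.
pose dl := h / T * e.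
have q0 : 0 < Num.sqrt T by rewrite sqrtr_gt0.
have stepj j : (j < N)%N -> `|A T (vk j.+1) (j.+1%:R * h) - A T (vk j) (j%:R * h)| <= dl.
  move=> jN; have a0 : 0 <= j%:R * h by rewrite mulr_ge0// ltW.
  have ej : j.+1%:R * h = j%:R * h + h by rewrite -natr1 mulrDl mul1r.
  have ev_ : vk j = vk j.+1 + s2 * h / T.
    by rewrite /vk -natr1 /h; field; rewrite !gt_eqF.
  have hab : j%:R * h <= j%:R * h + h <= j%:R * h + 2 * m by rewrite lerDl (ltW h0) lerD2l.
  have [iN hN] := hK _ _ a0 hab.
  have hV F l M : (forall x y, `|F x - F y| <= l * `|x - y|) -> (forall x, `|F x| <= M) ->
     `|Ex P (fun w => F (Z (j%:R * h) w) * D (j%:R * h) (j%:R * h + h) w ^+ 2) - s2 * h * Ex P (fun w => F (Z (j%:R * h) w))| <= M * (C + ev * h).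
    move=> f1 f2; have /andP[hab1 _] := hab; have := hC _ _ F l M a0 hab1 f1 f2.
    by have -> : j%:R * h + h - j%:R * h = h by ring.
  rewrite ej ev_; apply: le_trans (step B0 T0 a0 (ltW h0) C0 ev0 (vkv _ jN) K0 HB hV iN hN) _.
  rewrite /dl (_ : h / T * e = T^-1 * (h * e)); last by ring.
  apply: ler_wpM2l; first by rewrite invr_ge0 ltW.
  have p1 : 2 * B * (2 * K / Num.sqrt T * (s2 * h + (C + ev * h))) <= h * (e / 5).
    apply: le_trans (_ : h * (c1 / Num.sqrt T) <= _).
      rewrite (_ : h * (c1 / Num.sqrt T) = 2 * B * (2 * K / Num.sqrt T * (s2 * h + (C * h + ev * h)))); last by rewrite /c1; ring.
      apply: ler_wpM2l; first by rewrite mulr_ge0.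
      apply: ler_wpM2l; first by rewrite divr_ge0 ?mulr_ge0// ltW.
      by rewrite lerD2l lerD2r ler_peMr.
    rewrite ler_pM2l// ler_pdivrMr// mulrC -ler_pdivrMr//.
    have c3 : 0 <= c1 / (e / 5) by rewrite divr_ge0// ltW.
    by rewrite -(ger0_norm c3) -sqrtr_sqr ler_sqrt// ltW.
  have p2 : 2 * B * (4 * e2) <= h * (e / 5).
    apply: le_trans (_ : e / 5 <= _); last by rewrite ler_peMl// ltW.
    rewrite /e2 (_ : 2 * B * _ = B / (B + 1) * (e / 5)); last by field; rewrite gt_eqF.
    by rewrite ler_piMl ?(ltW e50)// ler_pdivrMr// mul1r lerDl.
  have p3 : B * s2 ^+ 2 * h ^+ 2 / T <= h * (e / 5).
    rewrite ler_pdivrMr// (_ : B * s2 ^+ 2 * h ^+ 2 = h * (B * s2 ^+ 2 * h)); last by ring.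
    rewrite -(mulrA h (e / 5) T) ler_pM2l//; apply: le_trans (_ : c2 <= _).
      by rewrite /c2 ler_wpM2l// mulr_ge0// sqr_ge0.
    by move: Tc2; rewrite ler_pdivrMr// mulrC.
  have p4 : B / 2 * (C + ev * h) <= h * (e / 5).
    have k1 : B * C <= h * (e / 5) by apply: (le_trans mB); rewrite mulrC ler_wpM2r ?(ltW e50).
    have k2 : B * (ev * h) <= h * (e / 5).
      rewrite mulrA mulrC ler_pM2l// /ev mulrCA ler_piMr ?(ltW e50)//.
      by rewrite ler_pdivrMr// mul1r lerDl.
    by rewrite (_ : B / 2 * _ = 2^-1 * (B * C + B * (ev * h))); [lra|ring].
  have he0 : 0 <= h * (e / 5) by rewrite mulr_ge0 ?(ltW h0) ?(ltW e50).
  have -> : h * e = 5 * (h * (e / 5)) by field.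
  rewrite mulrDr; lra.
have tele j : (j <= N)%N -> `|A T (vk j) (j%:R * h) - A T (vk 0) (0%:R * h)| <= j%:R * dl.
  elim: j => [_|j IH jN]; first by rewrite subrr normr0 mul0r.
  have e1 : j.+1%:R * dl = dl + j%:R * dl by rewrite -natr1 mulrDl mul1r addrC.
  rewrite e1; apply: le_trans (lerD (stepj j jN) (IH (ltnW jN))).
  exact: ler_distD.
have := tele N (leqnn N); rewrite NhT.
have -> : vk N = v0 by rewrite /vk divff ?gt_eqF// subrr mulr0 addr0.
have -> : vk 0%N = v0 + s2 by rewrite /vk mul0r subr0 mulr1.
have -> : A T (v0 + s2) (0%:R * h) = heat (v0 + s2) xi.
  rewrite mul0r /A -[RHS](Ex_cst P); apply: eq_Ex => w.
  by rewrite Z0 mul0r subr0.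
by rewrite /dl (_ : N%:R * (h / T * e) = e)// -NhT; field; rewrite !gt_eqF.
Qed.

End lindeberg.

(** * Moments *)

Section moments.
Context {R : realType} {E : polishMetricType R}.
Context {d : measure_display} {Omega : measurableType d}.
Variables (P : probability Omega R) (Pt : R -> R.-pker (borel E) ~> (borel E)).
Variables (mu0 : probability (borel E) R) (X : R -> {RV P >-> borel E}).
Hypothesis XM : markov_process X Pt mu0.
Hypothesis mu0_P1 : finite_first_moment mu0.
Hypothesis sg : transition_semigroup Pt.
Hypothesis h0 : H0 Pt.
Variables (c gam : R).
Hypotheses (c0 : 0 < c) (gam0 : 0 < gam).
Hypothesis P1_stable : forall (t : R) (mu : probability (borel E) R), 0 <= t ->
  finite_first_moment mu -> finite_first_moment (kernel_push mu (Pt t)).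
Hypothesis contr : forall (t : R) (mu nu : probability (borel E) R), 0 <= t ->
  finite_first_moment mu -> finite_first_moment nu ->
  (wasserstein (kernel_push mu (Pt t)) (kernel_push nu (Pt t)) <=
   (c * expR (- gam * t))%:E * wasserstein mu nu)%E.
Variable mu : probability (borel E) R.
Hypothesis mu_inv : invariant_law Pt mu.
Hypothesis mu_P1 : finite_first_moment mu.
Variable o : E.
Local Notation TR := (measurableTypeR R).
Local Notation Pf t f := (kernel_op (Pt t) f).
Local Notation kap := (kappa c gam).
Local Notation V := (weight mu o).
Local Notation Y := (proc X).
Local Notation past := (past X).
Implicit Types (a b s t : R) (f : E -> R).
Local Notation U := (growth mu o).

(** Moments of order greater than two give uniformly integrable squares. *)
Lemma moments_ui delta : 0 < delta -> H3 X delta -> forall e, 0 < e ->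
  exists2 K, 0 <= K & forall s, L1 P (fun w => Num.max 0 (U (Y s w) - K) ^+ 2) /\
    Ex P (fun w => Num.max 0 (U (Y s w) - K) ^+ 2) <= e.
Proof.
move=> d0 [x0 hsup] e e0.
pose r (s : R) (w : Omega) : R := mdist (Y s w : E) x0.
have r0 s w : 0 <= r s w by exact: mdist_ge0.
have mr s : measurable_fun setT (r s) := measurableT_comp (meas_dist x0) (meas_proc X s).
have [C hC] : exists C : R, forall s, L1 P (fun w => r s w `^ (2 + delta)) /\
    Ex P (fun w => r s w `^ (2 + delta)) <= C.
  pose S := ereal_sup [set ('E_P[fun w => (mdist (X t w : E) x0 `^ (2 + delta))%R])%E | t in `[0%R, +oo[].
  have hS s : (\int[P]_w (r s w `^ (2 + delta))%:E <= S)%E.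
    have -> : (\int[P]_w (r s w `^ (2 + delta))%:E = 'E_P[fun w => (mdist (X (pos_time s) w : E) x0 `^ (2 + delta))%R])%E.
      by rewrite unlock.
    by apply: ereal_sup_ubound; exists (pos_time s) => //=; rewrite in_itv/= andbT pos_time_ge0.
  exists (fine S) => s.
  have mrs : measurable_fun setT (fun w => r s w `^ (2 + delta)).
    exact: (measurableT_comp (measurable_powR _) (mr s)).
  have i1 : L1 P (fun w => r s w `^ (2 + delta)).
    apply: L1_ge0 => //; first by move=> w; exact: powR_ge0.
    exact: le_lt_trans (hS s) hsup.
  split => //; rewrite -lee_fin -(ExE i1) fineK; first exact: hS.
  rewrite ge0_fin_numE//; apply: le_trans (hS s); apply: integral_ge0 => w _.
  by rewrite lee_fin powR_ge0.
pose C1 := `|C| + 1; have C10 : 0 < C1 by rewrite ltr_wpDl.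
pose K1 := Num.max 1 ((C1 / e) `^ delta^-1).
have K11 : 1 <= K1 by rewrite le_max lexx.
have K10 : 0 < K1 by exact: lt_le_trans K11.
have Kd : C1 / e <= K1 `^ delta.
  have -> : C1 / e = ((C1 / e) `^ delta^-1) `^ delta.
    by rewrite -powRrM mulVf ?gt_eqF// powRr1// divr_ge0 ?(ltW C10)// ltW.
  apply: ge0_ler_powR; rewrite ?nnegrE ?powR_ge0 ?(ltW d0) ?(ltW K10)//.
  by rewrite le_max lexx orbT.
pose M := 1 + mdist x0 o + Ex mu (dist_to o).
have M0 : 0 <= M.
  by rewrite !addr_ge0 ?mdist_ge0//; apply: Ex_ge0 => x; exact: dist_ge0.
exists (K1 + M) => [|s]; first by rewrite addr_ge0// ltW.
have [i1 b1] := hC s.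
have hb w : `|Num.max 0 (U (Y s w) - (K1 + M)) ^+ 2| <= e / C1 * r s w `^ (2 + delta).
  rewrite ger0_norm ?sqr_ge0//.
  have hU : U (Y s w) <= r s w + M.
    rewrite /growth /weight /M /r /dist_to.
    have := lip_mdist o (Y s w : E) x0; rewrite mul1r => /(le_trans (ler_norm _)).
    by rewrite lerBlDr; lra.
  have pr : 0 <= e / C1 * r s w `^ (2 + delta) by rewrite mulr_ge0 ?powR_ge0// divr_ge0// ltW.
  case: (leP 0 (U (Y s w) - (K1 + M))) => hm; last by rewrite expr2 mul0r.
  have hr : K1 <= r s w by lra.
  have rp : 0 < r s w by exact: lt_le_trans K10 hr.
  apply: le_trans (_ : r s w ^+ 2 <= _).
    by rewrite ler_pXn2r ?nnegrE//; lra.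
  rewrite powRD; last by apply/implyP => _; rewrite gt_eqF.
  rewrite powR_mulrn// mulrCA ler_peMr ?sqr_ge0//.
  have : C1 / e <= r s w `^ delta.
    by apply: (le_trans Kd); apply: ge0_ler_powR; rewrite ?nnegrE ?(ltW d0) ?(ltW K10)//.
  rewrite ler_pdivrMr// => h; rewrite mulrAC ler_pdivlMr// mul1r mulrC.
  by rewrite mulrC in h; rewrite mulrC.
have mU : measurable_fun setT (fun w => Num.max 0 (U (Y s w) - (K1 + M)) ^+ 2).
  apply: measurable_funX; apply: measurable_maxr => //; apply: measurable_funB => //.
  exact: (meas_f_proc X s (lip_growth1 mu o)).
split; first exact: (L1_dom mU hb (L1Z _ i1)).
apply: (le_trans (ler_norm _)); apply: (le_trans (Ex_dom mU hb (L1Z _ i1))).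
rewrite (ExZ _ i1) mulrAC ler_pdivrMr// ler_pM2l//.
by rewrite (le_trans b1)// (le_trans (ler_norm _))// lerDl.
Qed.

Hypothesis ui : forall e, 0 < e -> exists2 K, 0 <= K & forall s,
  L1 P (fun w => Num.max 0 (U (Y s w) - K) ^+ 2) /\
  Ex P (fun w => Num.max 0 (U (Y s w) - K) ^+ 2) <= e.
Variables (g : E -> R) (L : R).
Hypotheses (L0 : 0 <= L) (hg : lip L g) (g0 : Ex mu (g : borel E -> R) = 0).
Local Notation chi := (chi Pt g).
Local Notation D := (mart Pt X g).

Let bfield_proc' := bfield_proc XM mu0_P1 c0 gam0 P1_stable contr mu_inv mu_P1 o.
Let proc_L1' := proc_L1 XM mu0_P1 c0 P1_stable contr o.
Let hchi := lip_chi' sg h0 c0 gam0 P1_stable contr mu_inv mu_P1 o L0 hg g0.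
Let iD a b : 0 <= a -> a <= b -> L1 P (D a b).
Proof. by move=> a0 ab; have [] := ceq_mart XM mu0_P1 sg h0 c0 gam0 P1_stable contr mu_inv mu_P1 o L0 hg g0 a0 ab. Qed.

Lemma mart0 w : D 0 0 w = 0.
Proof.
rewrite /mart subrr addr0 /Sf /tint Ex_tmE ?set_itv1 ?Rintegral_set1//.
exact: (measurable_fun_pair2 (f := pfield X g) w (meas_pfield XM hg)).
Qed.

Let add_increments (x y p q r : R) : x + y + (r - p) = x + (q - p) + (y + (r - q)).
Proof. by ring. Qed.

Lemma mart_split a b : 0 <= a -> a <= b -> {ae P, forall w, D 0 b w = D 0 a w + D a b w}.
Proof.
move=> a0 ab; apply: filterS (tint_path 0 b (bfield_proc' hg)) => w iw.
rewrite /mart /Sf /tint (Ex_tm_split a0 ab iw); exact: add_increments.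
Qed.

Lemma approx_mart a : 0 <= a -> approx X a (D 0 a).
Proof.
move=> a0; have mc s : s <= a -> measurable_fun setT ((fun w => chi (Y s w)) : pastT X a -> R).
  move=> sa; have mp := meas_past_proc (X := X) sa a0.
  have h := measurableT_comp (lip_meas hchi : measurable_fun setT (chi : borel E -> R)) mp; exact: h.
have h1 := approx_Sf XM mu0_P1 h0 c0 gam0 P1_stable contr mu_inv mu_P1 o a0 hg.
have h2 : approx X a (fun w => chi (Y a w) - chi (Y 0 w)).
  apply: approx_meas; first by apply: measurable_funB; exact: mc.
  exact: L1B (proc_L1' a hchi) (proc_L1' 0 hchi).
exact: approxD h1 h2.
Qed.

Let collect (x p q r s t : R) : x * p + x * q * r + (x * s + x * q + (x * t + x * q)) =
  x * (p + (s + t)) + x * q * (r + 2).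
Proof. by ring. Qed.

Let sq3 (x y z : R) : (x + (y + z)) ^+ 2 <= 3 * (x ^+ 2 + (y ^+ 2 + z ^+ 2)).
Proof. have := sqr_ge0 (x - y); have := sqr_ge0 (x - z); have := sqr_ge0 (y - z); nra. Qed.

(** Over bounded time spans the squares of the increments are uniformly
    integrable. *)
Lemma mart_tails m e : 0 < e -> exists2 K, 0 <= K & forall a b, 0 <= a -> a <= b <= a + m ->
  L1 P (fun w => Num.max 0 (`|D a b w| - K) ^+ 2) /\
  Ex P (fun w => Num.max 0 (`|D a b w| - K) ^+ 2) <= e.
Proof.
move=> e0; have [A A0 hA] := common_growth sg h0 c0 gam0 P1_stable contr mu_inv mu_P1 o L0 hg g0.
have q0 : 0 < A ^+ 2 * (3 * (m ^+ 2 + 2)) + 1.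
  by rewrite ltr_wpDl// mulr_ge0 ?sqr_ge0// mulr_ge0// addr_ge0// sqr_ge0.
have [k k0 hk] := ui (divr_gt0 e0 q0).
set e' := e / _ in hk; have e'0 : 0 <= e' by rewrite divr_ge0 ?(ltW q0) ?(ltW e0).
pose n (x : E) : R := Num.max 0 (U x - k).
have hn : lip 1 n by apply: lip_pos; apply: lipBc; exact: lip_growth1.
have n0 x : 0 <= n x by rewrite le_max lexx.
have Un x : U x <= n x + k by rewrite -lerBlDr le_max lexx orbT.
have bn := bfield_proc' hn; have bg := bfield_proc' hg.
have bn2 : bfield P (fun z => pfield X n z ^+ 2).
  split; first by apply: measurable_funX; exact: bn.1.
  exists e' => s; have [i1 b1] := hk s; split => //.
  by apply: le_trans b1; apply: Ex_le => //; [exact: L1_norm|move=> w; rewrite ger0_norm ?sqr_ge0].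
exists (A * k * (`|m| + 2)) => [|a b a0 /andP[ab bm]]; first by rewrite !mulr_ge0// addr_ge0.
have hm : b - a <= `|m| by rewrite (le_trans _ (ler_norm m))//; lra.
have ba0 : 0 <= b - a by rewrite subr_ge0.
pose I w := tint a b (pfield X n) w.
have iI2 : L1 P (fun w => I w ^+ 2) := L1_sq_tint ab bn bn2.
have bI : Ex P (fun w => I w ^+ 2) <= (b - a) ^+ 2 * e' := Ex_sq_tint ab bn bn2 (fun s => (hk s).2).
have [ia ba] := hk a; have [ib bb] := hk b.
have iB := L1Z (A ^+ 2 * 3) (L1D iI2 (L1D ib ia)).
have mD := L1_meas (iD a0 ab).
have mM : measurable_fun setT (fun w => Num.max 0 (`|D a b w| - A * k * (`|m| + 2)) ^+ 2).
  apply: measurable_funX; apply: measurable_maxr => //; apply: measurable_funB => //.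
  exact: measurableT_comp.
have main : {ae P, forall w, `|Num.max 0 (`|D a b w| - A * k * (`|m| + 2)) ^+ 2| <=
    A ^+ 2 * 3 * (I w ^+ 2 + (n (Y b w) ^+ 2 + n (Y a w) ^+ 2))}.
  apply: filterS2 (tint_path a b bg) (tint_path a b bn) => w ig iN.
  have S1 : `|Sf X a b g w| <= A * I w + A * k * (b - a).
    have iNA : L1 (tm a b) (fun s => A * (pfield X n (w, s) + k)).
      by apply: L1Z; exact: (L1D iN (L1_cst (tm a b) k)).
    apply: le_trans (_ : Ex (tm a b) (fun s => A * (pfield X n (w, s) + k)) <= _).
      apply: Ex_dom => //; first exact: L1_meas ig.
      move=> s; have [h1 _] := hA (Y s w); apply: (le_trans h1).
      by rewrite ler_wpM2l//; exact: Un.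
    rewrite (ExZ _ (L1D iN (L1_cst (tm a b) k))) (ExD iN (L1_cst (tm a b) k)) (Ex_tm_cst _ ab).
    by rewrite mulrDr mulrA.
  have chb s : `|chi (Y s w)| <= A * n (Y s w) + A * k.
    have [_ h2] := hA (Y s w); apply: (le_trans h2).
    by rewrite -mulrDr ler_wpM2l//; exact: Un.
  have I0 : 0 <= I w by apply: Ex_ge0 => s; exact: n0.
  rewrite ger0_norm ?sqr_ge0// -(mulrA (A ^+ 2) 3).
  apply: le_trans (_ : (A * (I w + (n (Y b w) + n (Y a w)))) ^+ 2 <= _); last first.
    rewrite exprMn; apply: ler_wpM2l; [exact: sqr_ge0|exact: sq3].
  have rhs0 : 0 <= A * (I w + (n (Y b w) + n (Y a w))) by rewrite mulr_ge0// !addr_ge0.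
  rewrite ler_pXn2r ?nnegrE ?le_max ?lexx// ge_max rhs0/= lerBlDr.
  have Ak : A * k * (b - a) <= A * k * `|m| by rewrite ler_wpM2l// mulr_ge0.
  rewrite /mart; apply: (le_trans (ler_normD _ _)).
  have c1 := chb a; have c2 := chb b.
  apply: (le_trans (lerD S1 (le_trans (ler_normB _ _) (lerD c2 c1)))).
  apply: le_trans (_ : A * I w + A * k * `|m| + (A * n (Y b w) + A * k + (A * n (Y a w) + A * k)) <= _).
    by rewrite lerD2r lerD2l.
  by rewrite le_eqVlt; apply/orP; left; apply/eqP; exact: collect.
split; first exact: (L1_dom_ae mM main iB).
apply: le_trans (_ : Ex P (fun w => A ^+ 2 * 3 * (I w ^+ 2 + (n (Y b w) ^+ 2 + n (Y a w) ^+ 2))) <= _).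
  apply: Ex_le_ae => //; first exact: (L1_dom_ae mM main iB).
  by apply: filterS main => w; apply: le_trans; exact: ler_norm.
rewrite (ExZ _ (L1D iI2 (L1D ib ia))) (ExD iI2 (L1D ib ia)) (ExD ib ia).
have mm : (b - a) ^+ 2 <= m ^+ 2.
  by rewrite -(real_normK (num_real m)) ler_pXn2r ?nnegrE.
apply: le_trans (_ : A ^+ 2 * 3 * (m ^+ 2 * e' + (e' + e')) <= _).
  apply: ler_wpM2l; first by rewrite mulr_ge0 ?sqr_ge0.
  by apply: lerD; [apply: (le_trans bI); rewrite ler_wpM2r|exact: lerD].
rewrite (_ : _ * _ = (A ^+ 2 * (3 * (m ^+ 2 + 2))) * e'); last by ring.
rewrite /e' mulrA ler_pdivrMr// mulrC ler_pM2l//; last by rewrite lerDl.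
Qed.

End moments.

(** * From smoothed to exact distribution functions *)

Section distribution_functions.
Context {R : realType}.
Implicit Types (x y e v : R).

Lemma cvg_pinfty_eps (f : R -> \bar R) (l : R) :
  (forall e, 0 < e -> exists T0, forall T, T0 <= T -> 0 < T -> exists2 r, f T = r%:E & `|r - l| <= e) ->
  f T @[T --> +oo] --> l%:E.
Proof.
move=> H; apply/fine_cvgP; split.
  have [T0 hT] := H 1 ltr01; near=> T.
  have [||r -> _] := hT T; last by [].
    by near: T; exact: nbhs_pinfty_ge (num_real _).
  by near: T; exact: nbhs_pinfty_gt (num_real _).
apply/cvgrPdist_le => e /H[T0 hT]; near=> T.
have [||r /= -> hr] := hT T; last by rewrite distrC.
  by near: T; exact: nbhs_pinfty_ge (num_real _).
by near: T; exact: nbhs_pinfty_gt (num_real _).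
Unshelve. all: by end_near. Qed.

Lemma prob_Ex d (Omega : measurableType d) (P : probability Omega R) (A : set Omega) :
  measurable A -> L1 P (\1_A : Omega -> R) /\ P A = (Ex P (\1_A))%:E.
Proof.
move=> mA; have i1 : L1 P (\1_A : Omega -> R).
  apply: (L1_bounded (M := 1) P) => [//|w].
  by rewrite indicE; case: (w \in A); rewrite ?normr1 ?normr0.
by split => //; rewrite -(ExE i1) integral_indic// setIT.
Qed.

Lemma Phi_tails e : 0 < e -> exists2 A : R, 0 < A & forall z, A <= z -> 1 - e <= Phi z /\ Phi (- z) <= e.
Proof.
move=> e0.
have /cvgrPdist_le/(_ _ e0)[A1 [_ h1]] := @ncdf_cvg1 R 1.
have /cvgrPdist_le/(_ _ e0)[A2 [_ h2]] := @ncdf_cvg0 R 1.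
exists (`|A1| + `|A2| + 1) => [|z hz]; first by rewrite ltr_wpDl// addr_ge0.
have a1 := ler_norm A1; have a2 := ler_norm (- A2); rewrite normrN in a2.
have b1 := normr_ge0 A1; have b2 := normr_ge0 A2.
have z1 : A1 < z by lra.
have z2 : - z < A2 by lra.
split.
  by have := h1 z z1 => /(le_trans (ler_norm _)); rewrite /Phi; lra.
have := h2 (- z) z2; rewrite sub0r normrN => /(le_trans (ler_norm _)); exact.
Qed.

(** The limiting value, including the degenerate law away from its atom. *)
Definition limit_cdf sigma xi : R := if sigma == 0 then (0 < xi)%R%:R else Phi (xi / sigma).

Lemma limit_cdfE sigma xi : 0 <= sigma -> (sigma != 0) || (xi != 0) ->
  normal_cdf sigma xi = (limit_cdf sigma xi)%:E.
Proof.
move=> s0; rewrite /normal_cdf /limit_cdf; have [_|sn] /= := eqVneq sigma 0; last first.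
  by move=> _; rewrite ncdf_fin ncdf_scale// lt_neqAle eq_sym sn.
move=> xn; rewrite diracE.
have -> : ((0 : R) \in `]-oo, xi]%classic) = (0 <= xi) by apply/idP/idP; rewrite inE/= in_itv.
by rewrite le_eqVlt eq_sym (negbTE xn).
Qed.

Let combine_upper (x y z e : R) : `|y - z| <= e / 4 + e / 8 -> `|x - y| <= e / 2 -> x <= z + e.
Proof. by rewrite !ler_norml => /andP[? ?] /andP[? ?]; lra. Qed.

Let combine_lower (x y z e : R) : `|y - z| <= e / 4 + e / 8 -> `|x - y| <= e / 2 -> z - e <= x.
Proof. by rewrite !ler_norml => /andP[? ?] /andP[? ?]; lra. Qed.

Lemma smoothing_choice sigma xi e : 0 <= sigma -> (sigma != 0) || (xi != 0) -> 0 < e ->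
  exists k v : R, [/\ 0 < k, 0 < v, 1 - e <= Phi (isqrt v * k), Phi (- (isqrt v * k)) <= e &
    heat (v + sigma ^+ 2) (xi + 2 * k) <= limit_cdf sigma xi + e /\
    limit_cdf sigma xi - e <= heat (v + sigma ^+ 2) (xi - 2 * k)].
Proof.
move=> s0 hs e0; have [A A0 hA] := Phi_tails e0.
have small k : 0 < k -> forall v, 0 < v -> v <= (k / A) ^+ 2 -> A <= isqrt v * k.
  move=> k0 v v0 hv; rewrite isqrtE// mulrC ler_pdivlMr ?sqrtr_gt0//.
  have kA : 0 <= k / A by rewrite divr_ge0// ltW.
  have : Num.sqrt v <= k / A by rewrite -(ger0_norm kA) -sqrtr_sqr ler_sqrt// sqr_ge0.
  by rewrite ler_pdivlMr// mulrC.
rewrite /limit_cdf; have [sE|sn] := eqVneq sigma 0.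
  have xn : xi != 0 by move: hs; rewrite sE eqxx.
  pose k := `|xi| / 4; have k0 : 0 < k by rewrite divr_gt0// normr_gt0.
  pose v := (k / A) ^+ 2; have v0 : 0 < v by rewrite exprn_gt0// divr_gt0.
  have big := small k k0 v v0 (lexx _); have [t1 t2] := hA _ big.
  exists k, v; split => //; rewrite sE expr0n/= addr0.
  have i0 := isqrt_gt0 v.
  have [xp|xneg|x0] := ltgtP 0 xi; last by rewrite -x0 eqxx in xn.
  - have xk : xi = 4 * k by rewrite /k gtr0_norm//; field.
    split; first by have /andP[_ h] := heat01 v (xi + 2 * k); rewrite (le_trans h)// lerDl ltW.
    apply: (le_trans t1); apply: ncdf_homo; rewrite ler_pM2l//; lra.
  - have xk : xi = - (4 * k) by rewrite /k ltr0_norm//; field.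
    split; last by have /andP[h _] := heat01 v (xi - 2 * k); rewrite sub0r (le_trans _ h)// oppr_le0 ltW.
    rewrite add0r; apply: le_trans t2; apply: ncdf_homo; rewrite -mulrN ler_pM2l//; lra.
have sp : 0 < sigma by rewrite lt_neqAle eq_sym sn.
have s2p : 0 < sigma ^+ 2 by rewrite exprn_gt0.
have [B B0 HB] := heat_bounds s2p.
have B1 : 0 < B + 1 by rewrite ltr_wpDl.
pose k := e / (4 * (B + 1)); have k0 : 0 < k by rewrite divr_gt0// mulr_gt0.
pose v := Num.min ((k / A) ^+ 2) (Num.min 1 k).
have v0 : 0 < v by rewrite !lt_min k0 ltr01 exprn_gt0// divr_gt0.
have vk : v <= k by rewrite /v !ge_min lexx !orbT.
have v1 : v <= 1 by rewrite /v !ge_min lexx !orbT.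
have big := small k k0 v v0; rewrite ge_min lexx in big.
have [t1 t2] := hA _ (big isT).
exists k, v; split => //.
have -> : Phi (xi / sigma) = heat (sigma ^+ 2) xi.
  by rewrite /heat isqrtE// sqrtr_sqr gtr0_norm// mulrC.
have [_ [c2 _] _ hv] := HB _ (lexx (sigma ^+ 2)).
have sv : sigma ^+ 2 <= v + sigma ^+ 2 by rewrite lerDr ltW.
have [[c1 _] _ _ _] := HB _ sv.
have lipx := lip_of_drv (drv_heat (v + sigma ^+ 2)) c1.
have Bk : B * k <= e / 4.
  rewrite /k (_ : B * _ = B / (B + 1) * (e / 4)); last by field; rewrite gt_eqF.
  by rewrite ler_piMl ?divr_ge0 ?(ltW e0)// ler_pdivrMr// mul1r lerDl.
have d1 : `|heat (v + sigma ^+ 2) xi - heat (sigma ^+ 2) xi| <= e / 4 + e / 8.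
  have hvv := hv v xi (ltW v0); have h2 := c2 xi.
  rewrite (addrC v); rewrite -[X in `|X|](subrK (v * (2^-1 * heat2 (sigma ^+ 2) xi))).
  apply: (le_trans (ler_normD _ _)); apply: lerD.
    apply: (le_trans hvv); apply: le_trans Bk; apply: ler_wpM2l => //.
    rewrite expr2; apply: le_trans vk; rewrite -[X in _ <= X]mulr1.
    by apply: ler_wpM2l => //; exact: ltW.
  rewrite (normrM v) (normrM 2^-1) (gtr0_norm v0) (ger0_norm (_ : 0 <= 2^-1 :> R)) ?invr_ge0//.
  apply: le_trans (_ : k * (2^-1 * B) <= _); last by move: Bk; lra.
  have h3 : 0 <= 2^-1 * `|heat2 (sigma ^+ 2) xi| by apply: mulr_ge0 => //; rewrite invr_ge0.
  have h4 : 2^-1 * `|heat2 (sigma ^+ 2) xi| <= 2^-1 * B by apply: ler_wpM2l => //; rewrite invr_ge0.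
  exact: (ler_pM (ltW v0) h3 vk h4).
have d2 (r : R) : `|r| = 2 * k -> `|heat (v + sigma ^+ 2) (xi + r) - heat (v + sigma ^+ 2) xi| <= e / 2.
  move=> hr; apply: (le_trans (lipx _ _)); have -> : xi + r - xi = r by ring.
  by rewrite hr; move: Bk; clear; lra.
have k2 : `|2 * k| = 2 * k by rewrite ger0_norm// mulr_ge0// ltW.
have k2' : `|- (2 * k)| = 2 * k by rewrite normrN.
have e1 := d2 _ k2; have e2 := d2 _ k2'.
by split; [exact: (combine_upper d1 e1)|exact: (combine_lower d1 e2)].
Qed.

(** Comparison of the indicator of a half line with its smoothing, at nearby
    points. *)
Lemma indicator_smoothing xi k v x y e : 0 < k -> 0 < v -> 1 - e <= Phi (isqrt v * k) ->
  Phi (- (isqrt v * k)) <= e -> 0 <= e ->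
  heat v (xi - 2 * k - x) - e - `|x - y| / k <= (y < xi)%R%:R <=
  heat v (xi + 2 * k - x) + e + `|x - y| / k.
Proof.
move=> k0 v0 h1 h2 e0; have i0 := isqrt_gt0 v.
have /andP[p1 p2] := heat01 v (xi - 2 * k - x); have /andP[p3 p4] := heat01 v (xi + 2 * k - x).
have r0 : 0 <= `|x - y| / k by rewrite divr_ge0// ltW.
have [near|far] := ltP `|x - y| k; last first.
  have r1 : 1 <= `|x - y| / k by rewrite ler_pdivlMr// mul1r.
  by case: (y < xi); apply/andP; split => //=; lra.
move: near; rewrite ltr_norml => /andP[n1 n2].
case: (ltP y xi) => hy; apply/andP; split => /=; try lra.
- have : Phi (isqrt v * k) <= heat v (xi + 2 * k - x) by apply: ncdf_homo; rewrite ler_pM2l//; lra.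
  lra.
- have : heat v (xi - 2 * k - x) <= Phi (- (isqrt v * k)).
    by apply: ncdf_homo; rewrite -[X in _ <= X]mulrN ler_pM2l//; lra.
  lra.
Qed.

End distribution_functions.

(** * The limit theorems *)

Section limit_theorems.
Context {R : realType} {E : polishMetricType R}.
Context {d : measure_display} {Omega : measurableType d}.
Variables (P : probability Omega R) (Pt : R -> R.-pker (borel E) ~> (borel E)).
Variables (mu0 : probability (borel E) R) (X : R -> {RV P >-> borel E}).
Hypothesis XM : markov_process X Pt mu0.
Hypothesis mu0_P1 : finite_first_moment mu0.
Hypothesis sg : transition_semigroup Pt.
Hypothesis h0 : H0 Pt.
Variables (c gam : R).
Hypotheses (c0 : 0 < c) (gam0 : 0 < gam).
Hypothesis P1_stable : forall (t : R) (mu : probability (borel E) R), 0 <= t ->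
  finite_first_moment mu -> finite_first_moment (kernel_push mu (Pt t)).
Hypothesis contr : forall (t : R) (mu nu : probability (borel E) R), 0 <= t ->
  finite_first_moment mu -> finite_first_moment nu ->
  (wasserstein (kernel_push mu (Pt t)) (kernel_push nu (Pt t)) <=
   (c * expR (- gam * t))%:E * wasserstein mu nu)%E.
Variable mu : probability (borel E) R.
Hypothesis mu_inv : invariant_law Pt mu.
Hypothesis mu_P1 : finite_first_moment mu.
Variable o : E.
Local Notation TR := (measurableTypeR R).
Local Notation Pf t f := (kernel_op (Pt t) f).
Local Notation kap := (kappa c gam).
Local Notation V := (weight mu o).
Local Notation Y := (proc X).
Local Notation past := (past X).
Implicit Types (a b s t : R) (f : E -> R).

Let bfield_proc' := bfield_proc XM mu0_P1 c0 gam0 P1_stable contr mu_inv mu_P1 o.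

Lemma time_integralE f K T : lip K f -> time_integral X f T = Sf X 0 T f.
Proof.
move=> hf; apply/funext => w; rewrite /Sf /tint Ex_tmE.
  apply: eq_Rintegral => s; rewrite inE/= in_itv/= => /andP[s0 _].
  by rewrite /pfield /= /proc pos_timeE.
exact: (measurable_fun_pair2 (f := pfield X f) w (meas_pfield XM hf)).
Qed.

Lemma wlln_in_probability f K : 0 <= K -> lip K f ->
  cvg_in_probability P (fun T w => T^-1 * time_integral X f T w) (Ex mu (f : borel E -> R)).
Proof.
move=> K0 hf eps eps0; apply: cvg_pinfty_eps => e e0.
have [T0 hT] := wlln_L1 XM mu0_P1 sg h0 c0 gam0 P1_stable contr mu_inv mu_P1 o K0 hf (mulr_gt0 e0 eps0).
exists T0 => T TT T1; rewrite (time_integralE T hf).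
have iS := L1_tint 0 T (bfield_proc' hf).
pose y w := `|T^-1 * Sf X 0 T f w - Ex mu (f : borel E -> R)|.
have iy : L1 P y by exact: L1_norm (L1B (L1Z _ iS) (L1_cst P _)).
have mA : measurable [set w | eps <= y w].
  rewrite (_ : [set w | _] = y @^-1` `[eps, +oo[%classic).
    by rewrite -[X in measurable X]setTI; exact: (L1_meas iy).
  by apply/seteqP; split => w /=; rewrite in_itv/= andbT.
have [i1 pE] := prob_Ex P mA; exists (Ex P (\1_[set w | eps <= y w])); first exact: pE.
rewrite subr0 ger0_norm; last by apply: Ex_ge0 => w; rewrite indicE.
have hE : Ex P y <= e * eps by exact: hT T TT T1.
apply: le_trans (_ : Ex P (fun w => eps^-1 * y w) <= _).
  apply: Ex_le => //; first exact: L1Z.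
  move=> w; rewrite indicE; case: (boolP (w \in _)) => [|_].
    by rewrite inE /= => h; rewrite mulrC ler_pdivlMr// mul1r.
  by rewrite mulr_ge0// ?invr_ge0 ?(ltW eps0)// normr_ge0.
by rewrite (ExZ _ iy) mulrC ler_pdivrMr.
Qed.

Hypothesis ui : forall e, 0 < e -> exists2 K, 0 <= K & forall s,
  L1 P (fun w => Num.max 0 (growth mu o (Y s w) - K) ^+ 2) /\
  Ex P (fun w => Num.max 0 (growth mu o (Y s w) - K) ^+ 2) <= e.
Variables (g : E -> R) (L : R).
Hypotheses (L0 : 0 <= L) (hg : lip L g) (g0 : Ex mu (g : borel E -> R) = 0).
Local Notation chi := (chi Pt g).
Local Notation D := (mart Pt X g).
Local Notation S T := (Sf X 0 T g).

Let iD a b : 0 <= a -> a <= b -> ceq P (past a) (D a b) (fun=> 0).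
Proof. exact: (ceq_mart XM mu0_P1 sg h0 c0 gam0 P1_stable contr mu_inv mu_P1 o L0 hg g0). Qed.
Let hchi := lip_chi' sg h0 c0 gam0 P1_stable contr mu_inv mu_P1 o L0 hg g0.
Let iD2 a b : 0 <= a -> a <= b -> L1 P (fun w => D a b w ^+ 2).
Proof. exact: (L1_sq_mart XM mu0_P1 sg h0 c0 gam0 P1_stable contr mu_inv mu_P1 ui L0 hg g0). Qed.
Let amart a : 0 <= a -> approx X a (D 0 a).
Proof. exact: (approx_mart XM mu0_P1 sg h0 c0 gam0 P1_stable contr mu_inv mu_P1 o L0 hg g0). Qed.

(** The boundary term separating the integral from the martingale is bounded in
    mean square. *)
Let boundary : exists C, forall T, 0 <= T ->
  L1 P (fun w => (D 0 T w - S T w) ^+ 2) /\ Ex P (fun w => (D 0 T w - S T w) ^+ 2) <= C.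
Proof.
have [A A0 hA] := common_growth sg h0 c0 gam0 P1_stable contr mu_inv mu_P1 o L0 hg g0.
have [M2 hM] := growth_sq (X := X) ui.
exists (4 * A ^+ 2 * M2) => T T0.
have [i1 b1] := hM T; have [i2 b2] := hM 0.
have hb w : `|(D 0 T w - S T w) ^+ 2| <= 2 * A ^+ 2 * (growth mu o (Y T w) ^+ 2 + growth mu o (Y 0 w) ^+ 2).
  rewrite ger0_norm ?sqr_ge0// /mart addrC addKr.
  have [_ h1] := hA (Y T w); have [_ h2] := hA (Y 0 w).
  apply: le_trans (sqrB_le _ _) _; rewrite -mulrA ler_pM2l// mulrDr -!exprMn.
  have q s : `|chi (Y s w)| <= A * growth mu o (Y s w) -> chi (Y s w) ^+ 2 <= (A * growth mu o (Y s w)) ^+ 2.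
    by move=> h; rewrite -(real_normK (num_real (chi _))) ler_pXn2r// nnegrE (le_trans _ h).
  by apply: lerD; exact: q.
have [j1 _ _] := iD (lexx 0) T0.
have mB : measurable_fun setT (fun w => (D 0 T w - S T w) ^+ 2).
  by apply: measurable_funX; apply: measurable_funB; [exact: L1_meas j1|exact: (L1_meas (L1_tint 0 T (bfield_proc' hg)))].
have iB := L1Z (2 * A ^+ 2) (L1D i1 i2).
split; first exact: L1_dom mB hb iB.
apply: (le_trans (ler_norm _)); apply: (le_trans (Ex_dom mB hb iB)).
rewrite (ExZ _ (L1D i1 i2)) (ExD i1 i2) (_ : 4 * A ^+ 2 * M2 = 2 * A ^+ 2 * (M2 + M2)); last by ring.
by apply: ler_wpM2l; [rewrite mulr_ge0 ?sqr_ge0|exact: lerD].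
Qed.

Variable q : R.
Hypothesis sqm : forall e, 0 < e -> exists2 C, 0 <= C & forall a Z F l M, past_weight X a Z F l M ->
  forall b, a <= b ->
  `|Ex P (fun w => F (Z w) * D a b w ^+ 2) - 2 * q * (b - a) * Ex P (fun w => F (Z w))| <= M * (C + e * (b - a)).

Let varD e : 0 < e -> exists2 C, 0 <= C & forall T, 0 <= T ->
  `|Ex P (fun w => D 0 T w ^+ 2) - 2 * q * T| <= C + e * T.
Proof.
move=> e0; have [C C0 hC] := sqm e0; exists C => // T T0.
have hw : past_weight X 0 (D 0 0) (fun=> 1) 0 1.
  by split => // [|x y|x]; [exact: amart|rewrite subrr normr0 mul0r|rewrite normr1].
have := hC _ _ _ _ _ hw T T0; rewrite subr0 mul1r (Ex_cst P) mulr1.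
by rewrite (_ : Ex P (fun w => 1 * D 0 T w ^+ 2) = Ex P (fun w => D 0 T w ^+ 2))//; apply: eq_Ex => w; rewrite mul1r.
Qed.

Lemma variance_ge0 : 0 <= 2 * q.
Proof.
rewrite leNgt; apply/negP => qn.
have e0 : 0 < - (2 * q) / 2 by rewrite divr_gt0// oppr_gt0.
have [C C0 hC] := varD e0.
pose T := (C + 1) / (- (2 * q) / 2); have T0 : 0 < T by rewrite divr_gt0// ltr_wpDl.
have E0 : 0 <= Ex P (fun w => D 0 T w ^+ 2) by apply: Ex_ge0 => w; exact: sqr_ge0.
have := hC T (ltW T0) => /(le_trans (ler_norm _)).
have Tq : - (2 * q) / 2 * T = C + 1 by rewrite /T; field; rewrite lt_eqF//; lra.
by move: E0; lra.
Qed.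

Let gap_sq (x y k : R) : 0 < k -> `|y ^+ 2 - x ^+ 2| <= (1 + k^-1) * (x - y) ^+ 2 + k * x ^+ 2.
Proof.
move=> k0; have e1 : y ^+ 2 - x ^+ 2 = (x - y) ^+ 2 - 2 * (x * (x - y)) by ring.
rewrite e1; move: (x - y) => r.
have h1 : 0 <= k^-1 * (r - k * x) ^+ 2 by rewrite mulr_ge0 ?sqr_ge0// invr_ge0 ltW.
have h2 : 0 <= k^-1 * (r + k * x) ^+ 2 by rewrite mulr_ge0 ?sqr_ge0// invr_ge0 ltW.
have e2 : k^-1 * (r - k * x) ^+ 2 = k^-1 * r ^+ 2 - 2 * (x * r) + k * x ^+ 2 by field; rewrite gt_eqF.
have e3 : k^-1 * (r + k * x) ^+ 2 = k^-1 * r ^+ 2 + 2 * (x * r) + k * x ^+ 2 by field; rewrite gt_eqF.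
rewrite e2 in h1; rewrite e3 in h2; have h3 := sqr_ge0 r.
by rewrite mulrDl mul1r ler_norml; apply/andP; split; lra.
Qed.

Lemma variance_limit : ((T^-1)%:E * 'E_P[fun w => (time_integral X g T w ^+ 2)%R])%E @[T --> +oo] --> (2 * q)%:E.
Proof.
apply: cvg_pinfty_eps => e e0; have [C' hC'] := boundary.
have e40 : 0 < e / 4 by rewrite divr_gt0.
have [C C0 hC] := varD e40; have q0 := variance_ge0.
have q1 : 0 < 4 * (2 * q + 1) by rewrite mulr_gt0// ltr_wpDl.
pose k := Num.min 1 (e / (4 * (2 * q + 1))).
have k0 : 0 < k by rewrite lt_min ltr01 divr_gt0.
have k1 : k <= 1 by rewrite ge_min lexx.
have kq : k * (2 * q) <= e / 4.
  apply: le_trans (_ : e / (4 * (2 * q + 1)) * (2 * q) <= _).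
    by apply: ler_wpM2r => //; rewrite ge_min lexx orbT.
  rewrite mulrAC ler_pdivrMr// (_ : e / 4 * (4 * (2 * q + 1)) = e * (2 * q) + e); last by field.
  by rewrite lerDl ltW.
pose K := C + ((1 + k^-1) * C' + k * C).
exists (4 * K / e) => T TT T0.
have [ir br] := hC' T (ltW T0); have hD := hC T (ltW T0); have iD2' := iD2 (lexx 0) (ltW T0).
have mS : measurable_fun setT (S T) := L1_meas (L1_tint 0 T (bfield_proc' hg)).
have iB := L1D (L1Z (1 + k^-1) ir) (L1Z k iD2').
have iS : L1 P (fun w => S T w ^+ 2).
  have iX : L1 P (fun w => S T w ^+ 2 - D 0 T w ^+ 2).
    apply: (L1_dom _ _ iB) => [|w]; last exact: gap_sq.
    by apply: measurable_funB; [exact: measurable_funX|exact: L1_meas iD2'].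
  by apply: (eq_L1 _ (L1D iX iD2')) => w; rewrite subrK.
exists (T^-1 * Ex P (fun w => S T w ^+ 2)).
  by rewrite (time_integralE T hg) unlock (ExE iS).
have h1 : `|Ex P (fun w => S T w ^+ 2) - Ex P (fun w => D 0 T w ^+ 2)| <=
    (1 + k^-1) * C' + k * (2 * q * T + (C + e / 4 * T)).
  rewrite -(ExB iS iD2'); apply: le_trans (Ex_dom (L1_meas (L1B iS iD2')) (fun w => gap_sq _ _ k0) iB) _.
  rewrite (ExD (L1Z (1 + k^-1) ir) (L1Z k iD2')) (ExZ _ ir) (ExZ _ iD2'); apply: lerD.
    by apply: ler_wpM2l => //; rewrite addr_ge0// invr_ge0 ltW.
  apply: ler_wpM2l; first exact: ltW.
  by have := le_trans (ler_norm _) hD; rewrite lerBlDl.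
move: h1 hD; move: (Ex P (fun w => S T w ^+ 2)) (Ex P (fun w => D 0 T w ^+ 2)) => x y h1 hD.
have TK : K <= e / 4 * T by move: TT; rewrite ler_pdivrMr//; lra.
have b1 : k * (2 * q * T) <= e / 4 * T by rewrite mulrA ler_wpM2r// ltW.
have b2 : k * (e / 4 * T) <= e / 4 * T by rewrite ler_piMl// mulr_ge0 ?(ltW T0) ?(ltW e40).
have -> : T^-1 * x - 2 * q = T^-1 * (x - 2 * q * T) by field; rewrite gt_eqF.
rewrite normrM gtr0_norm ?invr_gt0// mulrC ler_pdivrMr//.
apply: (le_trans (ler_distD y _ _)); apply: (le_trans (lerD h1 hD)).
rewrite /K in TK; rewrite !mulrDr; move: b1 b2 TK.
set u1 := k * (2 * q * T); set u2 := k * (e / 4 * T); set u3 := k * C; set u4 := _ * C'.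
by lra.
Qed.

Let lind xi v : 0 < v -> forall e, 0 < e -> exists T0, forall T, T0 <= T -> 0 < T ->
  `|Ex P (fun w => heat v (xi - D 0 T w / Num.sqrt T)) - heat (v + 2 * q) xi| <= e.
Proof.
move=> v0; apply: (@lindeberg _ _ _ P (fun a => D 0 a) D (2 * q)).
- exact: variance_ge0.
- by move=> w; apply: mart0; eassumption.
- by move=> a a0; have [i _ _] := iD (lexx 0) a0; exact: L1_meas i.
- exact: (mart_split XM mu0_P1 c0 gam0 P1_stable contr mu_inv mu_P1 o hg).
- by move=> a b a0 ab; have [i _ _] := iD a0 ab; split => //; exact: iD2.
- move=> a b F l M a0 ab Fl FM; rewrite (approx_ceq (amart a0) Fl FM (iD a0 ab)).
  apply: (etrans _ (Ex0 P)); apply: eq_Ex => w; exact: mulr0.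
- move=> e e0; have [C C0 hC] := sqm e0; exists C => // a b F l M a0 ab Fl FM.
  by apply: (hC a (D 0 a) F l M) => //; split => //; exact: amart.
- exact: (mart_tails XM mu0_P1 sg h0 c0 gam0 P1_stable contr mu_inv mu_P1 ui L0 hg g0).
- exact: v0.
Qed.

Let squeeze (p r a b A B l e : R) : `|a - A| <= e / 4 -> `|b - B| <= e / 4 ->
  A <= l + e / 4 -> l - e / 4 <= B -> p <= a + e / 4 + r -> b - e / 4 - r <= p -> r <= e / 4 ->
  `|p - l| <= e.
Proof.
rewrite !ler_norml => /andP[h1 h2] /andP[h3 h4] h5 h6 h7 h8 h9.
by apply/andP; split; lra.
Qed.

Lemma central_limit sigma xi : 0 <= sigma -> sigma ^+ 2 = 2 * q -> (sigma != 0) || (xi != 0) ->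
  P [set w | (Num.sqrt T)^-1 * time_integral X g T w < xi] @[T --> +oo] --> normal_cdf sigma xi.
Proof.
move=> s0 sq hs; rewrite limit_cdfE//; apply: cvg_pinfty_eps => e e0.
have e40 : 0 < e / 4 by rewrite divr_gt0.
have [k [v [k0 v0 t1 t2 [up lo]]]] := smoothing_choice s0 hs e40; rewrite sq in up lo.
have [C hC] := boundary.
have C0 : 0 <= C by have [_] := hC 0 (lexx 0); apply: le_trans; apply: Ex_ge0 => w; exact: sqr_ge0.
have [T1 h1] := lind (xi + 2 * k) v0 e40; have [T2 h2] := lind (xi - 2 * k) v0 e40.
pose B := (1 + C) / (k * (e / 4)); have B0 : 0 <= B by rewrite divr_ge0 ?addr_ge0// mulr_ge0// ltW.
exists (Num.max (B ^+ 2) (Num.max T1 T2)) => T; rewrite ge_max => /andP[TB]; rewrite ge_max => /andP[TT1 TT2] T0.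
have {}h1 := h1 T TT1 T0; have {}h2 := h2 T TT2 T0.
have r0 : 0 < Num.sqrt T by rewrite sqrtr_gt0.
have [ir br] := hC T (ltW T0); have [iDT _ _] := iD (lexx 0) (ltW T0).
have iS : L1 P (S T) := L1_tint 0 T (bfield_proc' hg).
pose y w := (Num.sqrt T)^-1 * S T w; pose x w := D 0 T w / Num.sqrt T.
have my : measurable_fun setT y := L1_meas (L1Z _ iS).
have mA : measurable [set w | y w < xi].
  rewrite (_ : [set w | _] = y @^-1` `]-oo, xi[%classic).
    by rewrite -[X in measurable X]setTI; exact: my.
  by apply/seteqP; split => w /=; rewrite in_itv.
have [i1 pE] := prob_Ex P mA; exists (Ex P (\1_[set w | y w < xi])).
  by rewrite (time_integralE T hg); exact: pE.
have ind w : \1_[set w | y w < xi] w = (y w < xi)%R%:R :> R.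
  by rewrite indicE; congr (nat_of_bool _)%:R; apply/idP/idP; rewrite inE.
pose r w := `|x w - y w| / k.
have iX : L1 P (fun w => x w - y w).
  by apply: L1B; [apply: (eq_L1 _ (L1Z (Num.sqrt T)^-1 iDT)) => w; rewrite mulrC|exact: L1Z].
have ir' : L1 P r by apply: (eq_L1 _ (L1Z k^-1 (L1_norm iX))) => w; rewrite mulrC.
have Er : Ex P r <= e / 4.
  apply: le_trans (_ : Ex P (fun w => (Num.sqrt T * k)^-1 * (1 + (D 0 T w - S T w) ^+ 2)) <= _).
    apply: Ex_le => //; first by apply: L1Z; exact: L1_addcst.
    move=> w; rewrite /r (_ : x w - y w = (Num.sqrt T)^-1 * (D 0 T w - S T w)); last by rewrite /x /y; ring.
    rewrite normrM gtr0_norm ?invr_gt0// invfM mulrAC; apply: ler_wpM2l.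
      by rewrite mulr_ge0 ?invr_ge0// ltW.
    move: (D 0 T w - S T w) => z; rewrite -(real_normK (num_real z)).
    by have := sqr_ge0 (`|z| - 1); have := normr_ge0 z; move: (`|z|) => u; nra.
  have i2 := L1_addcst 1 ir.
  rewrite (ExZ _ i2) (ExD (L1_cst P 1) ir) (Ex_cst P) mulrC ler_pdivrMr ?mulr_gt0//.
  apply: le_trans (_ : 1 + C <= _); first by rewrite lerD2l.
  have : B <= Num.sqrt T by rewrite -(ger0_norm B0) -sqrtr_sqr ler_sqrt// ltW.
  by rewrite /B ler_pdivrMr ?mulr_gt0// (_ : Num.sqrt T * (k * (e / 4)) = e / 4 * (Num.sqrt T * k)); last by ring.
have iH z : L1 P (fun w => heat v (z - x w)).
  apply: (L1_bounded (M := 1) P) => [|w]; last by have /andP[? ?] := heat01 v (z - x w); rewrite ger0_norm.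
  have [B1 B10 HB] := heat_bounds v0; have [[c1 _] _ _ _] := HB v (lexx v).
  apply: (lipR_meas (lip_of_drv (drv_heat v) c1)); apply: measurable_funB => //.
  by apply: measurable_funM => //; exact: L1_meas iDT.
have sm w := indicator_smoothing xi (x w) (y w) k0 v0 t1 t2 (ltW e40).
have U : Ex P (\1_[set w | y w < xi]) <= Ex P (fun w => heat v (xi + 2 * k - x w)) + e / 4 + Ex P r.
  rewrite -[e / 4](Ex_cst P) -(ExD (iH _) (L1_cst P _)) -(ExD (L1D (iH _) (L1_cst P _)) ir').
  apply: Ex_le => //; first exact: (L1D (L1D (iH _) (L1_cst P _)) ir').
  by move=> w; rewrite ind; have /andP[] := sm w.
have W : Ex P (fun w => heat v (xi - 2 * k - x w)) - e / 4 - Ex P r <= Ex P (\1_[set w | y w < xi]).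
  rewrite -[e / 4](Ex_cst P) -(ExB (iH _) (L1_cst P _)) -(ExB (L1B (iH _) (L1_cst P _)) ir').
  apply: Ex_le => //; first exact: (L1B (L1B (iH _) (L1_cst P _)) ir').
  by move=> w; rewrite ind; have /andP[] := sm w.
exact: (squeeze h1 h2 up lo U W Er).
Qed.

End limit_theorems.

Local Open Scope ereal_scope.

Theorem theorem2p1 (R : realType) (E : polishMetricType R)
  (d : measure_display) (Omega : measurableType d) (P : probability Omega R)
  (Pt : R -> R.-pker (borel E) ~> (borel E))
  (mu0 : probability (borel E) R) (X : R -> {RV P >-> borel E})
  (psi : E -> R)
  (Pt_semigroup : transition_semigroup Pt)
  (X_markov : markov_process X Pt mu0)
  (mu0_P1 : finite_first_moment mu0)
  (psi_lip : lipschitz_fun psi) :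
  H0 Pt -> H1 Pt ->
  exists mu_star : probability (borel E) R,
    [/\ invariant_law Pt mu_star,
        forall nu : probability (borel E) R,
          invariant_law Pt nu -> nu ≡μ mu_star,
        finite_first_moment mu_star &
        let v_star : R := (\int[mu_star]_x psi x)%R in
        cvg_in_probability P
          (fun T w => (T^-1 * time_integral X psi T w)%R) v_star /\
        (let psi_tilde := fun x : E => (psi x - v_star)%R in
         forall delta : R, (0 < delta)%R -> H2 Pt delta -> H3 X delta ->
         exists2 sigma : R, (0 <= sigma)%R &
           ((T^-1)%:E * 'E_P[fun w => (time_integral X psi_tilde T w ^+ 2)%R]
              @[T --> +oo%R] --> (sigma ^+ 2)%:E) /\
           (forall xi : R, (sigma != 0%R) || (xi != 0%R) ->
             P [set w | ((Num.sqrt T)^-1 * time_integral X psi_tilde T w < xi)%R]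
               @[T --> +oo%R] --> normal_cdf sigma xi))].
Proof.
move=> h0 [P1_stable [c [gam [c0 gam0 contr]]]].
have [x0 _] := mu0_P1.
have [mu [mu_inv mu_P1]] := invariant_exists Pt_semigroup c0 gam0 P1_stable contr x0.
have [L L0 hL] := lipschitz_funP psi_lip.
exists mu; split => //.
  move=> nu hnu A mA.
  exact: (invariant_unique c0 gam0 P1_stable contr mu_inv mu_P1 hnu mA).
split.
  by eapply wlln_in_probability; try exact contr; eassumption.
move=> psi_tilde delta delta0 _ h3.
have ui := moments_ui mu x0 delta0 h3.
have hg : lip L psi_tilde by exact: lipBc.
have g0 : Rintegral mu setT (psi_tilde : borel E -> R) = 0%R.
  by rewrite (ExB (L1_inv mu_P1 hL) (L1_cst mu _)) (Ex_cst mu) subrr.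
have [q hq] : exists q : R, forall e : R, (0 < e)%R -> exists2 K : R, (0 <= K)%R &
    (forall s : R, Ex P (fun w => `|corr Pt psi_tilde (proc X s w) - corr_trunc Pt psi_tilde K (proc X s w)|%R) <= e)%R /\
    (`|Ex mu (corr_trunc Pt psi_tilde K) - q| <= e)%R.
  by eapply corr_limit; try exact contr; try exact hg; eassumption.
have sqm : forall e : R, (0 < e)%R -> exists2 C : R, (0 <= C)%R & forall a Z F l M, past_weight X a Z F l M ->
    forall b : R, (a <= b)%R ->
    (`|Ex P (fun w => F (Z w) * mart Pt X psi_tilde a b w ^+ 2) - 2 * q * (b - a) * Ex P (fun w => F (Z w))|
      <= M * (C + e * (b - a)))%R.
  by eapply sq_mart; try exact contr; try exact hg; eassumption.
have q0 : (0 <= 2 * q)%R by eapply variance_ge0; try exact contr; try exact hg; eassumption.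
have sE : (Num.sqrt (2 * q) ^+ 2 = 2 * q)%R by rewrite sqr_sqrtr.
exists (Num.sqrt (2 * q)); first exact: sqrtr_ge0.
rewrite sE; split.
  by eapply variance_limit; try exact contr; try exact hg; eassumption.
move=> xi hxi; have s0 := sqrtr_ge0 (2 * q)%R.
by eapply central_limit; try exact contr; try exact hg; eassumption.
Unshelve. all: exact x0.
Qed.
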